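(* Let $(R,\mathfrak m,k)$ be a local ring. For each $R$-module $M$ and each integer $n$, let $$\varepsilon^n_M=\operatorname{Ext}^n_R(k,\pi^M)\colon \operatorname{Ext}^n_R(k,M)\to\operatorname{Ext}^n_R(k,M/\mathfrak m M)$$ be the map of $R$-modules induced by the natural map $\pi^M\colon M\to M/\mathfrak m M$. The following conditions are equivalent. (i) $R$ is regular. (ii) $\varepsilon^n_R\ne 0$ for some integer $n$. (iii) $\varepsilon^n_M\neq 0$ for some $R$-module $M$ of finite projective dimension and some integer $n$. (iv) $\varepsilon^d_M\ne 0$ for every finite $R$-module $M\neq 0$ and for $d=\dim R$. (v) $\operatorname{Coker}(\partial^F_n)$, where $F$ is a minimal free resolution of $k$ over $R$, has a non-zero free direct summand for some integer $n$.
   Context: A local ring $(R,\mathfrak m,k)$ is a commutative noetherian local ring $R$ with maximal ideal $\mathfrak m$ and residue field $k=R/\mathfrak m$. A finite module is a finitely generated module; in (iii) the module $M$ is not assumed finite. $\dim R$ is the Krull dimension. For a complex $F$, $\partial^F_n\colon F_n\to F_{n-1}$ denotes its $n$-th differential; a minimal free resolution of $k$ has $F_i=0$ for $i<0$. *)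

(* Defs.v *)
From HB Require Import structures.
From mathcomp Require Import all_boot all_order all_algebra.
From mathcomp Require Import ring_quotient generic_quotient.
From mathcomp Require Import boolp classical_sets functions.

Set Implicit Arguments.
Unset Strict Implicit.
Unset Printing Implicit Defensive.

Import GRing.Theory.
Local Open Scope ring_scope.
Local Open Scope quotient_scope.

(* Rings and modules carry a decidable equality and a choice operator; with the
   axioms of boolp every type does, so [lmodType R] covers all R-modules and
   the boolean predicates [{pred M}] cover all subsets of M. *)

Section Hom.
Variables (R : comNzRingType) (U V : lmodType R).

Definition linear_pred : {pred U -> V} := fun f => `[< linear f >].

Lemma linear_predP (f : U -> V) : f \in linear_pred -> linear f.
Proof. exact: asboolW. Qed.

Definition linear_Sub (f : U -> V) (Pf : f \in linear_pred) : {linear U -> V} :=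
  HB.pack f (GRing.isLinear.Build R U V *:%R f (linear_predP Pf)).

Lemma linear_Sub_rect (K : {linear U -> V} -> Type) :
  (forall f (Pf : f \in linear_pred), K (linear_Sub Pf)) ->
  forall u : {linear U -> V}, K u.
Proof.
move=> Ksub u; have Pu : (u : U -> V) \in linear_pred by apply/asboolP/linearP.
have <- : linear_Sub Pu = u; last exact: Ksub.
case: u Pu => f [[[f0 fD]] [fZ]] Pu; rewrite /linear_Sub /=.
congr (GRing.Linear.Pack (GRing.Linear.Class _ _)).
  case: (X in X = _) => -[g0 gD].
  by congr (GRing.isNmodMorphism.phant_Build (_, _)); exact: Prop_irrelevance.
by case: (X in X = _) => gZ; congr GRing.isScalable.phant_Build;
  exact: Prop_irrelevance.
Qed.

Lemma linear_SubK (f : U -> V) (Pf : f \in linear_pred) :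
  linear_Sub Pf = f :> (U -> V).
Proof. by []. Qed.

HB.instance Definition _ :=
  isSub.Build (U -> V) linear_pred {linear U -> V} linear_Sub_rect linear_SubK.
HB.instance Definition _ := [Choice of {linear U -> V} by <:].

Lemma linear_pred_submod : submod_closed linear_pred.
Proof.
split.
  by apply/asboolP => a x y; rewrite /GRing.zero/= scaler0 addr0.
move=> a f g /linear_predP lf /linear_predP lg; apply/asboolP => b x y.
rewrite -[LHS]/(a *: f (b *: x + y) + g (b *: x + y)).
rewrite -[RHS]/(b *: (a *: f x + g x) + (a *: f y + g y)).
by rewrite lf lg !scalerDr !scalerA (mulrC a b) addrACA.
Qed.
HB.instance Definition _ :=
  GRing.isSubmodClosed.Build R (U -> V) linear_pred linear_pred_submod.
HB.instance Definition _ := [SubChoice_isSubLmodule of {linear U -> V} by <:].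

End Hom.

Section Kernel.
Variables (R : comNzRingType) (U V : lmodType R) (f : {linear U -> V}).

Definition ker_pred : {pred U} := fun x => f x == 0.

Lemma ker_pred_submod : submod_closed ker_pred.
Proof.
split=> [|a x y]; rewrite !unfold_in; first by rewrite linear0.
by move=> /eqP fx /eqP fy; rewrite linearP fx fy scaler0 addr0.
Qed.
HB.instance Definition _ :=
  GRing.isSubmodClosed.Build R U ker_pred ker_pred_submod.

Record kernel : Type := Kernel {ker_val :> U; _ : ker_val \in ker_pred}.

HB.instance Definition _ := [isSub for ker_val].
HB.instance Definition _ := [Choice of kernel by <:].
HB.instance Definition _ := [SubChoice_isSubLmodule of kernel by <:].

Definition im_pred : {pred V} := fun y => `[< exists x, f x = y >].

Lemma im_pred_submod : submod_closed im_pred.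
Proof.
split=> [|a _ _ /asboolP[x <-] /asboolP[y <-]]; apply/asboolP.
  by exists 0; rewrite linear0.
by exists (a *: x + y); rewrite linearP.
Qed.
HB.instance Definition _ :=
  GRing.isSubmodClosed.Build R V im_pred im_pred_submod.

End Kernel.

Section QuotientModule.
Variables (R : comNzRingType) (M : lmodType R) (N : submodClosed M).

(* [submodClosed] does not inherit from [zmodClosed], which the library's
   quotient groups require; [zmod_pred] is N itself, with that structure. *)
Definition zmod_pred : {pred M} := N.

Lemma zmod_pred_closed : zmod_closed zmod_pred.
Proof. exact/GRing.submod_closedB/submodClosedP. Qed.
HB.instance Definition _ :=
  GRing.isZmodClosed.Build M zmod_pred zmod_pred_closed.

Definition quot_mod : Type := Quotient.quot zmod_pred.
HB.instance Definition _ := GRing.Zmodule.on quot_mod.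

Definition quot_pi (x : M) : quot_mod := \pi_(Quotient.quot zmod_pred)%type x.
Definition quot_scale (a : R) (u : quot_mod) : quot_mod :=
  quot_pi (a *: repr (u : (Quotient.quot zmod_pred))).

Lemma quot_pi_eq x y : (quot_pi x = quot_pi y) <-> (x - y \in N).
Proof. by split=> [|xyN]; [move/eqmodP|apply/eqmodP]. Qed.

Lemma quot_piP (u : quot_mod) : exists x, u = quot_pi x.
Proof. by exists (repr (u : (Quotient.quot zmod_pred))); rewrite /quot_pi reprK. Qed.

Lemma quot_piD x y : quot_pi (x + y) = quot_pi x + quot_pi y.
Proof. by rewrite /quot_pi Quotient.pi_add. Qed.

Lemma quot_piZ a x : quot_pi (a *: x) = quot_scale a (quot_pi x).
Proof.
by apply/quot_pi_eq; rewrite -scalerBr rpredZ//; apply/quot_pi_eq;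
  rewrite /quot_pi reprK.
Qed.

Lemma quot_scaleA a b u :
  quot_scale a (quot_scale b u) = quot_scale (a * b) u.
Proof. by have [x ->] := quot_piP u; rewrite -!quot_piZ scalerA. Qed.
Lemma quot_scale1 : left_id 1 quot_scale.
Proof. by move=> u; have [x ->] := quot_piP u; rewrite -quot_piZ scale1r. Qed.
Lemma quot_scaleDr : right_distributive quot_scale +%R.
Proof.
move=> a u v; have [x ->] := quot_piP u; have [y ->] := quot_piP v.
by rewrite -quot_piD -!quot_piZ -quot_piD scalerDr.
Qed.
Lemma quot_scaleDl u : {morph quot_scale^~ u : a b / a + b}.
Proof.
by move=> a b; have [x ->] := quot_piP u; rewrite -!quot_piZ -quot_piD scalerDl.
Qed.
HB.instance Definition _ := GRing.Zmodule_isLmodule.Build R quot_mod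
  quot_scaleA quot_scale1 quot_scaleDr quot_scaleDl.

Lemma quot_pi_linear : linear quot_pi.
Proof. by move=> a x y; rewrite quot_piD quot_piZ. Qed.
HB.instance Definition _ :=
  GRing.isLinear.Build R M quot_mod *:%R quot_pi quot_pi_linear.

End QuotientModule.

Definition coker (R : comNzRingType) (U V : lmodType R) (f : {linear U -> V}) :
  lmodType R := quot_mod (im_pred f).

Section Rings.
Variable R : comNzRingType.

Definition generated_by (I : {pred R}) n (g : 'I_n -> R) : Prop :=
  forall x, x \in I <-> exists a : 'I_n -> R, x = \sum_i a i * g i.

(* [idealr R] is the type of proper ideals; the unit ideal is generated by 1. *)
Definition noetherian : Prop :=
  forall I : idealr R, exists n (g : 'I_n -> R), generated_by I g.

Definition maximal_ideal (I : idealr R) : Prop :=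
  forall J : idealr R, {subset I <= J} -> I =i J.

Definition local_ring (m : idealr R) : Prop :=
  [/\ noetherian, maximal_ideal m & forall J, maximal_ideal J -> J =i m].

Definition prime_chain l (p : 'I_l.+1 -> prime_idealr R) : Prop :=
  forall i j : 'I_l.+1, (i < j)%N ->
    {subset p i <= p j} /\ ~ {subset p j <= p i}.

Definition has_krull_dim (d : nat) : Prop :=
  (exists p, @prime_chain d p) /\ (forall l p, @prime_chain l p -> (l <= d)%N).

Definition regular (m : idealr R) : Prop :=
  exists2 d, has_krull_dim d & exists g : 'I_d -> R, generated_by m g.

End Rings.

Section LocalModules.
Variables (R : comNzRingType) (m : idealr R).

Definition ideal_submod : {pred R^o} := fun x => x \in m.

Lemma ideal_submod_closed : submod_closed ideal_submod.
Proof.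
split=> [|a x y xm ym]; first exact: (idealr0 m).
exact: (rpredD (idealMr a xm : a * x \in m) ym).
Qed.
HB.instance Definition _ :=
  GRing.isSubmodClosed.Build R R^o ideal_submod ideal_submod_closed.

Definition residue_field : lmodType R := quot_mod ideal_submod.

Variable M : lmodType R.

Definition ideal_mul : {pred M} := fun x =>
  `[< exists n (a : 'I_n -> R) (y : 'I_n -> M),
        (forall i, a i \in m) /\ x = \sum_i a i *: y i >].

Lemma ideal_mul_closed : submod_closed ideal_mul.
Proof.
split.
  apply/asboolP; exists 0, (fun=> 0), (fun=> 0).
  by split=> [i|]; [exact: idealr0|rewrite big_ord0].
move=> b _ _ /asboolP[n [a [x [am ->]]]] /asboolP[p [c [y [cm ->]]]].
apply/asboolP; exists (n + p)%N.
exists (fun i => match fintype.split i with inl j => b * a j | inr j => c j end).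
exists (fun i => match fintype.split i with inl j => x j | inr j => y j end).
split=> [i|]; first by case: fintype.split => j; [exact: idealMr|exact: cm].
rewrite big_split_ord/= scaler_sumr; congr (_ + _); apply: eq_bigr => i _.
  by case: split_ordP => j => [/lshift_inj->|/eqP]; rewrite ?scalerA// eq_lrshift.
by case: split_ordP => j => [/eqP|/rshift_inj->//]; rewrite eq_rlshift.
Qed.
HB.instance Definition _ :=
  GRing.isSubmodClosed.Build R M ideal_mul ideal_mul_closed.

Definition mod_ideal : lmodType R := quot_mod ideal_mul.

Definition mod_ideal_pi : {linear M -> mod_ideal} := @quot_pi R M ideal_mul.

End LocalModules.
Arguments mod_ideal {R} m M.
Arguments mod_ideal_pi {R} m M.
Arguments ideal_mul {R} m M.

Section Modules.
Variable R : comNzRingType.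

Definition is_zero (M : lmodType R) : Prop := forall x : M, x = 0.

Definition finite_module (M : lmodType R) : Prop :=
  exists n (g : 'I_n -> M), forall x, exists a : 'I_n -> R,
    x = \sum_i a i *: g i.

Definition is_basis (M : lmodType R) (B : {pred M}) : Prop :=
  (forall x, exists (s : seq M) (a : M -> R),
     {subset s <= B} /\ x = \sum_(b <- s) a b *: b) /\
  (forall (s : seq M) (a : M -> R), uniq s -> {subset s <= B} ->
     \sum_(b <- s) a b *: b = 0 -> {in s, forall b, a b = 0}).

Definition free_module (M : lmodType R) : Prop :=
  exists B : {pred M}, is_basis B.

Definition projective_module (P : lmodType R) : Prop :=
  forall (A B : lmodType R) (g : {linear A -> B}) (f : {linear P -> B}),
    (forall y, exists x, g x = y) ->
    exists h : {linear P -> A}, forall x, g (h x) = f x.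

Definition has_nonzero_free_summand (C : lmodType R) : Prop :=
  exists (L K : lmodType R) (f : {linear C -> (L * K)%type}),
    [/\ free_module L, ~ is_zero L & bijective f].

End Modules.

(* Differentials are given between all pairs of degrees, and are zero unless
   the degree drops by one; this avoids transport along i = i + 1 - 1.  The
   n-th differential is [diff F n (n - 1)]. *)
Record complex (R : comNzRingType) := Complex {
  obj :> int -> lmodType R;
  diff : forall i j : int, {linear obj i -> obj j};
  diff_shape : forall i j (x : obj i), i != j + 1 -> diff i j x = 0;
  diff_diff : forall i j k (x : obj i), diff j k (diff i j x) = 0
}.
Arguments diff {R} c i j.

Section Resolutions.
Variables (R : comNzRingType) (F : complex R).

Definition resolution (A : lmodType R) : Prop :=
  [/\ forall i : int, i < 0 -> is_zero (F i),
      forall (i : int) (x : F i), 0 < i -> diff F i (i - 1) x = 0 ->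
        exists y : F (i + 1), diff F (i + 1) i y = x
    & exists e : {linear F 0 -> A},
        (forall a, exists x, e x = a) /\
        (forall x, e x = 0 <-> exists y, diff F 1 0 y = x)].

Definition projective_resolution (A : lmodType R) : Prop :=
  resolution A /\ forall i, projective_module (F i).

(* Free modules may have infinite rank here; over a noetherian local ring, a
   minimal free resolution of a finite module has terms of finite rank. *)
Definition minimal_free_resolution (m : idealr R) (A : lmodType R) : Prop :=
  [/\ resolution A, forall i, free_module (F i)
    & forall i (x : F i), diff F i (i - 1) x \in ideal_mul m (F (i - 1))].

End Resolutions.

Definition finite_projective_dimension (R : comNzRingType) (M : lmodType R) :
  Prop :=
  exists P : complex R, projective_resolution P M /\
    exists N : int, forall i, N < i -> is_zero (P i).

Section Precomp.
Variables (R : comNzRingType) (U V M : lmodType R) (d : {linear U -> V}).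

Definition precomp (f : {linear V -> M}) : {linear U -> M} := f \o d.

Lemma precomp_linear : linear precomp.
Proof. by move=> a f g; apply/val_inj/funext => x. Qed.
HB.instance Definition _ := GRing.isLinear.Build R
  {linear V -> M} {linear U -> M} *:%R precomp precomp_linear.

End Precomp.
Arguments precomp {R U V} M d.

Section Ext.
Variables (R : comNzRingType) (P : complex R) (n : int).

Section Modules.
Variable M : lmodType R.

Definition cocycle : lmodType R := kernel (precomp M (diff P (n + 1) n)).

Definition coboundary : {pred cocycle} := fun f : cocycle =>
  ker_val f \in im_pred (precomp M (diff P n (n - 1))).

Lemma coboundary_closed : submod_closed coboundary.
Proof.
pose B := im_pred (precomp M (diff P n (n - 1))); split=> [|a f g fB gB]; first exact: (rpred0 B).
exact: (rpredD (rpredZ a fB : a *: ker_val f \in B) gB).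
Qed.
HB.instance Definition _ :=
  GRing.isSubmodClosed.Build R cocycle coboundary coboundary_closed.

(* Ext^n(A, M) as the n-th cohomology of Hom(P, M), for P a projective
   resolution of A. *)
Definition Ext : lmodType R := quot_mod coboundary.

Definition Ext_class (f : cocycle) : Ext := quot_pi coboundary f.

End Modules.
Arguments coboundary M : clear implicits.

Variables (M N : lmodType R) (phi : {linear M -> N}).

Definition postcomp (f : {linear P n -> M}) : {linear P n -> N} := phi \o f.

Lemma postcomp_cocycle (f : cocycle M) :
  postcomp (ker_val f) \in ker_pred (precomp N (diff P (n + 1) n)).
Proof.
case: f => f /= /eqP f0; apply/eqP/val_inj/funext => x /=.
by have := congr1 (fun h : {linear _ -> _} => h x) f0 => /= ->; rewrite linear0.
Qed.

Definition cocycle_map (f : cocycle M) : cocycle N :=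
  Kernel (postcomp_cocycle f).

Definition Ext_map_fun (u : Ext M) : Ext N :=
  Ext_class (cocycle_map (repr (u : Quotient.quot (zmod_pred (coboundary M))))).

Lemma Ext_map_class (f : cocycle M) :
  Ext_map_fun (Ext_class f) = Ext_class (cocycle_map f).
Proof.
apply/quot_pi_eq; set g := repr _.
have /quot_pi_eq/asboolP[h hE] : quot_pi (coboundary M) g = quot_pi _ f.
  by rewrite /quot_pi reprK.
apply/asboolP.
exists (phi \o (h : {linear P (n - 1) -> M}) : {linear P (n - 1) -> N}).
apply/val_inj/funext => x /=.
have := congr1 (fun k : {linear _ -> _} => k x) hE => /= ->.
exact: linearB.
Qed.

Lemma Ext_map_linear : linear Ext_map_fun.
Proof.
move=> a u v; have [f ->] := quot_piP u; have [g ->] := quot_piP v.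
rewrite -[X in _ = a *: X + _]/(Ext_map_fun (Ext_class f)).
rewrite -[X in _ = _ + X]/(Ext_map_fun (Ext_class g)).
rewrite -linearP -/(Ext_class _) !Ext_map_class -linearP.
by congr (quot_pi _ _); do 2!apply/val_inj; apply/funext => x; exact: linearP.
Qed.
HB.instance Definition _ :=
  GRing.isLinear.Build R (Ext M) (Ext N) *:%R Ext_map_fun Ext_map_linear.

Definition Ext_map : {linear Ext M -> Ext N} := Ext_map_fun.

End Ext.
Arguments coboundary {R} P n M.
Arguments Ext_map {R} P n {M N} phi.

(* The map Ext^n(k, M) -> Ext^n(k, M/mM), for P a projective resolution of k. *)
Definition epsilon (R : comNzRingType) (m : idealr R) (P : complex R) (n : int)
    (M : lmodType R) : {linear Ext P n M -> Ext P n (mod_ideal m M)} :=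
  Ext_map P n (mod_ideal_pi m M).

(* Main.v *)
From HB Require Import structures.
Require Import Defs.
From mathcomp Require Import all_boot all_order all_algebra.
From mathcomp Require Import ring_quotient.
From mathcomp Require Import boolp classical_sets functions.
From mathcomp Require Import ring zify freeg.

Set Implicit Arguments.
Unset Strict Implicit.
Unset Printing Implicit Defensive.

Import GRing.Theory.
Local Open Scope ring_scope.

(** Everything rests on one statement about a singular, that is non-regular, local
ring R with residue field k: if F is the minimal free resolution of k and M is
a module of finite projective dimension, then every cocycle f : F_n -> M has
its image in mM ([cocycle_into_ideal], [singular_cocycle]). It follows that
epsilon_M vanishes for all such M, in particular for M = R. So (ii), (iii) and
(iv) each force R to be regular, and so does (v), because a free summand of
the cokernel of a differential into F_n amounts to a cocycle F_n -> R that
takes the value 1.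

The statement is proved as follows. Let x_1, ..., x_e be minimal generators of
m and K their Koszul complex. Since R is singular, H_1(K) is not zero
([koszul_H1_regular]): there is a cycle t = a_1 X_1 + ... + a_e X_e that is
not a boundary, and all a_l lie in m because the generators are minimal. Free
K-modules are attached to K so as to kill, up to some large degree, all homology except
k in degree 0 and k t in degree 1; this gives a differential graded K-module B, free over R
([singular_kmodule]). Next a divided power variable T with dT = t is adjoined.
Its powers T^(r) index the layers of G = B<T>. As multiplication by t
identifies H_0(B) with H_1(B), the complex G is a free resolution of k
in that range ([layers_exact]), and T^(r+1) |-> T^(r) defines a surjective endomorphism D of
degree -2. The section u |-> u T of D fails to be a chain map only by
multiplication with t, which is zero modulo m. Hence D is surjective on the
homology of k (x) G, which is Tor(k,k), and every class of Tor_n(k,k) has the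
form D^J(c) ([divide_cycle], [divide_power]). A cocycle f induces a map from
H(F (x) G) to H(M (x) G) that commutes with D. It sends c into Tor_2J(k,M),
which is zero for large J ([bounded_acyclic]), and so it sends D^J(c) to zero
in Tor_0(k,M) = M/mM.

Conversely let m be generated by a regular sequence x_1, ..., x_d. Induction
along the sequence computes the homology of F/(x_1, ..., x_i)F. For i = d the
differential of F/mF is zero, so this homology is F/mF itself; the outcome is
F_(d+1) = 0 and F_d <> 0 ([regular_resolution]). A coordinate function of F_d
is then a cocycle with value 1. Its multiples by elements of M outside mM show
that epsilon^d_M is not zero ([regular_epsilon]), and F_d is itself the
cokernel required in (v).

Regularity, which is defined by the Krull dimension, is tied to regular
sequences by Krull's principal ideal theorem. If p_0 < ... < p_l is a chain of
primes and x lies in p_l, then x may be moved into p_1 ([chain_through]).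
Applied to the generators of m one after the other, this bounds the length of
chains by their number. When a chain of length d exists, it also shows, by
Nakayama's lemma, that the ideals (x_1, ..., x_i) are the primes of such a
chain, so that the x_i form a regular sequence ([regularP]). *)
(** * Submodules, maximal elements and Nakayama's lemma *)

Section Submodules.
Variable R : comNzRingType.

(** Submodules are propositional predicates throughout, so that they can be formed
by comprehension and compared without any decidability. *)
Definition submod (M : lmodType R) (N : M -> Prop) : Prop :=
  N 0 /\ forall a x y, N x -> N y -> N (a *: x + y).

Definition fingen (M : lmodType R) (N : M -> Prop) : Prop :=
  exists n (g : 'I_n -> M), (forall i, N (g i)) /\
    forall x, N x -> exists a : 'I_n -> R, x = \sum_i a i *: g i.

Definition noeth (M : lmodType R) : Prop :=
  forall N : M -> Prop, submod N -> fingen N.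

Section Theory.
Variables (M : lmodType R) (N : M -> Prop) (subN : submod N).

Lemma submod0 : N 0. Proof. exact: subN.1. Qed.

Lemma submodD x y : N x -> N y -> N (x + y).
Proof. by move=> Nx Ny; rewrite -[x]scale1r; apply: subN.2. Qed.

Lemma submodZ a x : N x -> N (a *: x).
Proof. by move=> Nx; rewrite -[_ *: _]addr0; apply: subN.2 => //; apply: submod0. Qed.

Lemma submodB x y : N x -> N y -> N (x - y).
Proof. by move=> Nx Ny; rewrite addrC -scaleN1r; apply: subN.2. Qed.

Lemma submodN x : N x -> N (- x).
Proof. by move=> Nx; rewrite -scaleN1r; apply: submodZ. Qed.

Lemma submod_sum (I : Type) (r : seq I) (P : pred I) (F : I -> M) :
  (forall i, P i -> N (F i)) -> N (\sum_(i <- r | P i) F i).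
Proof. by move=> NF; apply: (big_ind N) => //; [apply: submod0 | apply: submodD]. Qed.

End Theory.

(** A family without maximal member yields, by choice, a strictly increasing
sequence; its union is finitely generated, hence reached at a finite stage. *)
Lemma noeth_max (M : lmodType R) (Phi : (M -> Prop) -> Prop) :
  noeth M -> (forall N, Phi N -> submod N) -> (exists N, Phi N) ->
  exists N, Phi N /\
    forall N', Phi N' -> (forall x, N x -> N' x) -> forall x, N' x -> N x.
Proof.
move=> nM subPhi [N0 PhiN0]; apply: contrapT => nomax.
have next (s : {N | Phi N}) : {s' : {N | Phi N} |
    (forall x, sval s x -> sval s' x) /\ exists x, sval s' x /\ ~ sval s x}.
  apply/cid; case: s => N PhiN; apply: contrapT => nonext; apply: nomax.
  exists N; split=> // N' PhiN' NN' x N'x; apply: contrapT => Nx.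
  by apply: nonext; exists (exist _ N' PhiN'); split=> //; exists x.
pose s := nat_rect (fun=> {N | Phi N}) (exist _ N0 PhiN0) (fun=> fun s => sval (next s)).
have sS n x : sval (s n) x -> sval (s n.+1) x.
  by have [+ _] := svalP (next (s n)); apply.
have sD p n x : sval (s n) x -> sval (s (n + p)%N) x.
  by elim: p => [|p IHp] /=; rewrite ?addn0// addnS => /IHp/sS.
have sle n p x : (n <= p)%N -> sval (s n) x -> sval (s p) x.
  by move/subnKC <-; apply: sD.
pose U x := exists n, sval (s n) x.
have subU : submod U.
  split; first by exists 0%N; apply: submod0; apply: subPhi (svalP (s _)).
  move=> a x y [n snx] [p spy]; exists (maxn n p).
  apply: (subPhi _ (svalP (s (maxn n p)))).2.
    exact: sle (leq_maxl _ _) snx.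
  exact: sle (leq_maxr _ _) spy.
have [r [g [Ug gP]]] := nM _ subU.
have [f fP] := choice Ug.
pose p := \max_i f i.
have [_ [x [sx nsx]]] := svalP (next (s p)).
have [a xE] : exists a : 'I_r -> R, x = \sum_i a i *: g i by apply: gP; exists p.+1.
apply: nsx; rewrite xE; have sub_p := subPhi _ (svalP (s p)); apply: submod_sum => //.
move=> i _; apply: submodZ => //.
by apply: sle (fP i); apply: leq_bigmax.
Qed.

Definition ideal (I : R -> Prop) : Prop := @submod R^o I.

Lemma idealI (I : R -> Prop) :
  I 0 -> (forall a x, I x -> I (a * x)) -> (forall x y, I x -> I y -> I (x + y)) ->
  ideal I.
Proof. by move=> I0 IM ID; split=> // a x y Ix Iy; apply: ID => //; apply: IM. Qed.

Lemma ideal0 I : ideal I -> I 0. Proof. by case. Qed.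
Lemma idealD I x y : ideal I -> I x -> I y -> I (x + y).
Proof. by move=> II; apply: (submodD II). Qed.
Lemma idealB I x y : ideal I -> I x -> I y -> I (x - y).
Proof. by move=> II; apply: (submodB II). Qed.
Lemma idealM I a x : ideal I -> I x -> I (a * x).
Proof. by move=> II; apply: (submodZ II). Qed.
Lemma idealMl I a x : ideal I -> I x -> I (x * a).
Proof. by rewrite mulrC; apply: idealM. Qed.

Definition is_prime (p : R -> Prop) : Prop :=
  [/\ ideal p, ~ p 1 & forall a b, p (a * b) -> p a \/ p b].

Lemma prime_ideal p : is_prime p -> ideal p. Proof. by case. Qed.

Lemma primeNM p a b : is_prime p -> ~ p a -> ~ p b -> ~ p (a * b).
Proof. by case=> _ _ pM pa pb /pM[]. Qed.

(** Saturated submodules are the contractions of submodules of the localisation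
at p; with them one argues at p without constructing that localisation. *)
Definition saturated (p : R -> Prop) (M : lmodType R) (N : M -> Prop) : Prop :=
  forall s x, ~ p s -> N (s *: x) -> N x.

Definition saturation (p : R -> Prop) (M : lmodType R) (N : M -> Prop) : M -> Prop :=
  fun x => exists2 s, ~ p s & N (s *: x).

Section Saturation.
Variables (p : R -> Prop) (pp : is_prime p).

Lemma saturation_submod (M : lmodType R) (N : M -> Prop) :
  submod N -> submod (saturation p N).
Proof.
case: (pp) => _ p1 _ sN; split; first by exists 1; rewrite ?scaler0//; apply: submod0.
move=> a x y [s ps Nx] [t pt Ny]; exists (s * t); first exact: primeNM.
have -> : (s * t) *: (a *: x + y) = (a * t) *: (s *: x) + s *: (t *: y).
  by rewrite scalerDr !scalerA; congr (_ *: x + _); ring.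
by apply: submodD => //; apply: submodZ.
Qed.

Lemma saturationS (M : lmodType R) (N : M -> Prop) x : N x -> saturation p N x.
Proof. by case: (pp) => _ p1 _ Nx; exists 1; rewrite ?scale1r. Qed.

Lemma saturation_saturated (M : lmodType R) (N : M -> Prop) :
  saturated p (saturation p N).
Proof.
by move=> s x ps [t pt Ntx]; exists (t * s); [apply: primeNM|rewrite -scalerA].
Qed.

Definition adjoin (M : lmodType R) (N : M -> Prop) (a : M) : M -> Prop :=
  fun x => exists r, N (x - r *: a).

Lemma adjoin_submod (M : lmodType R) (N : M -> Prop) a :
  submod N -> submod (adjoin N a).
Proof.
move=> sN; split; first by exists 0; rewrite scale0r subr0; apply: submod0.
move=> c x y [r Nx] [s Ny]; exists (c * r + s).
by rewrite scalerDl -scalerA opprD addrACA -scalerBr; apply: sN.2.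
Qed.

Lemma adjoinS (M : lmodType R) (N : M -> Prop) a x : N x -> adjoin N a x.
Proof. by move=> Nx; exists 0; rewrite scale0r subr0. Qed.

Lemma adjoin_gen (M : lmodType R) (N : M -> Prop) a : submod N -> adjoin N a a.
Proof. by move=> sN; exists 1; rewrite scale1r subrr; apply: submod0. Qed.

(** Nakayama's lemma at a prime p, for the inclusion of J in N + xJ with x in p.
Take a saturated submodule H that contains N and is maximal among those not
containing J, and a in J outside H. Maximality puts J into H + Ra up to
elements outside p, and then (s - x r) a lies in H for some s outside p. *)
Lemma nakayama (M : lmodType R) (N J : M -> Prop) x :
  noeth M -> submod N -> submod J -> p x ->
  (forall a, J a -> exists s c, [/\ ~ p s, J c & N (s *: a - x *: c)]) ->
  forall a, J a -> saturation p N a.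
Proof.
move=> nM sN sJ px Jx; apply: contrapT => /existsNP[a0 /not_implyP[Ja0 Na0]].
pose Phi H := [/\ submod H, saturated p H, (forall a, N a -> H a) &
  exists a, J a /\ ~ H a].
have [||H [[sH satH NH [a [Ja Ha]]] Hmax]] := @noeth_max M Phi nM.
- by move=> ? [].
- exists (saturation p N); split; first exact: saturation_submod.
  + exact: saturation_saturated.
  + exact: saturationS.
  + by exists a0.
pose H' := saturation p (adjoin H a).
have H'H b : H b -> H' b by move=> Hb; apply/saturationS/adjoinS.
have JH' b : J b -> H' b.
  apply: contraPP => H'b Jb; apply: Ha; apply: (Hmax H') => //.
    split.
    - exact/saturation_submod/adjoin_submod.
    - exact: saturation_saturated.
    - by move=> c /NH/H'H.
    - by exists b.
  exact/saturationS/adjoin_gen.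
have [s [c [ps Jc Nsc]]] := Jx _ Ja.
have [t pt [r Hr]] := JH' _ Jc.
apply: Ha; apply: (satH (t * s - x * r)).
  move=> ptx; suff: p (t * s) by exact: primeNM.
  case: (pp) => pI _ _; rewrite -(subrK (x * r) (t * s)).
  by apply: idealD => //; apply: idealMl.
have -> : (t * s - x * r) *: a =
    t *: (s *: a - x *: c) + x *: (t *: c - r *: a).
  rewrite scalerBl !scalerBr !scalerA addrA; congr (_ - _).
  by rewrite (mulrC t x) subrK.
by apply: submodD => //; apply: submodZ => //; apply: NH.
Qed.

End Saturation.
End Submodules.

(** * Krull's principal ideal theorem *)

Section PrincipalIdealTheorem.
Variables (R : comNzRingType) (noethR : noeth R^o).
Implicit Types (p q I : R -> Prop).

Definition strict_sub p q := (forall a, p a -> q a) /\ exists2 a, q a & ~ p a.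

Let max_ideal (Phi : (R -> Prop) -> Prop) := @noeth_max R R^o Phi noethR.

(** A maximal member among the annihilators of non-zero elements of R/U is prime. *)
Lemma exists_associated_prime p (U : R -> Prop) : is_prime p -> ideal U ->
  @saturated R p R^o U -> ~ U 1 ->
  exists2 a, ~ U a & is_prime (fun r => U (r * a)) /\ forall r, U (r * a) -> p r.
Proof.
move=> pp iU satU U1.
pose ann b r := U (r * b).
have annI b : ideal (ann b).
  apply: idealI => [|c x|x y]; rewrite /ann ?mul0r.
  - exact: ideal0.
  - by rewrite -mulrA; apply: idealM.
  - by rewrite mulrDl; apply: idealD.
have [_ [b Ub ->]||A [[a Ua ->] maxA]] := max_ideal (Phi := fun A => exists2 b, ~ U b & A = ann b).
- exact: annI.
- by exists (ann 1), 1.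
exists a => //; split; last first.
  by move=> r Ura; apply: contrapT => pr; apply: Ua; apply: satU Ura.
split; [exact: annI|by rewrite mul1r|move=> r s Ursa].
have [Ura|Ura] := pselect (U (r * a)); [by left|right].
apply: (maxA (ann (r * a))); first by exists (r * a).
  by move=> x Uxa; rewrite /ann mulrCA; apply: idealM.
by rewrite /ann mulrA (mulrC s).
Qed.

(** If p is the only prime between U0 and p, then the quotient by U0, localised at
p, is artinian; two consecutive members of the chain are shown to agree. By
noetherian induction from above it suffices to treat chains above a V such
that the claim holds above V' = V + Ra, where p a lies in V: the quotient V'/V
is then simple at p, and the chain either contains a throughout, or meets V'
in V from some point on. *)
Lemma descending_chain p (U0 : R -> Prop) : is_prime p ->
  (forall p', is_prime p' -> (forall a, U0 a -> p' a) -> (forall a, p' a -> p a) ->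
     forall a, p a -> p' a) ->
  forall L : nat -> R -> Prop,
  (forall n, [/\ ideal (L n), @saturated R p R^o (L n),
      (forall a, U0 a -> L n a) & forall a, L n.+1 a -> L n a]) ->
  exists n, forall a, L n a -> L n.+1 a.
Proof.
move=> pp minp; pose good (U : R -> Prop) (L : nat -> R -> Prop) :=
  forall n, [/\ ideal (L n), @saturated R p R^o (L n),
      (forall a, U a -> L n a) & forall a, L n.+1 a -> L n a].
suff main (U : R -> Prop) : ideal U -> @saturated R p R^o U ->
    (forall a, U0 a -> U a) -> forall L, good U L ->
    exists n, forall a, L n a -> L n.+1 a.
  move=> L gL.
  have H n := gL n.
  pose U a := forall n, L n a.
  apply: (main U).
  - apply: idealI => [n|c x Ux n|x y Ux Uy n]; have [iL _ _ _] := gL n.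
    + exact: ideal0.
    + by apply: idealM.
    + by apply: idealD.
  - by move=> s x ps Usx n; have [_ satL _ _] := gL n; apply: satL (Usx n).
  - by move=> a U0a n; have [_ _ U0L _] := gL n; apply: U0L.
  - by move=> n; have [iL satL U0L LS] := gL n; split=> // a Ua; apply: Ua.
move=> iU satU U0U; apply: contrapT => nU.
have [||V [[iV satV U0V nV] maxV]] := max_ideal (Phi := fun U => [/\ ideal U,
    @saturated R p R^o U, (forall a, U0 a -> U a) &
    ~ forall L, good U L -> exists n, forall a, L n a -> L n.+1 a]).
- by move=> ? [].
- by exists U.
have V1 : ~ V 1.
  move=> V1; apply: nV => L gL; exists 0%N => a _; have [iL _ VL _] := gL 1%N.
  by rewrite -[a]mulr1; apply: idealM => //; apply: VL.
have [a Va [prA Ap]] := exists_associated_prime pp iV satV V1.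
have pA r : p r -> V (r * a).
  apply: (minp (fun r => V (r * a))) => // b U0b; rewrite mulrC; apply: idealM => //; exact: U0V.
pose V' := saturation p (@adjoin R R^o V a).
have iV' : ideal V' by apply: saturation_submod => //; apply: adjoin_submod.
have VV' b : V b -> V' b by move=> Vb; apply: (saturationS pp); apply: adjoinS.
have V'a : V' a by apply: (saturationS pp); apply: adjoin_gen.
have CV' : forall L, good V' L -> exists n, forall a, L n a -> L n.+1 a.
  apply: contrapT => nV'; apply: Va; apply: (maxV V') => //; split=> //.
    exact: saturation_saturated.
  by move=> b /U0V/VV'.
apply: nV => L gL.
have [allLa|/existsNP[n1 Ln1a]] := pselect (forall n, L n a).
  apply: CV' => n; have [iL satL VL LS] := gL n; split=> // b [s ps [r Vr]].
  apply: (satL s) => //; rewrite -(subrK (r *: (a : R^o)) (s *: (b : R^o))).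
  by apply: idealD => //; [apply: VL|apply: idealM].
have Lna n : ~ L (n1 + n)%N a.
  elim: n => [|n IHn]; rewrite ?addn0// addnS => La; apply: IHn.
  by have [_ _ _ LS] := gL (n1 + n)%N; apply: LS.
pose sum n b := exists2 c, L (n1 + n)%N c & V' (b - c).
pose L' n := saturation p (sum n : R^o -> Prop).
have isum n : ideal (sum n).
  have [iL _ _ _] := gL (n1 + n)%N; apply: idealI => [|c x [d Ld Vd]|x y [d Ld Vd] [e Le Ve]].
  - by exists 0; rewrite ?subr0; apply: ideal0.
  - by exists (c * d); [apply: idealM|rewrite -mulrBr; apply: idealM].
  - by exists (d + e); [apply: idealD|rewrite opprD addrACA; apply: idealD].
have [n L'n] : exists n, forall b, L' n b -> L' n.+1 b.
  apply: CV' => n; split.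
  - exact/saturation_submod/isum.
  - exact: saturation_saturated.
  - move=> b V'b; apply: saturationS => //; exists 0; rewrite ?subr0//.
    by have [iL _ _ _] := gL (n1 + n)%N; apply: ideal0.
  - move=> b [s ps [c Lc Vc]]; exists s => //; exists c => //.
    by move: Lc; rewrite addnS; have [_ _ _] := gL (n1 + n)%N; apply.
exists (n1 + n)%N => b Lb.
have [iL satL VL _] := gL (n1 + n)%N.
have [iLS satLS VLS LS] := gL (n1 + n).+1.
have LV c : L (n1 + n)%N c -> V' c -> V c.
  move=> Lc [s ps [r Vr]].
  have [pr|pr] := pselect (p r).
    apply: (satV s) => //; rewrite -(subrK (r *: (a : R^o)) (s *: (c : R^o))).
    by apply: idealD => //; apply: pA.
  case: (Lna n); apply: (satL r) => //.
  rewrite -[r *: _](subKr (s *: (c : R^o))).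
  by apply: idealB => //; [apply: idealM|apply: VL].
have [|s ps [c]] := L'n b.
  by apply: saturationS => //; exists b; rewrite ?subrr//; apply: ideal0.
rewrite addnS => Lc V'c; apply: (satLS s) => //.
rewrite -(subrK c (s *: (b : R^o))); apply: idealD => //; apply/VLS/LV => //.
apply: idealB => //; first exact: idealM.
by have [_ _ _] := gL (n1 + n)%N; apply.
Qed.

End PrincipalIdealTheorem.

Section PIT.
Variables (R : comNzRingType) (noethR : noeth R^o).
Implicit Types (p q I : R -> Prop).

Lemma prime_exp p x n : is_prime p -> ~ p x -> ~ p (x ^+ n).
Proof.
move=> pp px; elim: n => [|n IHn]; first by case: pp; rewrite expr0.
by rewrite exprS; apply: primeNM.
Qed.

(** If no such p' exists, p is minimal over q0 + (x). For y in q outside q0, let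
J n be the contraction of (y^n) + q0 from the localisation at q. The chain
J n + (x) becomes stationary, and as x is not in q this gives
J n = J (n+1) + x J n, hence J n = J (n+1) by Nakayama. So y^n is a multiple of
y^(n+1) modulo q0 at q, which makes y invertible there: a contradiction. *)
Theorem principal_ideal_theorem q0 q p x :
  is_prime q0 -> is_prime q -> is_prime p -> strict_sub q0 q -> strict_sub q p -> p x ->
  exists p', [/\ is_prime p', strict_sub q0 p', strict_sub p' p & p' x].
Proof.
move=> pq0 pq pp q0q qp px.
have [qx|qx] := pselect (q x); first by exists q.
have iq0 := prime_ideal pq0; have iq := prime_ideal pq; have ip := prime_ideal pp.
apply: contrapT => no.
have minp p' : is_prime p' -> (forall a, @adjoin R R^o q0 x a -> p' a) ->
    (forall a, p' a -> p a) -> forall a, p a -> p' a.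
  move=> pp' U0p' p'p a pa; apply: contrapT => p'a; apply: no; exists p'.
  have p'x : p' x by apply: U0p'; apply: adjoin_gen.
  split=> //; last by split=> //; exists a.
  split; last by exists x => // /(q0q.1).
  by move=> b q0b; apply: U0p'; apply: adjoinS.
have [y qy q0y] := q0q.2.
pose J n a := exists2 s, ~ q s & exists r, q0 (s * a - r * y ^+ n).
have iJ n : ideal (J n).
  apply: idealI => [|c a [s qs [r ra]]|a b [s qs [r ra]] [t qt [u ub]]].
  - exists 1; first by case: pq.
    by exists 0; rewrite mulr0 mul0r subr0; apply: ideal0.
  - exists s => //; exists (c * r).
    by rewrite mulrCA -mulrA -mulrBr; apply: idealM.
  - exists (s * t); first exact: primeNM.
    exists (t * r + s * u).
    have -> : s * t * (a + b) - (t * r + s * u) * y ^+ n =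
      t * (s * a - r * y ^+ n) + s * (t * b - u * y ^+ n) by ring.
    by apply: idealD => //; apply: idealM.
have q0J n a : q0 a -> J n a.
  move=> q0a; exists 1; first by case: pq.
  by exists 0; rewrite mul0r subr0 mul1r.
have JS n a : J n.+1 a -> J n a.
  by case=> s qs [r ra]; exists s => //; exists (r * y); rewrite -mulrA -exprS.
have Jcancel n a t : ~ q t -> J n (a * t) -> J n a.
  move=> qt [s qs [r ra]]; exists (s * t); first exact: primeNM.
  by exists r; rewrite -mulrA (mulrC t).
pose L n := saturation p (@adjoin R R^o (J n) x).
have [n Ln] : exists n, forall a, L n a -> L n.+1 a.
  apply: (descending_chain noethR pp minp) => n; split.
  - exact: (@saturation_submod R p pp R^o _ (@adjoin_submod R R^o _ x (iJ n))).
  - exact: saturation_saturated.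
  - move=> a [r q0a]; apply: saturationS => //; exists r; exact: q0J.
  - by move=> a [s ps [r Ja]]; exists s => //; exists r; apply: JS.
have Jn : forall a, J n a -> @saturation R p R^o (J n.+1) a.
  apply: (@nakayama R p pp R^o (J n.+1) (J n) x noethR (iJ _) (iJ _) px) => a Ja.
  have [|s ps [r Jr]] := Ln a; first by apply: saturationS => //; apply: adjoinS.
  exists s, r; split=> //; last by rewrite [x *: _]mulrC.
  apply: (Jcancel n r x) => //.
  have -> : r * x = s * a - (s * a - r * x) by ring.
  apply: idealB => //; first exact: idealM.
  exact: JS.
have Jyn : J n (y ^+ n).
  exists 1; first by case: pq.
  by exists 1; rewrite !mul1r subrr; apply: ideal0.
have [s ps [t qt [r]]] := Jn _ Jyn.
rewrite -[s *: _]/(s * y ^+ n).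
have -> : t * (s * y ^+ n) - r * y ^+ n.+1 = y ^+ n * (t * s - r * y).
  by rewrite exprS; ring.
have qs : ~ q s by move=> /(qp.1).
move=> q0r; have [/(prime_exp pq0 q0y)//|{}q0r] : q0 (y ^+ n) \/ q0 (t * s - r * y).
  by case: pq0 => _ _; apply.
suff : q (t * s) by apply: primeNM.
rewrite -(subrK (r * y) (t * s)); apply: idealD => //; last exact: idealM.
exact: q0q.1.
Qed.

(** * Chains of primes and regular sequences *)

(** Chains grow at the upper end q; only their end points are recorded, because
[chain_through] replaces all the primes in between. *)
Fixpoint chain l p q : Prop :=
  if l is l'.+1 then exists r, [/\ is_prime r, chain l' p r & strict_sub r q]
  else forall a, p a <-> q a.

(** The principal ideal theorem moves x from the top of the chain down to its
second member, one step at a time. *)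
Lemma chain_through l p q x : is_prime p -> is_prime q -> chain l.+1 p q -> q x ->
  exists r, [/\ is_prime r, strict_sub p r, r x & chain l r q].
Proof.
move=> pp; elim: l q => [|l IHl] q pq.
  move=> [r [_ pr rq]] qx; exists q; split=> //; case: rq => rq [a qa ra].
  by split=> [b /pr/rq//|]; exists a => // /pr.
move=> [s [ps [s' [ps' ch s's]] sq]] qx.
have [t [pt s't tq tx]] := principal_ideal_theorem ps' ps pq s's sq qx.
have [|r [pr ppr rx chr]] := IHl t pt _ tx; first by exists s'.
by exists r; split=> //; exists t.
Qed.

Definition gen_ideal (x : nat -> R) i a : Prop :=
  exists c : nat -> R, a = \sum_(j < i) c j * x j.

Lemma gen_ideal_closed x i : ideal (gen_ideal x i).
Proof.
apply: idealI => [|a _ [c ->]|_ _ [c ->] [d ->]].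
- by exists (fun=> 0); rewrite big1// => j _; rewrite mul0r.
- by exists (fun j => a * c j); rewrite mulr_sumr; apply: eq_bigr => j _; rewrite mulrA.
- exists (fun j => c j + d j); rewrite -big_split/=.
  by apply: eq_bigr => j _; rewrite mulrDl.
Qed.

Lemma mem_gen_ideal x i j : (j < i)%N -> gen_ideal x i (x j).
Proof.
move=> ji; exists (fun k => (k == j)%:R); rewrite (bigD1 (Ordinal ji))//= eqxx mul1r.
rewrite big1 ?addr0// => k; rewrite -val_eqE/= => /negPf ->.
by rewrite mul0r.
Qed.

Lemma gen_ideal_least x i I : ideal I -> (forall j, (j < i)%N -> I (x j)) ->
  forall a, gen_ideal x i a -> I a.
Proof.
move=> iI Ix _ [c ->].
by apply: (submod_sum (M := R^o) iI) => j _; apply: (idealM _ iI); apply: Ix.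
Qed.

Lemma gen_idealS x i a : gen_ideal x i.+1 a <-> exists c, gen_ideal x i (a - c * x i).
Proof.
split=> [[c ->]|[c [d acE]]].
  by exists (c i); exists c; rewrite big_ord_recr/= addrK.
exists (fun j => if j == i then c else d j); rewrite big_ord_recr/= eqxx.
rewrite -(subrK (c * x i) a) acE; congr (_ + _); apply: eq_bigr => j _.
by rewrite ltn_eqF.
Qed.

Lemma gen_idealW x i j a : (i <= j)%N -> gen_ideal x i a -> gen_ideal x j a.
Proof.
move=> ij; apply: gen_ideal_least => [|k ki]; first exact: gen_ideal_closed.
by apply: mem_gen_ideal; apply: leq_trans ij.
Qed.

Definition regular_seq (x : nat -> R) d : Prop :=
  forall i a, (i < d)%N -> gen_ideal x i (a * x i) -> gen_ideal x i a.

Variables (m : R -> Prop) (pm : is_prime m) (x : nat -> R) (d : nat).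
Hypothesis unit_m : forall s, ~ m s -> exists t, t * s = 1.
Hypothesis mx : forall a, m a <-> gen_ideal x d a.

(** Moving x_i into the second prime of the chain and dropping the first prime
shortens the chain by one and enlarges by one the set of generators that all
its members contain. *)
Lemma chain_le_generators l p i : is_prime p -> (i <= d)%N ->
  (forall a, gen_ideal x i a -> p a) -> chain l p m -> (l <= d - i)%N.
Proof.
elim: l p i => // l IHl p i pp le_id xp ch.
have [lt_id|ge_id] := ltnP i d; last first.
  have [r [pr rp _ _]] := chain_through pp pm ch (ideal0 (prime_ideal pm)).
  have : chain l.+1 p m by [].
  case: ch => s [ps chs [sm [a ma sa]]].
  suff ps_ b : forall k q, is_prime q -> chain k p q -> p b -> q b.
    case: sa; apply: (ps_ _ l) => //; apply: xp.
    by move: ma => /mx; apply: gen_idealW.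
  elim=> [|k IHk] q pq /=; first by move=> pq_ /pq_.
  by move=> [t [pt cht [tq _]]] pb; apply: tq; apply: IHk pb.
have [|r [pr [pr_ pr__] rx chr]] := chain_through (x := x i) pp pm ch.
  by apply/mx/mem_gen_ideal.
suff: (l <= d - i.+1)%N by lia.
apply: (IHl r) => // a; apply: gen_ideal_least => [|j]; first exact: prime_ideal.
rewrite ltnS leq_eqVlt => /predU1P[->//|ji].
by apply/pr_/xp/mem_gen_ideal.
Qed.

(** When the bound is attained, the prime r above p equals (x_0, ..., x_i) by
induction and x_i is not in p. An element of p is then a combination of
x_0, ..., x_(i-1) plus c x_i with c in p, so p = (x_0, ..., x_(i-1)) by
Nakayama; as p is prime, x_i is regular modulo it. *)
Lemma maximal_chain_gen_ideal p i l : is_prime p -> (i + l)%N = d ->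
  (forall a, gen_ideal x i a -> p a) -> chain l p m ->
  (forall a, p a -> gen_ideal x i a) /\
  forall j a, (i <= j < d)%N -> gen_ideal x j (a * x j) -> gen_ideal x j a.
Proof.
elim: l p i => [|l IHl] p i pp ild xp ch.
  rewrite addn0 in ild; subst i; split; last by move=> j a; lia.
  by move=> a pa; apply/mx/ch.
have [|r [pr [pr_ [b rb pb]] rx chr]] := chain_through (x := x i) pp pm ch.
  by apply/mx/mem_gen_ideal; lia.
have ip := prime_ideal pp.
have xr a : gen_ideal x i.+1 a -> r a.
  apply: gen_ideal_least => [|j]; first exact: prime_ideal.
  rewrite ltnS leq_eqVlt => /predU1P[->//|ji].
  by apply/pr_/xp/mem_gen_ideal.
have [|rxS reg] := IHl r i.+1 pr _ xr chr; first by lia.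
have pxi : ~ p (x i).
  move=> pxi; apply: pb; move/rxS: rb; apply: gen_ideal_least => // j.
  rewrite ltnS leq_eqVlt => /predU1P[->//|ji]; exact/xp/mem_gen_ideal.
have pS a : p a -> exists2 c, p c & gen_ideal x i (a - c * x i).
  move=> pa; have /gen_idealS[c ac] := rxS _ (pr_ _ pa); exists c => //.
  have : p (c * x i).
    by rewrite -(subKr a (c * x i)); apply: idealB => //; apply: xp.
  by case: pp => _ _ pM /pM[].
have px a : p a -> gen_ideal x i a.
  move=> pa; have [||||s ms] := @nakayama R m pm R^o (gen_ideal x i) p (x i) noethR _ _ _ _ a pa.
  - exact: gen_ideal_closed.
  - exact: ip.
  - by apply/mx/mem_gen_ideal; lia.
  - move=> c pc; have [e pe xe] := pS c pc; exists 1, e; split=> //.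
      by case: pm.
    by rewrite scale1r [x i *: _]mulrC.
  have [t ts] := unit_m ms; move=> /(idealM t (gen_ideal_closed x i)).
  by rewrite [s *: _]/(s * a) mulrA ts mul1r.
split=> // j a /andP[]; rewrite leq_eqVlt => /predU1P[<- _|ij jd]; last by apply: reg; lia.
by move=> /xp; case: pp => _ _ pM /pM[/px|].
Qed.

End PIT.

(** * Regular local rings *)

Section IdealPredicates.
Variable R : comNzRingType.

Definition ideal_pred (I : R -> Prop) (iI : ideal I) (I1 : ~ I 1) : {pred R} :=
  fun x => `[< I x >].

Lemma ideal_pred_closed I iI I1 : idealr_closed (@ideal_pred I iI I1).
Proof.
split; first by apply/asboolP; apply: ideal0.
  by apply/negP => /asboolP.
move=> a u v /asboolP Iu /asboolP Iv; apply/asboolP.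
by apply: idealD => //; apply: idealM.
Qed.
HB.instance Definition _ I iI I1 :=
  isIdealr.Build R (@ideal_pred I iI I1) (ideal_pred_closed iI I1).

(** Unlike [ideal_pred] this carries the proof of primality, from which the
structure of prime ideal is inferred. *)
Definition prime_pred (p : R -> Prop) (pp : is_prime p) : {pred R} :=
  fun x => `[< p x >].

Lemma prime_pred_closed p pp : idealr_closed (@prime_pred p pp).
Proof.
by have [ip p1 _] := pp; apply: (ideal_pred_closed ip p1).
Qed.
HB.instance Definition _ p pp :=
  isIdealr.Build R (@prime_pred p pp) (prime_pred_closed pp).

Lemma prime_pred_prime p pp : prime_idealr_closed (@prime_pred p pp).
Proof.
move=> u v /asboolP puv; apply/orP; have [_ _ /(_ _ _ puv)[pu|pv]] := pp.
  by left; apply/asboolP.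
by right; apply/asboolP.
Qed.
HB.instance Definition _ p pp :=
  isPrimeIdealrClosed.Build R (@prime_pred p pp) (@prime_pred_prime p pp).

Lemma ideal_idealr (I : idealr R) : ideal (fun x => x \in I).
Proof.
split; first exact: idealr0.
by move=> a x y xI yI; apply: rpredD => //; apply: (idealMr a xI).
Qed.

Lemma is_prime_idealr (p : prime_idealr R) : is_prime (fun x => x \in p).
Proof.
split; [exact: ideal_idealr|by rewrite idealr1|].
by move=> a b; rewrite prime_idealrM => /orP.
Qed.

Lemma noeth_regular : noetherian R -> noeth R^o.
Proof.
move=> nR N sN; have [N1|N1] := pselect (N 1).
  exists 1%N, (fun=> 1); split=> // x Nx; exists (fun=> x).
  by rewrite big_ord1 [_ *: _]mulr1.
have [n [g gP]] := nR (@ideal_pred N sN N1 : idealr R).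
exists n, g; split=> [i|x Nx].
  suff /asboolP : g i \in (@ideal_pred N sN N1 : idealr R) by [].
  apply/gP; exists (fun j => (j == i)%:R).
  by rewrite (bigD1 i)//= eqxx mul1r big1 ?addr0// => j /negPf->; rewrite mul0r.
by have /gP : x \in (@ideal_pred N sN N1 : idealr R) by apply/asboolP.
Qed.

End IdealPredicates.

Section LocalRing.
Variables (R : comNzRingType) (m : idealr R) (hR : local_ring m).

Lemma local_noeth : noeth R^o.
Proof. by case: hR => + _ _; apply: noeth_regular. Qed.

(** A non-unit generates a proper ideal, and this lies in a maximal one. *)
Lemma local_unit x : x \notin m -> exists y, y * x = 1.
Proof.
move=> xm; apply: contrapT => nx.
pose Phi (I : R -> Prop) := [/\ ideal I, ~ I 1 & I x].
have [||J [[iJ J1 Jx] Jmax]] := @noeth_max R R^o Phi local_noeth.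
- by move=> ? [].
- exists (fun a => exists y, a = y * x); split.
  + apply: idealI => [|a _ [y ->]|_ _ [y ->] [z ->]].
    * by exists 0; rewrite mul0r.
    * by exists (a * y); rewrite mulrA.
    * by exists (y + z); rewrite mulrDl.
  + by move=> [y xy]; apply: nx; exists y.
  + by exists 1; rewrite mul1r.
case: hR => _ _ /(_ (@ideal_pred R J iJ J1)) mJ; move/negP: xm; apply.
rewrite -mJ; first by apply/asboolP.
move=> K JK a; apply/idP/idP => [/JK//|aK]; apply/asboolP.
apply: (Jmax (fun a => a \in K)) => //.
  split; [exact: ideal_idealr|by rewrite idealr1|].
  by apply: JK; apply/asboolP.
by move=> b Jb; apply: JK; apply/asboolP.
Qed.

Lemma local_prime : is_prime (fun a => a \in m).
Proof.
split; [exact: ideal_idealr|by rewrite idealr1|].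
move=> a b abm; have [am|/local_unit[y ya]] := boolP (a \in m); [by left|right].
by rewrite -[b]mul1r -ya -mulrA; apply: (idealMr y abm).
Qed.

Lemma prime_sub_local p : is_prime p -> forall a, p a -> a \in m.
Proof.
move=> [ip p1 _] a pa; apply: contrapT => /negP/local_unit[y ya].
by apply: p1; rewrite -ya; apply: idealM.
Qed.

Lemma local_unit1 x a : x \in m -> exists y, y * (1 - a * x) = 1.
Proof.
move=> xm; apply: local_unit; apply/negP => h.
have := rpredD h (idealMr a xm : a * x \in m).
by rewrite subrK idealr1.
Qed.

Section RegularSequence.
Variables (x : nat -> R) (d : nat).
Hypothesis mx : forall a, a \in m <-> gen_ideal x d a.

(** Descending induction on i. Suppose a b lies in I = (x_0, ..., x_(i-1)) but
neither factor does. Among the elements outside I that multiply b into I,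
choose a' with I + Ra' maximal. Then a' is not in I + (x_i): otherwise a' is
c x_i modulo I, regularity of x_i makes c another such element, and maximality
gives c in I + Ra', so that (1 - r x_i) c is in I with an invertible factor.
The same applies to b, and a' b' contradicts the primality of I + (x_i). *)
Lemma regular_seq_prime i : regular_seq x d -> (i <= d)%N -> is_prime (gen_ideal x i).
Proof.
move=> reg; move id_: (d - i)%N => k; elim: k i id_ => [|k IHk] i dik id_.
  have -> : i = d by lia.
  have -> : gen_ideal x d = (fun a => a \in m).
    by apply/funext => a; apply/propext; split => /mx.
  exact: local_prime.
have [iS S1 SM] : is_prime (gen_ideal x i.+1) by apply: IHk; lia.
have iI := gen_ideal_closed x i.
have xi_m : x i \in m by apply/mx/mem_gen_ideal; lia.
have step a b : ~ gen_ideal x i a -> gen_ideal x i (a * b) ->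
    exists2 a', ~ gen_ideal x i.+1 a' & gen_ideal x i (a' * b).
  move=> Ia Iab.
  pose Phi I := exists a', [/\ ~ gen_ideal x i a', gen_ideal x i (a' * b) &
    I = @adjoin R R^o (gen_ideal x i) a'].
  have [|| _ [[a' [Ia' Ia'b ->]] Imax]] := @noeth_max R R^o Phi local_noeth.
  - by move=> _ [? [_ _ ->]]; apply: adjoin_submod.
  - by exists (@adjoin R R^o (gen_ideal x i) a), a.
  exists a' => // /gen_idealS[c a'c]; apply: (Ia').
  suff Ic : gen_ideal x i c.
    by rewrite -(subrK (c * x i) a'); apply: idealD => //; apply: idealMl.
  have Icb : gen_ideal x i (c * b).
    apply: reg; first by lia.
    rewrite (mulrAC c b) -(subKr (a' * b) (c * x i * b)).
    by apply: idealB => //; rewrite -mulrBl; apply: idealMl.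
  apply: contrapT => Inc; have [|||r cr] := Imax (@adjoin R R^o (gen_ideal x i) c) _ _ c.
  - by exists c.
  - move=> e [s es]; exists (s * x i).
    suff : gen_ideal x i ((e - s * a') + s * (a' - c * x i)).
      by congr gen_ideal; rewrite -[RHS]/(e - s * x i * c); ring.
    by apply: idealD => //; apply: idealM.
  - exact: (@adjoin_gen R R^o).
  apply: Inc; have [y y1] := local_unit1 r xi_m.
  rewrite -[c]mul1r -y1 -mulrA; apply: idealM => //.
  have -> : (1 - r * x i) * c = (c - r * a') + r * (a' - c * x i) by ring.
  by apply: idealD => //; apply: idealM.
split=> //.
  by move=> I1; apply: S1; apply: gen_idealW I1.
move=> a b Iab; apply: contrapT => /not_orP[Ia Ib].
have [a' Sa' Ia'b] := step a b Ia Iab.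
rewrite mulrC in Ia'b; have [b' Sb' Ib'a'] := step b a' Ib Ia'b.
by have [] := SM b' a' (gen_idealW (leqnSn i) Ib'a').
Qed.

(** The top of a chain is m, or m can be appended to it. *)
Lemma chain_below_local l (p : 'I_l.+1 -> prime_idealr R) : prime_chain p ->
  exists2 q, is_prime q &
    chain l q (fun a => a \in m) \/ chain l.+1 q (fun a => a \in m).
Proof.
move=> pch; pose q j : R -> Prop := fun a => a \in p (inord j).
have pq j : is_prime (q j) := is_prime_idealr _.
have ch j : (j <= l)%N -> chain j (q 0%N) (q j).
  elim: j => [//|j IHj] jl; exists (q j); split; [exact: pq|exact/IHj/ltnW|].
  have [|pj /existsNP[a /not_implyP[pa npa]]] := pch (inord j) (inord j.+1).
    by rewrite !inordK// ltnS ltnW.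
  by split=> //; exists a.
exists (q 0%N) => //.
have [mq|/existsNP[a /not_implyP[ma qa]]] := pselect (forall a, a \in m -> q l a).
  left; suff <- : q l = (fun a => a \in m) by apply: ch.
  by apply/funext => a; apply/propext; split=> [/prime_sub_local->|/mq].
right; exists (q l); split; [exact: pq|exact: ch|].
by split; [apply: prime_sub_local|exists a].
Qed.

Lemma gen_ideal0 a (I : R -> Prop) : ideal I -> gen_ideal x 0%N a -> I a.
Proof. by move=> iI [c ->]; rewrite big_ord0; apply: ideal0. Qed.

Lemma chain_le_local l q : is_prime q -> chain l q (fun a => a \in m) -> (l <= d)%N.
Proof.
move=> pq ch; rewrite -[d]subn0.
apply: (chain_le_generators local_noeth local_prime mx pq (leq0n d)) ch => a.
exact: gen_ideal0 (prime_ideal pq).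
Qed.

Lemma prime_chain_le l (p : 'I_l.+1 -> prime_idealr R) :
  prime_chain p -> (l <= d)%N.
Proof.
by case/chain_below_local => q pq [] /(chain_le_local pq)// /ltnW.
Qed.

(** The ideals (x_0, ..., x_(i-1)) are a chain of primes of length d; x_i is not
in the i-th one, for otherwise regularity would put 1 into it. *)
Lemma krull_dim_regular_seq : regular_seq x d -> has_krull_dim R d.
Proof.
move=> reg; split; last exact: prime_chain_le.
have pi (i : 'I_d.+1) : is_prime (gen_ideal x i) by apply: regular_seq_prime => //; rewrite -ltnS.
exists (fun i => prime_pred (pi i) : prime_idealr R) => i j ij; split=> [a /asboolP ia|ji].
  by apply/asboolP; apply: gen_idealW ia; apply: ltnW.
have id_ : (i < d)%N by rewrite -ltnS; apply: leq_ltn_trans ij (ltn_ord j).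
have [_ I1 _] := pi i; apply: I1; apply: reg => //; rewrite mul1r.
have /ji/asboolP // : x i \in prime_pred (pi j).
by apply/asboolP/mem_gen_ideal.
Qed.

Lemma regular_seq_krull_dim : has_krull_dim R d -> regular_seq x d.
Proof.
move=> [[p /chain_below_local[q pq [ch|ch]]] _]; last first.
  by have := chain_le_local pq ch; rewrite ltnn.
have un a : ~ a \in m -> exists b, b * a = 1 by move/negP/local_unit.
have xq a : gen_ideal x 0%N a -> q a by apply: gen_ideal0 (prime_ideal pq).
have [_ reg] := maximal_chain_gen_ideal local_noeth local_prime un mx pq (add0n d) xq ch.
by move=> i a id_; apply: reg.
Qed.

End RegularSequence.

Lemma generated_by_gen_ideal n (g : 'I_n -> R) : generated_by m g ->
  exists x : nat -> R, forall a, a \in m <-> gen_ideal x n a.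
Proof.
move=> gP; pose x j := if insub j is Some i then g i else 0.
have xE (i : 'I_n) : x i = g i by rewrite /x valK.
exists x => a; split=> [/gP[c ->]|[c ->]].
  pose e j := if insub j is Some i then c i else 0.
  by exists e; apply: eq_bigr => i _; rewrite xE /e valK.
by apply/gP; exists (fun i => c i); apply: eq_bigr => i _; rewrite xE.
Qed.

Lemma gen_ideal_generated_by n (x : nat -> R) : (forall a, a \in m <-> gen_ideal x n a) ->
  exists g : 'I_n -> R, generated_by m g.
Proof.
move=> mx; exists (fun i => x i) => a; split=> [/mx[c ->]|[c ->]]; first by exists (fun i => c i).
by apply: rpred_sum => i _; apply: (idealMr _ (_ : x i \in m)); apply/mx/mem_gen_ideal.
Qed.

Lemma regularP : regular m <-> exists d x,
  [/\ forall a, a \in m <-> gen_ideal x d a & regular_seq x d].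
Proof.
split=> [[d dimd [g gP]]|[d [x [mx reg]]]].
  have [x mx] := generated_by_gen_ideal gP; exists d, x; split=> //.
  exact: regular_seq_krull_dim.
by exists d; [apply: krull_dim_regular_seq mx reg|apply: gen_ideal_generated_by mx].
Qed.

End LocalRing.

(** * Submodules of free modules of finite rank *)

Section NoetherianVectors.
Variable R : comNzRingType.

Definition mk_linear (U V : lmodType R) (f : U -> V) (lf : linear f) : {linear U -> V} :=
  HB.pack f (GRing.isLinear.Build R U V *:%R f lf).

(** The middle module of an exact sequence is generated by the images of generators
on the left and lifts of generators on the right. *)
Lemma noeth_extension (M1 M M2 : lmodType R) (i : {linear M1 -> M})
    (p : {linear M -> M2}) :
  (forall y, p y = 0 -> exists x, i x = y) -> noeth M1 -> noeth M2 -> noeth M.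
Proof.
move=> ex n1 n2 N sN.
have [|r1 [g1 [N1g1 gen1]]] := n1 (fun x => N (i x)).
  split; first by rewrite linear0; apply: submod0.
  by move=> a x y Nx Ny; rewrite linearP; apply: sN.2.
have [|r2 [g2 [N2g2 gen2]]] := n2 (fun z => exists2 y, N y & p y = z).
  split; first by exists 0; [apply: submod0|rewrite linear0].
  move=> a _ _ [y Ny <-] [z Nz <-]; exists (a *: y + z); last by rewrite linearP.
  exact: sN.2.
have /choice[h hP] : forall k, exists y, N y /\ p y = g2 k.
  by move=> k; have [y] := N2g2 k; exists y.
exists (r1 + r2)%N.
exists (fun k => match fintype.split k with inl k => i (g1 k) | inr k => h k end); split.
  by move=> k; case: fintype.split => k'; [apply: N1g1|have [] := hP k'].
move=> y Ny; have [|a ya] := gen2 (p y); first by exists y.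
have [|x xE] := ex (y - \sum_k a k *: h k).
  rewrite linearB ya linear_sum; apply/eqP; rewrite subr_eq0; apply/eqP.
  by apply: eq_bigr => k _; rewrite linearZ/=; have [_ ->] := hP k.
have [|b xb] := gen1 x.
  rewrite xE; apply: submodB => //; apply: submod_sum => // k _.
  by apply: submodZ => //; have [] := hP k.
exists (fun k => match fintype.split k with inl k => b k | inr k => a k end).
rewrite big_split_ord/= -(subrK (\sum_k a k *: h k) y) -xE xb linear_sum; congr (_ + _).
  apply: eq_bigr => k _; rewrite linearZ/=.
  by case: split_ordP => k' => [/lshift_inj->//|/eqP]; rewrite eq_lrshift.
apply: eq_bigr => k _.
by case: split_ordP => k' => [/eqP|/rshift_inj->//]; rewrite eq_rlshift.
Qed.

Lemma noeth_cV k : noeth R^o -> noeth ('cV[R]_k : lmodType R).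
Proof.
move=> nR; elim: k => [|k IHk].
  move=> N sN; exists 0%N, (fun=> 0); split=> [i|x Nx]; first exact: submod0.
  by exists (fun=> 0); rewrite big_ord0; apply/matrixP => -[].
have li : linear (fun w : 'cV[R]_k => col_mx 0 w : 'cV[R]_(1 + k)).
  by move=> a u v; rewrite scale_col_mx add_col_mx scaler0 addr0.
have lp : linear (fun v : 'cV[R]_(1 + k) => v 0 0 : R^o).
  by move=> a u v; rewrite !mxE.
apply: (@noeth_extension _ _ _ (mk_linear li) (mk_linear lp)) => //= v v0.
exists (dsubmx (v : 'cV_(1 + k))); rewrite -[RHS](@vsubmxK _ 1 k).
congr col_mx; apply/matrixP => i j; rewrite !mxE !ord1.
by rewrite -v0; congr (v _ _); apply/val_inj.
Qed.

End NoetherianVectors.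

(** * The Koszul complex *)

Section Koszul.
Variable R : comNzRingType.
Implicit Types (x a : nat -> R) (e l q : nat).

(** Graded free modules are modules of column vectors whose coordinates carry
degrees; a homogeneous vector is supported on the coordinates of its degree. *)
Definition homog b (deg : 'I_b -> nat) q (v : 'cV[R]_b) : Prop :=
  forall i, v i 0 != 0 -> deg i = q.

(** The relations of a differential graded module over the Koszul complex: d is the
differential and X l is multiplication by the l-th exterior variable. *)
Definition koszul_rel x e b (d : 'M[R]_b) (X : nat -> 'M[R]_b) : Prop :=
  [/\ forall l, (l < e)%N -> d *m X l + X l *m d = (x l)%:M,
      forall k l, (k < e)%N -> (l < e)%N -> X k *m X l = - (X l *m X k)
    & forall l, (l < e)%N -> X l *m X l = 0].

Fixpoint krank e := if e is e'.+1 then (krank e' + krank e')%N else 1%N.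

Fixpoint kdeg e : 'I_(krank e) -> nat :=
  if e is e'.+1 return 'I_(krank e) -> nat then fun i =>
    match fintype.split i with inl j => kdeg j | inr j => (kdeg j).+1 end
  else fun=> 0%N.

(** The Koszul complex on e+1 elements is the sum of K and X_e K, where K is the
one on e elements; the blocks express d (X_e w) = x_e w - X_e (d w). *)
Fixpoint kdiff x e : 'M[R]_(krank e) :=
  if e is e'.+1 return 'M[R]_(krank e) then
    block_mx (kdiff x e') (x e')%:M 0 (- kdiff x e')
  else 0.

Fixpoint kmul e l : 'M[R]_(krank e) :=
  if e is e'.+1 return 'M[R]_(krank e) then
    if l == e' then block_mx 0 0 1%:M 0 else block_mx (kmul e' l) 0 0 (- kmul e' l)
  else 0.

Fixpoint kone e : 'I_(krank e) :=
  if e is e'.+1 return 'I_(krank e) then lshift (krank e') (kone e') else ord0.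

Lemma kdeg_l e (i : 'I_(krank e)) : @kdeg e.+1 (lshift _ i) = kdeg i.
Proof. by rewrite /=; case: split_ordP => j => [/lshift_inj->//|/eqP]; rewrite eq_lrshift. Qed.

Lemma kdeg_r e (i : 'I_(krank e)) : @kdeg e.+1 (rshift _ i) = (kdeg i).+1.
Proof. by rewrite /=; case: split_ordP => j => [/eqP|/rshift_inj->//]; rewrite eq_rlshift. Qed.

Lemma kdiff2 x e : kdiff x e *m kdiff x e = 0.
Proof.
elim: e => [|e IHe] /=; first by rewrite mul0mx.
rewrite mulmx_block !(mulmxN, mulNmx) opprK IHe !(mulmx0, mul0mx, addr0, oppr0).
by rewrite scalar_mxC subrr block_mx_const.
Qed.

Lemma kmul_rel x e : koszul_rel x e (kdiff x e) (kmul e).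
Proof.
elim: e => [|e [dX XX X2]] /=; first by split.
have kmul_diag l : (l < e)%N -> (l == e) = false by move=> le; rewrite ltn_eqF.
split=> [l|k l|l]; rewrite ltnS leq_eqVlt.
- case: eqP => [-> _|_ /= le].
    rewrite !mulmx_block !(mulmx0, mul0mx, mulmx1, mul1mx, addr0, add0r) add_block_mx.
    by rewrite addr0 add0r addNr add0r [in RHS]scalar_mx_block.
  rewrite !mulmx_block !(mulmx0, mul0mx, addr0, add0r, mulmxN, mulNmx, opprK) add_block_mx.
  by rewrite dX// addr0 scalar_mxC addNr [in RHS]scalar_mx_block.
- case/predU1P => [->|ke]; rewrite ltnS leq_eqVlt => /predU1P[->|le];
    rewrite ?eqxx ?kmul_diag//;
    rewrite !mulmx_block !(mulmx0, mul0mx, mulmx1, mul1mx, addr0, add0r, mulmxN, mulNmx, opprK);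
    rewrite opp_block_mx !(oppr0, opprK)//.
  by rewrite XX//.
- case: eqP => [-> _|_ /= le];
    rewrite !mulmx_block !(mulmx0, mul0mx, mulmx1, mul1mx, addr0, add0r, mulmxN, mulNmx, opprK).
    by rewrite block_mx_const.
  by rewrite X2// block_mx_const.
Qed.

Lemma kdiff_deg x e i j : kdiff x e i j != 0 -> kdeg j = (kdeg i).+1.
Proof.
elim: e i j => [|e IHe] i j; first by rewrite mxE eqxx.
case: (split_ordP i) => i' ->; case: (split_ordP j) => j' ->; rewrite ?kdeg_l ?kdeg_r /=.
- by rewrite block_mxEul => /IHe.
- rewrite block_mxEur mxE; case: (i' =P j') => [-> _//|_]; by rewrite mulr0n eqxx.
- by rewrite block_mxEdl mxE eqxx.
- by rewrite block_mxEdr mxE oppr_eq0 => /IHe ->.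
Qed.

Lemma kmul_deg e l i j : kmul e l i j != 0 -> kdeg i = (kdeg j).+1.
Proof.
elim: e i j => [|e IHe] i j; first by rewrite mxE eqxx.
case: (split_ordP i) => i' ->; case: (split_ordP j) => j' ->; rewrite ?kdeg_l ?kdeg_r /=;
  case: (l == e).
- by rewrite block_mxEul mxE eqxx.
- by rewrite block_mxEul => /IHe.
- by rewrite block_mxEur mxE eqxx.
- by rewrite block_mxEur mxE eqxx.
- rewrite block_mxEdl mxE; case: (i' =P j') => [-> _//|_]; by rewrite mulr0n eqxx.
- by rewrite block_mxEdl mxE eqxx.
- by rewrite block_mxEdr mxE eqxx.
- by rewrite block_mxEdr mxE oppr_eq0 => /IHe ->.
Qed.

Lemma kdeg_one e i : (@kdeg e i == 0%N) = (i == kone e).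
Proof.
elim: e i => [|e IHe] i; first by rewrite ord1 !eqxx.
case: (split_ordP i) => i' ->; rewrite ?kdeg_l ?kdeg_r.
  by rewrite IHe (inj_eq (@lshift_inj _ _)).
by rewrite [RHS]/= eq_rlshift.
Qed.

Lemma kdiff_one x e j : gen_ideal x e (kdiff x e (kone e) j).
Proof.
elim: e j => [|e IHe] j.
  by rewrite mxE; apply: ideal0; apply: gen_ideal_closed.
case: (split_ordP j) => j' ->.
  by rewrite [kdiff _ _ _ _]block_mxEul; apply: gen_idealW (IHe _).
rewrite [kdiff _ _ _ _]block_mxEur mxE; case: (_ == _).
  by rewrite mulr1n; apply: mem_gen_ideal.
by rewrite mulr0n; apply: ideal0; apply: gen_ideal_closed.
Qed.

(** K is the free differential graded K-module on its unit: a cycle z of a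
differential graded module is the image of the unit under one K-linear chain
map, which sends u + X_e w to phi u + X_e (phi w). *)
Lemma kextend x e b (deg : 'I_b -> nat) (d : 'M[R]_b) (X : nat -> 'M[R]_b) q z :
  koszul_rel x e d X ->
  (forall l i j, (l < e)%N -> X l i j != 0 -> deg i = (deg j).+1) ->
  homog deg q z -> d *m z = 0 ->
  exists phi : 'M[R]_(b, krank e),
    [/\ phi *m delta_mx (kone e) 0 = z, d *m phi = phi *m kdiff x e,
        forall l, (l < e)%N -> X l *m phi = phi *m kmul e l
      & forall i j, phi i j != 0 -> deg i = (kdeg j + q)%N].
Proof.
move=> + + hz dz; elim: e => [_ _|e IHe [dX XX X2] Xdeg].
  exists z; split=> //; last by move=> i j; rewrite !ord1 => /hz.
    by apply/matrixP => i j; rewrite !ord1 mxE big_ord1 mxE !eqxx mulr1.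
  by rewrite dz mulmx0.
have [||phi [phi1 dphi Xphi degphi]] := IHe.
- split=> [l le|k l ke le|l le]; [apply: dX|apply: XX|apply: X2]; exact: ltnW.
- by move=> l i j le; apply: Xdeg; apply: ltnW.
exists (row_mx phi (X e *m phi)); split.
- have -> : delta_mx (kone e.+1) 0 = col_mx (delta_mx (kone e) 0) 0 :> 'cV[R]_(krank e.+1).
    by rewrite [kone _]/= delta_mx_ushift.
  by rewrite mul_row_col mulmx0 addr0.
- rewrite [kdiff _ _]/= mul_row_block mulmx0 addr0 mul_mx_row -dphi; congr row_mx.
  rewrite mulmxN -mulmxA -dphi mul_mx_scalar -mul_scalar_mx -dX// mulmxDl !mulmxA addrK.
  by [].
- move=> l; rewrite ltnS leq_eqVlt [kmul _ _]/=.
  case: eqP => [-> _|_ /= le].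
    rewrite mul_row_block !mulmx0 mulmx1 add0r addr0 mul_mx_row mulmxA X2// mul0mx.
    by [].
  rewrite mul_row_block !mulmx0 add0r addr0 mul_mx_row Xphi//; congr row_mx.
  by rewrite mulmxN -(mulmxA (X e)) -Xphi// !mulmxA (XX l e) ?mulNmx// ltnW.
- move=> i j; case: (split_ordP j) => j' ->; rewrite ?kdeg_l ?kdeg_r.
    by rewrite row_mxEl => /degphi.
  rewrite row_mxEr mxE => /eqP nz.
  have [k] : exists k, X e i k * phi k j' != 0.
    apply: contrapT => no; apply: nz; apply: big1 => k _; apply/eqP.
    by apply: contrapT => /negP h; apply: no; exists k.
  move=> nzk; rewrite addSn -(degphi k).
    by apply: (Xdeg e) => //; apply: contraNneq nzk => ->; rewrite mul0r.
  by apply: contraNneq nzk => ->; rewrite mulr0.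
Qed.

Lemma homog_col_mx e q (u v : 'cV[R]_(krank e)) :
  @homog (krank e.+1) (@kdeg e.+1) q (col_mx u v) <->
  homog (@kdeg e) q u /\ (forall i, v i 0 != 0 -> (kdeg i).+1 = q).
Proof.
split=> [h|[hu hv] i].
  split=> i nz; [rewrite -kdeg_l|rewrite -kdeg_r]; apply: h.
    by rewrite (@col_mxEu _ (krank e) (krank e)).
  by rewrite (@col_mxEd _ (krank e) (krank e)).
case: (split_ordP i) => i' ->; rewrite ?kdeg_l ?kdeg_r.
  by rewrite (@col_mxEu _ (krank e) (krank e)) => /hu.
by rewrite (@col_mxEd _ (krank e) (krank e)) => /hv.
Qed.

End Koszul.

(** * Differential graded modules over the Koszul complex *)

Section KoszulModules.
Variables (R : comNzRingType) (x : nat -> R) (e : nat).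

(** Besides the relations, [mdeg1] asks for a single coordinate of degree 0, and
[md1] for boundaries of degree 0 in the ideal generated by the x_l. *)
Record kmodule := KModule {
  mrank : nat;
  mdeg : 'I_mrank -> nat;
  md : 'M[R]_mrank;
  mX : nat -> 'M[R]_mrank;
  m1 : 'I_mrank;
  md2 : md *m md = 0;
  mrel : koszul_rel x e md mX;
  md_deg : forall i j, md i j != 0 -> mdeg j = (mdeg i).+1;
  mX_deg : forall l i j, (l < e)%N -> mX l i j != 0 -> mdeg i = (mdeg j).+1;
  mdeg1 : forall i, (mdeg i == 0%N) = (i == m1);
  md1 : forall j, gen_ideal x e (md m1 j) }.

Definition koszul : kmodule :=
  KModule (kdiff2 x e) (kmul_rel x e) (@kdiff_deg _ x e)
    (fun l i j _ => @kmul_deg R e l i j) (@kdeg_one e) (@kdiff_one _ x e).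

Definition munit B : 'cV[R]_(mrank B) := delta_mx (m1 B) 0.
Notation mhomog B := (homog (@mdeg B)).

Lemma homog0 b (deg : 'I_b -> nat) q : homog deg q (0 : 'cV[R]_b).
Proof. by move=> i; rewrite mxE eqxx. Qed.

Lemma homogP b (deg : 'I_b -> nat) q a (v w : 'cV[R]_b) :
  homog deg q v -> homog deg q w -> homog deg q (a *: v + w).
Proof.
move=> hv hw i; rewrite !mxE => nz; have [vi|/hv//] := eqVneq (v i 0) 0.
by apply: hw; apply: contraNneq nz => ->; rewrite vi mulr0 addr0.
Qed.

Lemma homogZ b (deg : 'I_b -> nat) q a (v : 'cV[R]_b) : homog deg q v -> homog deg q (a *: v).
Proof. by move=> hv; rewrite -[_ *: _]addr0; apply: homogP => //; apply: homog0. Qed.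

Lemma homogD b (deg : 'I_b -> nat) q (v w : 'cV[R]_b) :
  homog deg q v -> homog deg q w -> homog deg q (v + w).
Proof. by move=> hv hw; rewrite -[v]scale1r; apply: homogP. Qed.

Lemma homog_mul b (deg : 'I_b -> nat) q r (A : 'M[R]_b) (v : 'cV[R]_b) :
  (forall i j, A i j != 0 -> deg j = q -> deg i = r) ->
  homog deg q v -> homog deg r (A *m v).
Proof.
move=> hA hv i; rewrite mxE => /eqP nz.
have [j] : exists j, A i j * v j 0 != 0.
  apply: contrapT => no; apply: nz; apply: big1 => j _; apply/eqP.
  by apply: contrapT => /negP h; apply: no; exists j.
move=> nzj; apply: (hA i j); first by apply: contraNneq nzj => ->; rewrite mul0r.
by apply: hv; apply: contraNneq nzj => ->; rewrite mulr0.
Qed.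

Lemma mhomog_X B l q v : (l < e)%N -> mhomog B q v -> mhomog B q.+1 (mX B l *m v).
Proof. by move=> le; apply: homog_mul => i j /(mX_deg le) -> ->. Qed.

Lemma mhomog_unit B : mhomog B 0 (munit B).
Proof.
move=> i; rewrite mxE eqxx andbT; case: (i =P m1 B) => [-> _|]; last by rewrite eqxx.
by apply/eqP; rewrite mdeg1.
Qed.

Lemma md_unit B : md B *m munit B = 0.
Proof.
rewrite -colE; apply/matrixP => i j; rewrite !mxE; apply/eqP/negPn/negP => /md_deg.
by have /eqP -> : mdeg (m1 B) == 0%N by rewrite mdeg1.
Qed.

(** Extensions of B that leave the vectors of degree at most q unchanged. *)
Record embedding q B B' (iota : 'cV[R]_(mrank B) -> 'cV[R]_(mrank B')) : Prop :=
  Embedding {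
  emb_linear : linear iota;
  emb_inj : injective iota;
  emb_d : forall v, md B' *m iota v = iota (md B *m v);
  emb_X : forall l v, (l < e)%N -> mX B' l *m iota v = iota (mX B l *m v);
  emb_unit : iota (munit B) = munit B';
  emb_homog : forall p v, mhomog B p v -> mhomog B' p (iota v);
  emb_surj : forall p w, (p <= q)%N -> mhomog B' p w ->
    exists2 v, mhomog B p v & w = iota v }.

Lemma embedding_id q B : embedding q (@id 'cV[R]_(mrank B)).
Proof. by split=> // p w _ hw; exists w. Qed.

Lemma embedding_comp q B B' B'' (iota : 'cV_(mrank B) -> 'cV_(mrank B'))
    (iota' : 'cV_(mrank B') -> 'cV_(mrank B'')) :
  embedding q iota -> embedding q iota' -> embedding q (iota' \o iota).
Proof.
move=> [l i d X u h s] [l' i' d' X' u' h' s']; split=> /=.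
- by move=> a v w /=; rewrite l l'.
- by move=> v w /= /i'/i.
- by move=> v; rewrite d' d.
- by move=> k v ke; rewrite X' ?X.
- by rewrite u u'.
- by move=> p v /h/h'.
- by move=> p w pq /(s' _ _ pq)[v /(s _ _ pq)[u0 hu ->] ->]; exists u0.
Qed.

(** The free K-module on a generator of degree q+1 is attached along z. It enters
through the map K -> B, 1 |-> z, which must anticommute with the operators for
the total differential to square to zero; hence [kextend] is applied to B with
the opposite operators. *)
Lemma attach B q z : (0 < q)%N -> mhomog B q z -> md B *m z = 0 ->
  exists B' iota, [/\ @embedding q B B' iota,
    exists2 w, mhomog B' q.+1 w & md B' *m w = iota z
  & forall w, mhomog B' q.+1 w ->
      exists v c, mhomog B q.+1 v /\ md B' *m w = iota (md B *m v + c *: z)].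
Proof.
move=> q0 hz dz.
have [||||phi [phi1 dphi Xphi degphi]] :=
    @kextend R x e (mrank B) (@mdeg B) (- md B) (fun l => - mX B l) q z.
- have [dX XX X2] := mrel B; split=> [l le|k l ke le|l le].
  + by rewrite !mulmxN !mulNmx !opprK dX.
  + by rewrite !mulmxN !mulNmx !opprK XX.
  + by rewrite !mulmxN !mulNmx !opprK X2.
- by move=> l i j le; rewrite mxE oppr_eq0; apply: mX_deg.
- exact: hz.
- by rewrite mulNmx dz oppr0.
pose b' := (mrank B + krank e)%N.
(* the new generator has degree q+1, because its boundary z has degree q *)
pose deg' (i : 'I_b') := match fintype.split i with
  inl j => mdeg j | inr j => (kdeg j + q).+1 end.
have deg'l j : deg' (lshift _ j) = mdeg j.
  by rewrite /deg'; case: split_ordP => k => [/lshift_inj->//|/eqP]; rewrite eq_lrshift.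
have deg'r j : deg' (rshift _ j) = (kdeg j + q).+1.
  by rewrite /deg'; case: split_ordP => k => [/eqP|/rshift_inj->//]; rewrite eq_rlshift.
pose d' : 'M[R]_b' := block_mx (md B) phi 0 (kdiff x e).
pose X' l : 'M[R]_b' := block_mx (mX B l) 0 0 (kmul R e l).
have d'2 : d' *m d' = 0.
  rewrite mulmx_block md2 kdiff2 !(mulmx0, mul0mx, addr0, add0r) -dphi mulNmx subrr.
  by rewrite block_mx_const.
have X'rel : koszul_rel x e d' X'.
  have [dX XX X2] := mrel B; have [kdX kXX kX2] := kmul_rel x e.
  split=> [l le|k l ke le|l le].
  - rewrite !mulmx_block !(mulmx0, mul0mx, addr0, add0r) add_block_mx addr0 dX// kdX//.
    by rewrite -Xphi// mulNmx addNr [RHS]scalar_mx_block.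
  - rewrite !mulmx_block !(mulmx0, mul0mx, addr0, add0r) opp_block_mx !oppr0.
    by rewrite XX// kXX//.
  - by rewrite !mulmx_block !(mulmx0, mul0mx, addr0, add0r) X2// kX2// block_mx_const.
have d'deg i j : d' i j != 0 -> deg' j = (deg' i).+1.
  case: (split_ordP i) => i' ->; case: (split_ordP j) => j' ->; rewrite ?deg'l ?deg'r.
  - by rewrite block_mxEul => /md_deg.
  - by rewrite block_mxEur => /degphi ->.
  - by rewrite block_mxEdl mxE eqxx.
  - by rewrite block_mxEdr => /kdiff_deg ->.
have X'deg l i j : (l < e)%N -> X' l i j != 0 -> deg' i = (deg' j).+1.
  move=> le; case: (split_ordP i) => i' ->; case: (split_ordP j) => j' ->; rewrite ?deg'l ?deg'r.
  - by rewrite block_mxEul => /(mX_deg le).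
  - by rewrite block_mxEur mxE eqxx.
  - by rewrite block_mxEdl mxE eqxx.
  - by rewrite block_mxEdr => /kmul_deg ->.
pose one' : 'I_b' := lshift (krank e) (m1 B).
have deg'1 i : (deg' i == 0%N) = (i == one').
  case: (split_ordP i) => i' ->; rewrite ?deg'l ?deg'r.
    by rewrite mdeg1 (inj_eq (@lshift_inj _ _)).
  by rewrite eq_rlshift.
have d'1 j : gen_ideal x e (d' one' j).
  case: (split_ordP j) => j' ->; first by rewrite block_mxEul; apply: md1.
  rewrite block_mxEur; have [->|/degphi] := eqVneq (phi (m1 B) j') 0.
    by apply: ideal0; apply: gen_ideal_closed.
  have /eqP -> : mdeg (m1 B) == 0%N by rewrite mdeg1.
  by move=> h; exfalso; lia.
pose B' := KModule d'2 X'rel d'deg X'deg deg'1 d'1.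
exists B', (fun v => col_mx v 0).
have dE v w : d' *m col_mx v w = col_mx (md B *m v + phi *m w) (kdiff x e *m w).
  by rewrite mul_block_col mul0mx add0r.
have homE p (w : 'cV[R]_b') : homog deg' p w ->
    homog (@mdeg B) p (usubmx w) /\ forall i, dsubmx w i 0 != 0 -> (kdeg i + q).+1 = p.
  by move=> hw; split=> i; rewrite mxE => /hw; rewrite ?deg'l ?deg'r.
split; first split.
- by move=> a v w; rewrite scale_col_mx add_col_mx scaler0 addr0.
- by move=> v w /eq_col_mx[].
- by move=> v; rewrite dE !mulmx0 addr0.
- by move=> l v le; rewrite mul_block_col !mulmx0 !mul0mx !addr0.
- by rewrite /munit [m1 B']/= delta_mx_ushift.
- move=> p v hv i; case: (split_ordP i) => i' ->.
    by rewrite [mdeg _]deg'l col_mxEu => /hv.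
  by rewrite col_mxEd mxE eqxx.
- move=> p w pq /homE[hu hd]; exists (usubmx w) => //.
  rewrite -[LHS]vsubmxK; congr col_mx; apply/matrixP => i j; rewrite ord1 [RHS]mxE.
  by apply/eqP/negPn/negP => /hd; lia.
- exists (col_mx 0 (delta_mx (kone e) 0)).
    move=> i; case: (split_ordP i) => i' ->; first by rewrite col_mxEu mxE eqxx.
    rewrite [mdeg _]deg'r col_mxEd mxE eqxx andbT; case: (i' =P _) => [->|]; last by rewrite eqxx.
    by have /eqP -> : kdeg (kone e) == 0%N by rewrite kdeg_one.
  by rewrite [md B' *m _]dE mulmx0 add0r phi1 (md_unit koszul).
- move=> w /homE[hu hd]; pose c := dsubmx w (kone e) 0.
  have wE : dsubmx w = c *: delta_mx (kone e) 0.
    apply/matrixP => i j; rewrite ord1 [RHS]mxE [in RHS]mxE eqxx andbT.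
    case: (i =P kone e) => [->|/eqP ni]; first by rewrite mulr1.
    rewrite mulr0; apply/eqP/negPn/negP => /hd [] /eqP.
    by rewrite -{2}[q]add0n eqn_add2r kdeg_one (negPf ni).
  exists (usubmx w), c; split=> //; rewrite -{1}[w]vsubmxK [md B' *m _]dE wE.
  by rewrite -!scalemxAr phi1 (md_unit koszul) scaler0.
Qed.

End KoszulModules.

(** * Killing cycles *)

Section Boundaries.
Variables (R : comNzRingType) (x : nat -> R) (e : nat).
Implicit Types B : kmodule x e.

Definition boundary B q (w : 'cV[R]_(mrank B)) : Prop :=
  exists2 u, homog (@mdeg _ _ _ B) q.+1 u & md B *m u = w.

Definition exact_at B q : Prop :=
  forall w, homog (@mdeg _ _ _ B) q w -> md B *m w = 0 -> boundary q w.

(** The cycles attached to the relations among the x_l, see [md_relvec]. *)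
Definition relvec B (a : nat -> R) : 'cV[R]_(mrank B) :=
  \sum_(l < e) a l *: (mX B l *m munit B).

Lemma boundary_submod B q : submod (M := 'cV[R]_(mrank B)) (@boundary B q).
Proof.
split; first by exists 0; [apply: homog0|rewrite mulmx0].
move=> a _ _ [u hu <-] [v hv <-]; exists (a *: u + v); first exact: homogP.
by rewrite mulmxDr -scalemxAr.
Qed.

Lemma relvec_homog B a : homog (@mdeg _ _ _ B) 1 (relvec B a).
Proof.
apply: (big_ind (homog _ 1)); [exact: homog0|exact: homogD|].
by move=> l _; apply: homogZ; apply: mhomog_X => //; apply: mhomog_unit.
Qed.

Lemma md_relvec B a : md B *m relvec B a = (\sum_(l < e) a l * x l) *: munit B.
Proof.
rewrite mulmx_sumr scaler_suml; apply: eq_bigr => l _.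
have [dX _ _] := mrel B.
rewrite -scalemxAr mulmxA -[md B *m _](addrK (mX B l *m md B)) dX// mulmxBl.
by rewrite -mulmxA md_unit mulmx0 subr0 mul_scalar_mx scalerA.
Qed.

(** X_l is a homotopy between multiplication by x_l and zero. *)
Lemma cycle_boundary B l q w : (l < e)%N -> homog (@mdeg _ _ _ B) q w -> md B *m w = 0 ->
  boundary q (x l *: w).
Proof.
move=> le hw dw; exists (mX B l *m w); first exact: mhomog_X.
have [dX _ _] := mrel B.
rewrite mulmxA -[md B *m _](addrK (mX B l *m md B)) dX// mulmxBl.
by rewrite -mulmxA dw mulmx0 subr0 mul_scalar_mx.
Qed.

Lemma emb_relvec B B' q (iota : 'cV_(mrank B) -> 'cV_(mrank B')) a :
  embedding q iota -> iota (relvec B a) = relvec B' a.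
Proof.
move=> E; rewrite -[iota _]/(mk_linear (emb_linear E) _) linear_sum.
apply: eq_bigr => l _; rewrite linearZ/=; congr (_ *: _).
by rewrite -(emb_X E)// (emb_unit E).
Qed.

Lemma emb_boundary B B' q p (iota : 'cV_(mrank B) -> 'cV_(mrank B')) w :
  embedding q iota -> boundary p w -> boundary p (iota w).
Proof.
by move=> E [u hu <-]; exists (iota u); [apply: (emb_homog E)|rewrite (emb_d E)].
Qed.

Lemma emb_boundary_inv B B' q p (iota : 'cV_(mrank B) -> 'cV_(mrank B')) w :
  embedding q iota -> (p < q)%N -> boundary p (iota w) -> boundary p w.
Proof.
move=> E pq [u /(emb_surj E pq)[v hv ->]].
by rewrite (emb_d E) => /(emb_inj E) <-; exists v.
Qed.

Lemma emb0 B B' q (iota : 'cV_(mrank B) -> 'cV_(mrank B')) :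
  embedding q iota -> iota 0 = 0.
Proof. by move=> E; rewrite -[iota _]/(mk_linear (emb_linear E) _) linear0. Qed.

Lemma emb_exact_at B B' q p (iota : 'cV_(mrank B) -> 'cV_(mrank B')) :
  embedding q iota -> (p < q)%N -> exact_at B p -> exact_at B' p.
Proof.
move=> E pq Bp w /(emb_surj E (ltnW pq))[v hv ->].
rewrite (emb_d E) -(emb0 E) => /(emb_inj E) dv.
by apply: emb_boundary E _; apply: Bp.
Qed.

(** Lists of generators are consumed one by one while the ambient module changes,
which is why combinations are defined by recursion on the list. *)
Fixpoint combination b (U : 'cV[R]_b -> Prop) (S : seq 'cV[R]_b) (w : 'cV[R]_b) : Prop :=
  if S is s :: S' then exists c, combination U S' (w - c *: s) else U w.

Lemma combination_fingen b (U N : 'cV[R]_b -> Prop) : noeth ('cV[R]_b : lmodType R) ->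
  submod (M := 'cV[R]_b) N -> U 0 ->
  exists S, (forall s, s \in S -> N s) /\ forall w, N w -> combination U S w.
Proof.
move=> nb sN U0; have [n [g [Ng gP]]] := nb N sN.
exists [seq g i | i <- index_enum 'I_n]; split.
  by move=> _ /mapP[i _ ->].
move=> w /gP[a ->]; elim: (index_enum _) => [|i s IHs]; first by rewrite big_nil.
by exists (a i); rewrite big_cons addrC addKr.
Qed.

Lemma combination_skip b (U : 'cV[R]_b -> Prop) s S w : submod (M := 'cV[R]_b) U -> U s ->
  combination U (s :: S) w -> combination U S w.
Proof.
move=> sU Us [c]; elim: S w => [|s' S IHS] w /=.
  move=> Uw; rewrite -(subrK (c *: s) w); apply: (submodD sU) => //; exact: (submodZ sU).
by move=> [c' h]; exists c'; apply: IHS; rewrite addrAC.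
Qed.

(** Attaching a cell along z turns z into a boundary, so that it can be removed
from a list of generators. *)
Lemma combination_emb B B' q (iota : 'cV_(mrank B) -> 'cV_(mrank B')) (U V : _ -> Prop) S w z :
  embedding q iota -> submod (M := 'cV[R]_(mrank B')) V -> (forall w, U w -> V (iota w)) ->
  V (iota z) -> combination U (z :: S) w -> combination V [seq iota s | s <- S] (iota w).
Proof.
move=> E sV UV Vz [c]; elim: S w => [|s S IHS] w /=.
  move=> /UV; rewrite -[iota _]/(mk_linear (emb_linear E) _) linearB linearZ/= => h.
  by rewrite -(subrK (c *: iota z) (iota w)); apply: (submodD sV) => //; apply: (submodZ sV).
move=> [c' h]; exists c'; have := IHS (w - c' *: s); rewrite addrAC => /(_ h).
by rewrite -[iota (_ - _)]/(mk_linear (emb_linear E) _) linearB linearZ.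
Qed.

End Boundaries.

Section KillingCycles.
Variables (R : comNzRingType) (m : idealr R) (hR : local_ring m).

Lemma saturation_local (M : lmodType R) (N : M -> Prop) : submod N ->
  forall v, saturation (fun a => a \in m) N v -> N v.
Proof.
move=> sN v [s /negP/(local_unit hR)[y ys] Nsv].
by rewrite -[v]scale1r -ys -scalerA; apply: submodZ.
Qed.

Lemma koszul_deg1 (x : nat -> R) e (w : 'cV[R]_(krank e)) :
  homog (@kdeg e) 1 w -> exists a, w = relvec (koszul x e) a.
Proof.
rewrite /relvec /munit /=; elim: e w => [|e IHe] w hw.
  exists (fun=> 0); rewrite big_ord0; apply/matrixP => i j; rewrite [j]ord1 [RHS]mxE.
  by apply/eqP/negPn/negP => /hw.
move: hw; rewrite -[w]vsubmxK => /homog_col_mx[hu hv].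
have [a uE] := IHe _ hu; pose c := dsubmx w (kone e) 0.
have vE : dsubmx w = c *: delta_mx (kone e) 0.
  apply/matrixP => i j; rewrite ord1 [RHS]mxE [in RHS]mxE eqxx andbT.
  case: (i =P kone e) => [->|/eqP ni]; first by rewrite mulr1.
  rewrite mulr0; apply/eqP/negPn/negP => /hv [] /eqP.
  by rewrite kdeg_one (negPf ni).
exists (fun l => if l == e then c else a l).
rewrite big_ord_recr/= eqxx {}vE {}uE delta_mx_ushift.
rewrite mul_block_col !(mulmx0, mul0mx, mul1mx, addr0, add0r) scale_col_mx scaler0.
have colD (u u' v v' : 'cV[R]_(krank e)) :
    col_mx u v + col_mx u' v' = col_mx (u + u') (v + v') by rewrite add_col_mx.
rewrite -[X in col_mx X _]addr0 -[X in col_mx _ X]add0r -colD; congr (_ + _).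
elim/big_ind2 : _ => [|u u' v v' <- <-|l _]; first by rewrite col_mx0.
  by rewrite colD addr0.
rewrite (ltn_eqF (ltn_ord l)) mul_block_col !(mulmx0, mul0mx, addr0, add0r).
by rewrite scale_col_mx scaler0.
Qed.

(** Let K be the Koszul complex on the first e elements. A 1-cycle w of K is a
boundary in the larger complex, so that w is a boundary of K plus x_e times a
1-cycle; by Nakayama H_1(K) = 0, and induction applies. If a x_e is a
combination of the previous elements, the coefficients form a 1-cycle of the
larger complex with last coefficient a; being a boundary, it has a in the ideal
of the previous elements. *)
Lemma koszul_H1_regular (x : nat -> R) e : (forall l, (l < e)%N -> x l \in m) ->
  exact_at (koszul x e) 1 -> regular_seq x e.
Proof.
elim: e => [|e IHe] xm H1; first by move=> i a.
have dE (u v : 'cV[R]_(krank e)) : kdiff x e.+1 *m col_mx u v =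
    col_mx (kdiff x e *m u + x e *: v) (- (kdiff x e *m v)).
  by rewrite [kdiff _ _]/= mul_block_col mul_scalar_mx mul0mx add0r mulNmx.
have homl q (u : 'cV[R]_(krank e)) : homog (@kdeg e) q u ->
    homog (@kdeg e.+1) q (col_mx u 0 : 'cV[R]_(krank e + krank e)).
  by move=> hu; apply/homog_col_mx; split=> // i; rewrite mxE eqxx.
have H1e : exact_at (koszul x e) 1.
  move=> w hw dw.
  apply: (saturation_local (N := @boundary _ _ _ (koszul x e) 1)); first exact: boundary_submod.
  apply: (@nakayama R _ (local_prime hR) ('cV[R]_(krank e)) _
    (fun w => homog (@kdeg e) 1 w /\ kdiff x e *m w = 0) (x e)) => //.
  - exact/noeth_cV/(local_noeth hR).
  - exact: boundary_submod.
  - split; first by split; [apply: homog0|rewrite mulmx0].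
    move=> a u v [hu du] [hv dv]; split; first exact: homogP.
    by rewrite mulmxDr -scalemxAr du dv scaler0 addr0.
  - exact: xm.
  move=> u [hu du].
  have [||w' hw'] := H1 (col_mx u 0 : 'cV[R]_(krank e + krank e)).
  - exact: homl.
  - by rewrite [md _ *m _]dE du !mulmx0 scaler0 oppr0 addr0 col_mx0.
  move: hw'; rewrite -[w']vsubmxK => /homog_col_mx[hu' hv'] /=.
  move/(eq_trans (esym (dE _ _)))/eq_col_mx => [uE /eqP]; rewrite oppr_eq0 => /eqP dv'.
  exists 1, (dsubmx w'); split; first by rewrite idealr1.
    by split=> // i /hv'[].
  by rewrite scale1r -uE addrK; exists (usubmx w').
have reg := IHe (fun l le => xm l (ltnW le)) H1e.
move=> i a; rewrite ltnS leq_eqVlt => /predU1P[->|]; last exact: reg.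
move=> [c aE]; pose u := relvec (koszul x e) (fun l => - c l).
have du : kdiff x e *m u = - (a * x e) *: delta_mx (kone e) 0.
  rewrite [LHS](md_relvec (koszul x e)); congr (_ *: _); rewrite aE -sumrN.
  by apply: eq_bigr => l _; rewrite mulNr.
have [||w' hw'] := H1 (col_mx u (a *: delta_mx (kone e) 0) : 'cV[R]_(krank e + krank e)).
- apply/homog_col_mx; split; first exact: (@relvec_homog _ _ _ (koszul x e)).
  move=> j; rewrite mxE => nz; congr _.+1; apply: (@mhomog_unit _ _ _ (koszul x e)).
  by apply: contraNneq nz => ->; rewrite mulr0.
- rewrite [md _ *m _]dE du -scalemxAr (md_unit (koszul x e)) scaler0 oppr0.
  by rewrite scalerA mulrC scaleNr addNr col_mx0.
move: hw'; rewrite -[w']vsubmxK => /homog_col_mx[hu' hv'] /=.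
move/(eq_trans (esym (dE _ _)))/eq_col_mx => [_ /matrixP/(_ (kone e) 0)].
rewrite [RHS]mxE [in RHS]mxE !eqxx mulr1 => <-.
rewrite mxE; apply: (submodN (gen_ideal_closed x e)); rewrite mxE.
apply: (submod_sum (M := R^o) (gen_ideal_closed x e)) => j _.
by apply: idealMl; [apply: gen_ideal_closed|apply: kdiff_one].
Qed.

Section Existence.
Variables (x : nat -> R) (e : nat).
Hypothesis mx : forall a, a \in m <-> gen_ideal x e a.
Hypothesis xmin : forall c : nat -> R, \sum_(l < e) c l * x l = 0 -> forall l, (l < e)%N -> c l \in m.
Hypothesis xsing : ~ regular_seq x e.
Implicit Types B : kmodule x e.

Lemma cycles_submod B q : submod (M := 'cV[R]_(mrank B))
  (fun w => homog (@mdeg _ _ _ B) q w /\ md B *m w = 0).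
Proof.
split; first by split; [apply: homog0|rewrite mulmx0].
move=> a u v [hu du] [hv dv]; split; first exact: homogP.
by rewrite mulmxDr -scalemxAr du dv scaler0 addr0.
Qed.

(** Attaching a cell along the first cycle of the list shortens the list; vectors
of degree q, hence the cycles to be killed, stay the same. *)
Lemma kill_listed_cycles q n B (S : seq 'cV[R]_(mrank B)) : (0 < q)%N -> size S = n ->
  (forall s, s \in S -> homog (@mdeg _ _ _ B) q s /\ md B *m s = 0) ->
  (forall w, homog (@mdeg _ _ _ B) q w -> md B *m w = 0 -> combination (@boundary _ _ _ B q) S w) ->
  exists B' iota, @embedding _ _ _ q B B' iota /\ exact_at B' q.
Proof.
move=> q0; elim: n B S => [|n IHn] B [|z S]//= => [_|[sz]] cS genS.
  by exists B, id; split; [exact: embedding_id|].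
have [hz dz] := cS z (mem_head _ _).
have [B' [iota [E [u hu du] _]]] := attach q0 hz dz.
have [|||B'' [iota' [E' ex]]] := IHn B' [seq iota s | s <- S].
- by rewrite size_map.
- move=> _ /mapP[s sS ->]; have [|hs ds] := cS s; first by rewrite inE sS orbT.
  by split; [apply: (emb_homog E)|rewrite (emb_d E) ds (emb0 E)].
- move=> w' /(emb_surj E (leqnn q))[w hw ->].
  rewrite (emb_d E) -(emb0 E) => /(emb_inj E) dw.
  apply: (combination_emb E (U := @boundary _ _ _ B q)); last exact: genS.
  + exact: boundary_submod.
  + by move=> v; apply: emb_boundary E.
  + by exists u.
by exists B'', (iota' \o iota); split=> //; apply: embedding_comp E E'.
Qed.

Lemma kill_cycles B q : (0 < q)%N -> exists B' iota,
  @embedding _ _ _ q B B' iota /\ exact_at B' q.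
Proof.
move=> q0; have [S [ScB Sgen]] := combination_fingen (noeth_cV (local_noeth hR))
  (cycles_submod B q) (submod0 (@boundary_submod _ _ _ B q)).
by apply: (kill_listed_cycles q0 (erefl (size S)) ScB) => w hw dw; apply: Sgen.
Qed.

(** Boundaries up to a multiple of the cycle t attached to the relation a. *)
Definition relation_boundary B a (w : 'cV[R]_(mrank B)) : Prop :=
  exists c, boundary 1 (w - c *: relvec B a).

Lemma relation_boundary_submod B a : submod (M := 'cV[R]_(mrank B)) (relation_boundary a).
Proof.
have sB := @boundary_submod _ _ _ B 1; split.
  by exists 0; rewrite scale0r subr0; apply: submod0 sB.
move=> b v w [c vc] [c' wc]; exists (b * c + c').
rewrite scalerDl -scalerA opprD addrACA -scalerBr.
exact: sB.2.
Qed.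

(** A cycle z outside boundaries plus R t can be killed without making t a
boundary: if t were c z modulo boundaries, then c would be a unit, as m kills
H_1, and z would lie in R t plus boundaries. *)
Lemma kill_listed_relations a n B (S : seq 'cV[R]_(mrank B)) : size S = n ->
  ~ boundary 1 (relvec B a) ->
  (forall s, s \in S -> homog (@mdeg _ _ _ B) 1 s /\ md B *m s = 0) ->
  (forall w, homog (@mdeg _ _ _ B) 1 w -> md B *m w = 0 -> combination (@relation_boundary B a) S w) ->
  exists B', ~ boundary 1 (relvec B' a) /\
    forall w, homog (@mdeg _ _ _ B') 1 w -> md B' *m w = 0 -> relation_boundary a w.
Proof.
elim: n B S => [|n IHn] B [|z S]//= => [_|[sz]] ta cS genS; first by exists B.
have [hz dz] := cS z (mem_head _ _).
have cS' s : s \in S -> homog (@mdeg _ _ _ B) 1 s /\ md B *m s = 0.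
  by move=> sS; apply: cS; rewrite inE sS orbT.
have [az|az] := pselect (relation_boundary a z).
  apply: (IHn B S) => // w hw dw; apply: combination_skip (genS w hw dw) => //.
  exact: relation_boundary_submod.
have [B' [iota [E [u hu du] bd]]] := attach (ltn0Sn 0) hz dz.
apply: (IHn B' [seq iota s | s <- S]).
- by rewrite size_map.
- move=> [w hw]; have [v [c [hv ->]]] := bd w hw.
  rewrite -(emb_relvec a E) => /(emb_inj E) tE.
  have bdz : boundary 1 (md B *m v) by exists v.
  have [cm|/(local_unit hR)[y yc]] := boolP (c \in m).
    apply: ta; rewrite -tE; apply: (submodD (@boundary_submod _ _ _ B 1)) => //.
    have /mx[b ->] := cm; rewrite scaler_suml.
    apply: (submod_sum (@boundary_submod _ _ _ B 1)) => l _.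
    rewrite -scalerA; apply: (submodZ (@boundary_submod _ _ _ B 1)).
    exact: cycle_boundary.
  apply: az; exists y; rewrite -tE scalerDr scalerA yc scale1r opprD addrCA subrr addr0.
  by rewrite -scaleN1r; do 2!apply: (submodZ (@boundary_submod _ _ _ B 1)).
- move=> _ /mapP[s sS ->]; have [hs ds] := cS' s sS.
  by split; [apply: (emb_homog E)|rewrite (emb_d E) ds (emb0 E)].
- move=> w' /(emb_surj E (leqnn 1))[w hw ->].
  rewrite (emb_d E) -(emb0 E) => /(emb_inj E) dw.
  apply: (combination_emb E (U := @relation_boundary B a)); last exact: genS.
  + exact: relation_boundary_submod.
  + move=> v [c vc]; exists c; rewrite -(emb_relvec a E).
    rewrite -[iota v]/(mk_linear (emb_linear E) v) -[iota (relvec _ _)]/(mk_linear (emb_linear E) _).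
    by rewrite -linearZ -linearB; apply: emb_boundary E _.
  + exists 0; rewrite scale0r subr0.
    by exists u.
Qed.

(** B is a free differential graded module over the Koszul complex whose homology
is k in degree 0 and k t in degree 1, and vanishes in degrees 2 to L. *)
Theorem singular_kmodule L : exists B a,
  [/\ forall l, (l < e)%N -> a l \in m, \sum_(l < e) a l * x l = 0,
      ~ boundary 1 (relvec B a),
      forall w, homog (@mdeg _ _ _ B) 1 w -> md B *m w = 0 -> relation_boundary a w
    & forall q, (2 <= q <= L)%N -> exact_at B q].
Proof.
have xm l : (l < e)%N -> x l \in m by move=> le; apply/mx/mem_gen_ideal.
(* as R is singular, some 1-cycle of the Koszul complex is not a boundary *)
have [w0 [hw0 dw0 bw0]] : exists w, [/\ homog (@mdeg _ _ _ (koszul x e)) 1 w,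
    md (koszul x e) *m w = 0 & ~ boundary 1 w].
  apply: contrapT => no; apply: xsing; apply: koszul_H1_regular => // w hw dw.
  by apply: contrapT => bw; apply: no; exists w.
have [a w0E] := koszul_deg1 x hw0.
have a0 : \sum_(l < e) a l * x l = 0.
  move: dw0; rewrite w0E md_relvec => /matrixP/(_ (m1 (koszul x e)) 0).
  by rewrite !mxE !eqxx mulr1.
have am := xmin a0.
have [B1 [tB1 H1B1]] : exists B, ~ boundary 1 (relvec B a) /\
    forall w, homog (@mdeg _ _ _ B) 1 w -> md B *m w = 0 -> relation_boundary a w.
  have [S [ScB Sgen]] := combination_fingen (noeth_cV (local_noeth hR))
    (cycles_submod (koszul x e) 1) (submod0 (relation_boundary_submod (koszul x e) a)).
  apply: (kill_listed_relations (a := a) (erefl (size S)) _ ScB); first by rewrite -w0E.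
  by move=> w hw dw; apply: Sgen.
suff [B [tB H1B exB]] : exists B, [/\ ~ boundary 1 (relvec B a),
    forall w, homog (@mdeg _ _ _ B) 1 w -> md B *m w = 0 -> relation_boundary a w
    & forall q, (2 <= q <= L)%N -> exact_at B q] by exists B, a.
elim: L => [|L [B [tB H1B exB]]]; first by exists B1; split=> // q; lia.
have [L0|L0] := posnP L; first by exists B; split=> // q; lia.
have [B' [iota [E exB']]] := kill_cycles B (ltn0Sn L).
exists B'; split.
- by rewrite -(emb_relvec a E) => /(emb_boundary_inv E); apply/contra_not: tB; apply.
- move=> w' /(emb_surj E (leq_trans L0 (leqnSn L)))[w hw ->].
  rewrite (emb_d E) -(emb0 E) => /(emb_inj E) dw.
  have [c wc] := H1B w hw dw; exists c; rewrite -(emb_relvec a E).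
  rewrite -[iota w]/(mk_linear (emb_linear E) w) -[iota (relvec _ _)]/(mk_linear (emb_linear E) _).
  by rewrite -linearZ -linearB; apply: emb_boundary E _.
- move=> q /andP[q2]; rewrite leq_eqVlt => /predU1P[->//|qL].
  by apply: (emb_exact_at E) => //; apply: exB; rewrite q2.
Qed.


End Existence.
End KillingCycles.

(** * Projective modules *)

Lemma big_uniq_sub (V : zmodType) (T : eqType) (s t : seq T) (f : T -> V) :
  uniq s -> uniq t -> {subset s <= t} -> (forall b, b \notin s -> f b = 0) ->
  \sum_(b <- t) f b = \sum_(b <- s) f b.
Proof.
move=> us ut st f0; rewrite [LHS](bigID (mem s)) [X in _ + X = _]big1 ?addr0/=; last by move=> b /f0.
rewrite -big_filter; apply: perm_big; apply: uniq_perm => //; first exact: filter_uniq.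
by move=> b; rewrite mem_filter; have [/st->|] := boolP (b \in s).
Qed.

Section DualBasis.
Variable R : comNzRingType.

Section Lift.
Variables (M : lmodType R) (K : choiceType) (f : K -> M).

Let fgl : {additive {freeg K / R} -> M} :=
  HB.pack (@fglift R M K f) (GRing.isAdditive.Build _ _ (@fglift R M K f) (lift_is_additive f)).

Lemma fgliftE D : fglift f D = \sum_(z <- dom D) coeff z D *: f z.
Proof.
rewrite -{1}[D]freeg_sumE -[LHS]/(fgl _) raddf_sum.
by apply: eq_bigr => z _; exact: liftU.
Qed.

Lemma fglift_linear : linear (fglift f).
Proof.
move=> a D E; rewrite -[fglift f _]/(fgl _) raddfD; congr (_ + _).
rewrite fgliftE scaler_sumr -[a *: D]/(fgscale a D) /fgscale raddf_sum.
by apply: eq_bigr => z _; rewrite scalerA; exact: liftU.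
Qed.
End Lift.

(** The only consequence of projectivity that is used to pass from R to N: finitely
many elements at a time, N behaves like a free module. *)
Definition dual_basis_property (N : lmodType R) : Prop := forall s : seq N,
  exists (K : seq N) (phi : N -> {linear N -> R^o}),
    forall x, x \in s -> x = \sum_(k <- K) phi k x *: k.

(** A projective module is a direct summand of the free module on its elements. *)
Lemma projective_dual_basis (P : lmodType R) :
  projective_module P -> dual_basis_property P.
Proof.
move=> projP s.
have [y|h hK] := projP _ _ (mk_linear (fglift_linear (fun x : P => x))) (idfun : {linear P -> P}).
  by exists << 1 *g y >> => /=; rewrite liftU scale1r.
have lc k : linear (fun x => coeff k (h x) : R^o).
  by move=> a x y; rewrite linearP coeffD coeffZ.
exists (undup (flatten [seq dom (h x) | x <- s])), (fun k => mk_linear (lc k)) => x xs.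
rewrite -{1}[x]/(idfun x) -hK /= fgliftE.
apply/esym/big_uniq_sub => [||k kD|k /coeff_outdom ->]; last by rewrite scale0r.
- exact: uniq_dom.
- exact: undup_uniq.
rewrite mem_undup; apply/flattenP; exists (dom (h x)) => //.
exact: (map_f (fun y => dom (h y))).
Qed.

End DualBasis.

Section IdealMul.
Variables (R : comNzRingType) (m : idealr R) (M : lmodType R).

Lemma ideal_mul_submod : submod (fun y : M => y \in ideal_mul m M).
Proof. by split=> [|a x y]; [exact: rpred0|move=> xM yM; rewrite rpredD ?rpredZ]. Qed.

Lemma ideal_mulZ a (y : M) : a \in m -> a *: y \in ideal_mul m M.
Proof.
move=> am; apply/asboolP; exists 1%N, (fun=> a), (fun=> y); split=> //.
by rewrite big_ord1.
Qed.

Lemma ideal_mul_ind (N : M -> Prop) : submod N ->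
  (forall a y, a \in m -> N (a *: y)) -> forall y, y \in ideal_mul m M -> N y.
Proof.
move=> sN Nm _ /asboolP[n [a [y [am ->]]]].
by apply: (submod_sum sN) => i _; apply: Nm.
Qed.

End IdealMul.

Lemma ideal_mul_morph (R : comNzRingType) (m : idealr R) (M N : lmodType R)
    (f : {linear M -> N}) y : y \in ideal_mul m M -> f y \in ideal_mul m N.
Proof.
move: y; apply: ideal_mul_ind => [|a y am].
  split=> [|a x y]; rewrite ?linear0 ?linearP; [exact: rpred0|move=> xM yM].
  by rewrite rpredD ?rpredZ.
by rewrite linearZ; apply: ideal_mulZ.
Qed.

(** * Tensor products with modules of finite rank *)

Section VectorAction.
Variables (R : comNzRingType) (b : nat).
Implicit Types (A C : 'M[R]_b).

Section Action.
Variable N : lmodType R.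
Implicit Types (v w : 'I_b -> N).

(** The vectors with entries in N are the elements of the tensor product of N and
R^b, on which a matrix acts on the second factor. *)
Definition act A v : 'I_b -> N := fun i => \sum_j A i j *: v j.

Lemma actE A v i : act A v i = \sum_j A i j *: v j. Proof. by []. Qed.

Lemma act_linear A : linear (act A).
Proof.
move=> a v w; apply/funext => i; rewrite -[RHS]/(a *: act A v i + act A w i) !actE.
rewrite scaler_sumr -big_split/=; apply: eq_bigr => j _.
by rewrite -[(a *: v + w) j]/(a *: v j + w j) scalerDr !scalerA mulrC.
Qed.
HB.instance Definition _ A :=
  GRing.isLinear.Build R ('I_b -> N) ('I_b -> N) *:%R (act A) (act_linear A).

Lemma act_mul A C v : act (A *m C) v = act A (act C v).
Proof.
apply/funext => i; rewrite !actE.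
under [RHS]eq_bigr => j _ do rewrite actE scaler_sumr.
rewrite exchange_big; apply: eq_bigr => j _; rewrite mxE scaler_suml.
by apply: eq_bigr => k _; rewrite scalerA.
Qed.

Lemma act0 v : act 0 v = 0.
Proof. by apply/funext => i; rewrite actE big1// => j _; rewrite mxE scale0r. Qed.

Lemma actDl A C v : act (A + C) v = act A v + act C v.
Proof.
apply/funext => i; rewrite -[RHS]/(act A v i + act C v i) !actE -big_split/=.
by apply: eq_bigr => j _; rewrite mxE scalerDl.
Qed.

Lemma act_scalar a v : act a%:M v = a *: v.
Proof.
apply/funext => i; rewrite actE (bigD1 i)//= mxE eqxx mulr1n big1 ?addr0// => j.
by rewrite eq_sym mxE => /negPf ->; rewrite mulr0n scale0r.
Qed.

(** The sum of the tensors of the elements k of K with the columns w k. *)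
Definition tens (K : seq N) (w : N -> 'cV[R]_b) : 'I_b -> N :=
  fun i => \sum_(k <- K) w k i 0 *: k.

Lemma act_tens A K (w : N -> 'cV[R]_b) : act A (tens K w) = tens K (fun k => A *m w k).
Proof.
apply/funext => i; rewrite actE /tens.
under eq_bigr => j _ do rewrite scaler_sumr.
rewrite exchange_big/=; apply: eq_bigr => k _; rewrite mxE scaler_suml.
by apply: eq_bigr => j _; rewrite scalerA.
Qed.

Lemma dual_basis_tens v n : dual_basis_property N ->
  exists K (phi : N -> {linear N -> R^o}),
    v = tens K (fun k => \col_i phi k (v i)) /\ n = \sum_(k <- K) phi k n *: k.
Proof.
move=> dN; have [K [phi KP]] := dN (n :: codom v).
exists K, phi; split; last by apply: KP; rewrite mem_head.
apply/funext => i; rewrite /tens {1}(KP (v i)) ?inE ?codom_f ?orbT//.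
by apply: eq_bigr => k _; rewrite mxE.
Qed.

End Action.

Lemma act_morph (M N : lmodType R) (f : {linear M -> N}) A (v : 'I_b -> M) :
  act A (f \o v) = f \o act A v.
Proof.
apply/funext => i; rewrite /= !actE linear_sum; apply: eq_bigr => j _.
by rewrite linearZ.
Qed.

End VectorAction.

(** * Adjoining a divided power variable *)

Section SingularModule.
Variables (R : comNzRingType) (m : idealr R) (hR : local_ring m).
Variables (x : nat -> R) (e : nat).
Hypothesis mx : forall a, a \in m <-> gen_ideal x e a.
(* the data and properties provided by [singular_kmodule] *)
Variables (B : kmodule x e) (a : nat -> R) (L : nat).
Hypothesis am : forall l, (l < e)%N -> a l \in m.
Hypothesis a0 : \sum_(l < e) a l * x l = 0.
Hypothesis tB : ~ boundary 1 (relvec B a).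
Hypothesis H1B : forall w, homog (@mdeg _ _ _ B) 1 w -> md B *m w = 0 -> relation_boundary a w.
Hypothesis exB : forall q, (2 <= q <= L)%N -> exact_at B q.

Let b := mrank B.
Let d := md B.
Let deg := @mdeg _ _ _ B.
Let one := m1 B.
(** Multiplication by the cycle t = a_0 X_0 + ... + a_(e-1) X_(e-1) on B. *)
Definition tmul : 'M[R]_b := \sum_(l < e) a l *: mX B l.
Notation t := tmul.

Lemma tmul_sq : t *m t = 0.
Proof.
rewrite /tmul; have [_ XX X2] := mrel B.
suff tn n : (n <= e)%N -> (\sum_(l < n) a l *: mX B l) *m (\sum_(l < n) a l *: mX B l) = 0 by exact: tn.
elim: n => [|n IHn] ne; first by rewrite big_ord0 mul0mx.
rewrite big_ord_recr/= mulmxDl !mulmxDr IHn ?(ltnW ne)// add0r.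
rewrite -!scalemxAl -!scalemxAr X2// !scaler0 addr0 mulmx_suml mulmx_sumr !scaler_sumr -big_split/=.
apply: big1 => l _; rewrite -!scalemxAr -!scalemxAl (XX n l)//; last exact: ltn_trans (ltn_ord l) ne.
by rewrite !scalerA scalerN mulrC addrN.
Qed.

Lemma tmul_anticomm : d *m t + t *m d = 0.
Proof.
rewrite /tmul mulmx_sumr mulmx_suml -big_split/=; have [dX _ _] := mrel B.
transitivity (\sum_(l < e) a l *: (x l)%:M : 'M[R]_b).
  by apply: eq_bigr => l _; rewrite -scalemxAr -scalemxAl -scalerDr dX.
under eq_bigr => l _ do rewrite scale_scalar_mx.
by rewrite -raddf_sum a0 raddf0.
Qed.

Lemma tmul_unit : t *m munit B = relvec B a.
Proof. by rewrite mulmx_suml; apply: eq_bigr => l _; rewrite -scalemxAl. Qed.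

Lemma tmul_mem i j : t i j \in m.
Proof.
rewrite summxE; apply: rpred_sum => l _; rewrite mxE mulrC.
by apply: (idealMr _ (_ : a l \in m)); apply: am.
Qed.

Lemma tmul_deg i j : t i j != 0 -> deg i = (deg j).+1.
Proof.
rewrite summxE => /eqP nz; have [l] : exists l : 'I_e, (a l *: mX B l) i j != 0.
  apply: contrapT => no; apply: nz; apply: big1 => l _; apply/eqP.
  by apply: contrapT => /negP h; apply: no; exists l.
by rewrite mxE => nzl; apply: (mX_deg (ltn_ord l)); apply: contraNneq nzl => ->; rewrite mulr0.
Qed.

Section Coefficients.
Variable N : lmodType R.
Implicit Types (u v w : 'I_b -> N) (n : N).

Definition vhomog q v : Prop := forall i, v i != 0 -> deg i = q.

Definition vunit n : 'I_b -> N := fun i => if i == one then n else 0.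

Lemma vhomog0 q : vhomog q 0. Proof. by move=> i; rewrite eqxx. Qed.

Lemma vhomogP q c v w : vhomog q v -> vhomog q w -> vhomog q (c *: v + w).
Proof.
move=> hv hw i; rewrite -[(_ + _) i]/(c *: v i + w i) => nz.
have [vi|/hv//] := eqVneq (v i) 0.
by apply: hw; apply: contraNneq nz => ->; rewrite vi scaler0 addr0.
Qed.

Lemma vhomogN q v : vhomog q v -> vhomog q (- v).
Proof. by move=> hv i; rewrite -[(- v) i]/(- v i) oppr_eq0; apply: hv. Qed.

Lemma vhomog_act q r (A : 'M[R]_b) v : (forall i j, A i j != 0 -> deg j = q -> deg i = r) ->
  vhomog q v -> vhomog r (act A v).
Proof.
move=> hA hv i; rewrite actE => /eqP nz.
have [j] : exists j, A i j *: v j != 0.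
  apply: contrapT => no; apply: nz; apply: big1 => j _; apply/eqP.
  by apply: contrapT => /negP h; apply: no; exists j.
move=> nzj; apply: (hA i j); first by apply: contraNneq nzj => ->; rewrite scale0r.
by apply: hv; apply: contraNneq nzj => ->; rewrite scaler0.
Qed.

Lemma vhomog_tens q (K : seq N) (w : N -> 'cV[R]_b) :
  (forall k, homog deg q (w k)) -> vhomog q (tens K w).
Proof.
move=> hw i nz; apply: contrapT => ni; move/eqP: nz; apply; apply: big1 => k _.
have [->|/hw//] := eqVneq (w k i 0) 0; by rewrite scale0r.
Qed.

Lemma homog_coord q v (phi : {linear N -> R^o}) : vhomog q v -> homog deg q (\col_i phi (v i)).
Proof. by move=> hv i; rewrite mxE => nz; apply: hv; apply: contraNneq nz => ->; rewrite linear0. Qed.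

Lemma coord_act (A : 'M[R]_b) v (phi : {linear N -> R^o}) :
  A *m \col_i phi (v i) = \col_i phi (act A v i).
Proof.
apply/matrixP => i j; rewrite !mxE actE linear_sum; apply: eq_bigr => l _.
by rewrite linearZ mxE.
Qed.

Lemma coord0 (phi : {linear N -> R^o}) : \col_i phi ((0 : 'I_b -> N) i) = 0.
Proof. by apply/matrixP => i j; rewrite !mxE linear0. Qed.

Lemma vhomog_unit n : vhomog 0 (vunit n).
Proof.
move=> i; rewrite /vunit; case: (i =P one) => [-> _|]; last by rewrite eqxx.
by apply/eqP; rewrite mdeg1.
Qed.

Lemma vunitE v : vhomog 0 v -> v = vunit (v one).
Proof.
move=> hv; apply/funext => i; rewrite /vunit; case: (i =P one) => [->//|/eqP ni].
by apply/eqP/negPn/negP => /hv/eqP; rewrite mdeg1 (negPf ni).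
Qed.

Lemma tens_unit K (c : N -> R) : tens K (fun k => c k *: munit B) = vunit (\sum_(k <- K) c k *: k).
Proof.
apply/funext => i; rewrite /tens /vunit; under eq_bigr => k _ do rewrite !mxE eqxx andbT.
case: (i == one); first by apply: eq_bigr => k _; rewrite mulr1.
by rewrite big1// => k _; rewrite mulr0 scale0r.
Qed.

Lemma act_d_unit n : act d (vunit n) = 0.
Proof.
apply/funext => i; rewrite actE big1// => j _; rewrite /vunit.
case: (j =P one) => [->|]; last by rewrite scaler0.
have /matrixP/(_ i 0) := md_unit B; rewrite -colE !mxE => ->.
by rewrite scale0r.
Qed.

Lemma act_d_one v : act d v one \in ideal_mul m N.
Proof.
rewrite actE; apply: (submod_sum (ideal_mul_submod m N)) => j _.
by apply: ideal_mulZ; apply/mx/md1.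
Qed.

(** X_l multiplied by the unit is a primitive of x_l times the unit. *)
Lemma unit_boundary n : n \in ideal_mul m N -> exists2 u, vhomog 1 u & act d u = vunit n.
Proof.
move: n; apply: ideal_mul_ind => [|c y /mx[f ->]].
  split; first by exists 0; [apply: vhomog0|rewrite linear0; apply/funext => i; rewrite /vunit if_same].
  move=> c y z [u hu du] [v hv dv]; exists (c *: u + v); first exact: vhomogP.
  rewrite linearP/= du dv; apply/funext => i; rewrite -[LHS]/(c *: vunit y i + vunit z i).
  by rewrite /vunit; case: (_ == _); rewrite ?scaler0 ?addr0.
have [dX _ _] := mrel B.
have -> : vunit ((\sum_(l < e) f l * x l) *: y) = \sum_(l < e) act d (act (mX B l) (vunit (f l *: y))).
  transitivity (\sum_(l < e) vunit ((f l * x l) *: y)).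
    apply/funext => i; rewrite fct_sumE /vunit; case: (_ == _); last by rewrite big1.
    by rewrite scaler_suml.
  apply: eq_bigr => l _; rewrite -act_mul -[d *m _](addrK (mX B l *m d)) dX//.
  rewrite actDl act_scalar -scaleN1r -mul_scalar_mx 2!act_mul act_d_unit !linear0 addr0.
  apply/funext => i; rewrite -[RHS]/(x l *: vunit _ i) /vunit.
  by case: (_ == _); rewrite ?scaler0// scalerA mulrC.
exists (\sum_(l < e) act (mX B l) (vunit (f l *: y))); last by rewrite linear_sum.
apply: (big_ind (vhomog 1)); first exact: vhomog0.
  by move=> u v hu hv; rewrite -[u]scale1r; apply: vhomogP.
move=> l _; apply: (@vhomog_act 0); last exact: vhomog_unit.
by move=> i j /(mX_deg (ltn_ord l)) + j0; rewrite [mdeg j]j0.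
Qed.

Section Flat.
Hypothesis dN : dual_basis_property N.

(** Exactness passes from B to its tensor product with N coordinate by coordinate;
likewise in the next two lemmas. *)
Lemma exact_flat q v : (2 <= q <= L)%N -> vhomog q v -> act d v = 0 ->
  exists2 u, vhomog q.+1 u & act d u = v.
Proof.
move=> qL hv dv; have [K [phi [vE _]]] := dual_basis_tens v 0 dN.
have /choice[w wP] : forall k : N, exists w : 'cV[R]_b, homog deg q.+1 w /\ d *m w = \col_i phi k (v i).
  move=> k; have [|w hw dw] := exB qL (homog_coord (phi := phi k) hv); last by exists w.
  by rewrite coord_act dv coord0.
exists (tens K w); first by apply: vhomog_tens => k; have [] := wP k.
rewrite act_tens [RHS]vE; apply/funext => i; apply: eq_bigr => k _.
by have [_ ->] := wP k.
Qed.

Lemma relation_flat v : vhomog 1 v -> act d v = 0 ->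
  exists n u, vhomog 2 u /\ v = act d u + act t (vunit n).
Proof.
move=> hv dv; have [K [phi [vE _]]] := dual_basis_tens v 0 dN.
have /choice[w wP] : forall k : N, exists w : R * 'cV[R]_b, homog deg 2 w.2 /\
    \col_i phi k (v i) = d *m w.2 + w.1 *: (t *m munit B).
  move=> k; have [|c [w hw dw]] := H1B (homog_coord (phi := phi k) hv).
    by rewrite coord_act dv coord0.
  by exists (c, w); split=> //=; rewrite tmul_unit dw subrK.
exists (\sum_(k <- K) (w k).1 *: k), (tens K (fun k => (w k).2)); split.
  by apply: vhomog_tens => k; have [] := wP k.
rewrite -tens_unit !act_tens {1}vE; apply/funext => i.
rewrite -[RHS]/(tens K _ i + tens K _ i) /tens -big_split/=; apply: eq_bigr => k _.
by have [_ ->] := wP k; rewrite -scalemxAr -scalerDl [in LHS]mxE.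
Qed.

Lemma relation_flat_min n u : vhomog 2 u -> act t (vunit n) = act d u -> n \in ideal_mul m N.
Proof.
move=> hu tn; have [K [phi [uE ->]]] := dual_basis_tens u n dN.
apply: (submod_sum (ideal_mul_submod m N)) => k _; apply: ideal_mulZ.
apply: contrapT => /negP/(local_unit hR)[y yn]; apply: tB.
exists (y *: \col_i phi k (u i)); first by apply: homogZ; apply: homog_coord.
rewrite -scalemxAr coord_act -tn -coord_act -tmul_unit.
have -> : \col_i phi k (vunit n i) = phi k n *: munit B.
  apply/matrixP => i j; rewrite !mxE /vunit ord1 eqxx andbT.
  by case: (i == one); rewrite ?mulr1 ?mulr0 ?linear0.
by rewrite -scalemxAr scalerA yn scale1r.
Qed.

End Flat.
End Coefficients.

Lemma act_neq0 (N : lmodType R) (A : 'M[R]_b) (v : 'I_b -> N) i :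
  act A v i != 0 -> exists j, A i j != 0 /\ v j != 0.
Proof.
rewrite actE => /eqP nz; apply: contrapT => no; apply: nz; apply: big1 => j _.
have [->|Aij] := eqVneq (A i j) 0; first by rewrite scale0r.
have [->|vj] := eqVneq (v j) 0; first by rewrite scaler0.
by case: no; exists j.
Qed.

Section Layers.
Variable N : lmodType R.
Implicit Types (u v w : nat -> 'I_b -> N).

(** Elements of degree p of the tensor product of N with B<T>. The coefficient of
the divided power T^(r), of degree 2r, is the layer v r; only finitely many
layers are non-zero, since no coordinate of B has negative degree. *)
Definition ghomog p v : Prop := forall r i, v r i != 0 -> (deg i + r.*2 = p)%N.

(** The differential of B<T>: d (b T^(r)) = (d b) T^(r) + (t b) T^(r-1). *)
Definition gdiff v : nat -> 'I_b -> N := fun r => act d (v r) + act t (v r.+1).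

Lemma gdiff_linear : linear gdiff.
Proof.
move=> c v w; apply/funext => r; rewrite -[RHS]/(c *: gdiff v r + gdiff w r) /gdiff.
rewrite -[(_ + w) r]/(c *: v r + w r) -[(_ + w) r.+1]/(c *: v r.+1 + w r.+1).
by rewrite !linearP/= scalerDr addrACA.
Qed.
HB.instance Definition _ :=
  GRing.isLinear.Build R (nat -> 'I_b -> N) (nat -> 'I_b -> N) *:%R gdiff gdiff_linear.

Lemma gdiff_gdiff v : gdiff (gdiff v) = 0.
Proof.
apply/funext => r; rewrite /gdiff !linearD/= -!act_mul md2 tmul_sq !act0 add0r addr0.
by rewrite -actDl tmul_anticomm act0.
Qed.

Lemma ghomogP p c v w : ghomog p v -> ghomog p w -> ghomog p (c *: v + w).
Proof.
move=> hv hw r i; rewrite -[(_ + _) r i]/(c *: v r i + w r i) => nz.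
have [vi|/hv//] := eqVneq (v r i) 0.
by apply: hw; apply: contraNneq nz => ->; rewrite vi scaler0 addr0.
Qed.

Lemma ghomog0 p : ghomog p 0. Proof. by move=> r i; rewrite eqxx. Qed.

Lemma ghomogD p v w : ghomog p v -> ghomog p w -> ghomog p (v + w).
Proof. by move=> hv hw; rewrite -[v]scale1r; apply: ghomogP. Qed.

Lemma ghomogB p v w : ghomog p v -> ghomog p w -> ghomog p (v - w).
Proof. by move=> hv hw; rewrite addrC -scaleN1r; apply: ghomogP. Qed.

Lemma ghomog_gdiff p v : ghomog p.+1 v -> ghomog p (gdiff v).
Proof.
move=> hv r i; rewrite -[gdiff v r i]/(act d (v r) i + act t (v r.+1) i) => nz.
have [dv0|/act_neq0[j [/md_deg dij /hv vj]]] := eqVneq (act d (v r) i) 0.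
  rewrite dv0 add0r in nz; have [j [/tmul_deg tij /hv vj]] := act_neq0 nz.
  by rewrite tij; lia.
by move: vj; rewrite [deg j]dij addSn => -[].
Qed.

Lemma ghomog_at p v r : ghomog p v -> vhomog (p - r.*2) (v r).
Proof. by move=> hv i /hv <-; rewrite addnK. Qed.

Lemma ghomog_big p v r : ghomog p v -> (p < r.*2)%N -> v r = 0.
Proof.
by move=> hv pr; apply/funext => i; apply/eqP/negPn/negP => /hv; lia.
Qed.

Definition layer h (u : 'I_b -> N) : nat -> 'I_b -> N := fun r => if r == h then u else 0.

Lemma ghomog_layer p h (u : 'I_b -> N) : vhomog p u -> ghomog (p + h.*2) (layer h u).
Proof.
by move=> hu r i; rewrite /layer; case: (r =P h) => [-> /hu ->|_]; rewrite ?eqxx.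
Qed.

Lemma layer_ge h r (u : 'I_b -> N) : (h < r)%N -> layer h u r = 0.
Proof. by move=> hr; rewrite /layer gtn_eqF. Qed.

Lemma gdiff_layer_top h (u : 'I_b -> N) : gdiff (layer h u) h = act d u.
Proof. by rewrite /gdiff (layer_ge _ (ltnSn h)) linear0 addr0 /layer eqxx. Qed.

Lemma gdiff_layer_above h r (u : 'I_b -> N) : (h < r)%N -> gdiff (layer h u) r = 0.
Proof. by move=> hr; rewrite /gdiff !layer_ge ?linear0 ?addr0// ltnW. Qed.

(** A cycle is cleared from its top layer h downwards. That layer is a cycle of B.
In degree at least 2 it is a boundary. In degree 1 it is one up to a multiple
of t, and t T^(h) is the boundary of T^(h+1). In degree 0 it is some n T^(h);
then n t is a boundary because of the layer below, so that n lies in mN and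
n T^(h) is a boundary up to lower layers. *)
Lemma layers_exact p v : dual_basis_property N -> (1 <= p <= L)%N ->
  ghomog p v -> gdiff v = 0 -> exists2 u, ghomog p.+1 u & gdiff u = v.
Proof.
move=> dN pL; suff main h w : ghomog p w -> gdiff w = 0 -> (forall r, (h <= r)%N -> w r = 0) ->
    exists2 u, ghomog p.+1 u & gdiff u = w.
  move=> hv dv; apply: (main p.+1) => // r pr; apply: (ghomog_big hv); lia.
(* h bounds the number of non-zero layers *)
elim: h w => [|h IHh] w hw dw w0.
  exists 0; first exact: ghomog0.
  by rewrite linear0; apply/funext => r; rewrite w0.
have dwr r : act d (w r) + act t (w r.+1) = 0 by have /(congr1 (fun g => g r)) := dw.
have dwh : act d (w h) = 0 by rewrite -[RHS](dwr h) (w0 h.+1)// linear0 addr0.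
suff [u hu du] : exists2 u, ghomog p.+1 u & forall r, (h <= r)%N -> gdiff u r = w r.
  have [|||u' hu' du'] := IHh (w - gdiff u).
  - by apply: ghomogB => //; apply: ghomog_gdiff.
  - by rewrite linearB/= gdiff_gdiff dw subr0.
  - by move=> r hr; rewrite -[(w - gdiff u) r]/(w r - gdiff u r) du// subrr.
  exists (u' + u); first exact: ghomogD.
  by rewrite linearD/= du' subrK.
have topP u : gdiff u h = w h -> (forall r, (h < r)%N -> gdiff u r = 0) ->
    forall r, (h <= r)%N -> gdiff u r = w r.
  move=> uh ur r; rewrite leq_eqVlt => /predU1P[<-//|hr]; by rewrite ur// w0.
have [ph|hp] := ltnP p h.*2.
  exists 0; [exact: ghomog0|apply: topP => [|r _]; rewrite linear0//].
  by rewrite (ghomog_big hw ph).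
have := ghomog_at (r := h) hw; move qE: (p - h.*2)%N => q.
have pE : p = (q + h.*2)%N by lia.
case: q => [|[|q]] in qE pE * => hq.
- case: h pE {IHh hp qE} w0 dwh hq topP => [|h] pE w0 dwh hq topP; first by lia.
  have [|u hu du] := @unit_boundary N (w h.+1 one).
    have tE : act t (w h.+1) = - act d (w h).
      by apply/eqP; rewrite -addr_eq0 addrC dwr.
    apply: (relation_flat_min dN (u := - w h)); last by rewrite -vunitE// tE -linearN.
    by apply: vhomogN; have := ghomog_at (r := h) hw; rewrite pE (_ : _ - _ = 2)%N//; lia.
  exists (layer h.+1 u); first by have := ghomog_layer (h := h.+1) hu; rewrite pE.
  by apply: topP => [|r hr]; [rewrite gdiff_layer_top du -vunitE|rewrite gdiff_layer_above].
- have [n [u [hu wE]]] := relation_flat dN hq dwh.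
  exists (layer h u + layer h.+1 (vunit n)).
    apply: ghomogD; first by have := ghomog_layer (h := h) hu; rewrite pE.
    by have := ghomog_layer (h := h.+1) (@vhomog_unit N n); rewrite pE; congr ghomog; lia.
  have addE r v' v'' : (v' + v'') r = v' r + v'' r :> ('I_b -> N) by [].
  apply: topP => [|r hr]; rewrite linearD/= addE.
    rewrite gdiff_layer_top wE; congr (_ + _); rewrite /gdiff /layer eqxx.
    by rewrite ltn_eqF// linear0 add0r.
  rewrite gdiff_layer_above// add0r; move: hr; rewrite leq_eqVlt => /predU1P[<-|hr].
    by rewrite gdiff_layer_top act_d_unit.
  by rewrite gdiff_layer_above.
- have [|u hu du] := exact_flat dN _ hq dwh; first by lia.
  exists (layer h u); first by have := ghomog_layer (h := h) hu; rewrite pE.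
  by apply: topP => [|r hr]; [rewrite gdiff_layer_top|rewrite gdiff_layer_above].
Qed.

(** With [gdiff_top_unit] this says that the homology of B<T> in degree 0, with
coefficients in N, is N/mN. *)
Lemma unit_layers_boundary n : n \in ideal_mul m N ->
  exists2 u, ghomog 1 u & gdiff u = layer 0%N (vunit n).
Proof.
move=> /unit_boundary[u hu du]; exists (layer 0%N u); first by have := ghomog_layer (h := 0) hu.
apply/funext => -[|r]; first by rewrite gdiff_layer_top du.
by rewrite gdiff_layer_above// layer_ge.
Qed.

Lemma gdiff_top_unit J u : ghomog (J.*2).+1 u -> gdiff u J one \in ideal_mul m N.
Proof.
move=> hu; rewrite /gdiff (ghomog_big hu (r := J.+1)) ?linear0 ?addr0; last by lia.
exact: act_d_one.
Qed.

End Layers.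

Lemma gdiff_morph (M N : lmodType R) (f : {linear M -> N}) (v : nat -> 'I_b -> M) :
  gdiff (fun r i => f (v r i)) = fun r i => f (gdiff v r i).
Proof.
apply/funext => r; apply/funext => i.
rewrite -[gdiff v r i]/(act d (v r) i + act t (v r.+1) i) linearD.
by rewrite -[RHS]/((f \o act d (v r) : 'I_b -> N) i + (f \o act t (v r.+1)) i) -!act_morph.
Qed.

Lemma ghomog_morph (M N : lmodType R) (f : {linear M -> N}) p (v : nat -> 'I_b -> M) :
  ghomog p v -> ghomog p (fun r i => f (v r i)).
Proof.
by move=> hv r i nz; apply: hv; apply: contraNneq nz => ->; rewrite linear0.
Qed.

Lemma ghomog_lift (M N : lmodType R) (f : {linear M -> N}) p (v : nat -> 'I_b -> N) :
  ghomog p v -> (forall r i, exists y, f y = v r i) ->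
  exists2 w, ghomog p w & (fun r i => f (w r i)) = v.
Proof.
move=> hv fv.
have /choice[g gP] : forall ri : nat * 'I_b, exists y, f y = v ri.1 ri.2 /\ (v ri.1 ri.2 = 0 -> y = 0).
  move=> [r i] /=; have [v0|nz] := pselect (v r i = 0).
    by exists 0; rewrite linear0 v0.
  by have [y fy] := fv r i; exists y; split=> // v0; case: nz.
exists (fun r i => g (r, i)).
  by move=> r i nz; apply: hv; apply: contraNneq nz => v0; have [_ ->] := gP (r, i).
by apply/funext => r; apply/funext => i; have [-> _] := gP (r, i).
Qed.

End SingularModule.

(** * Cocycles over a singular ring *)

Record nresolution (R : comNzRingType) (A : lmodType R) := NResolution {
  nobj :> nat -> lmodType R;
  nd : forall i, {linear nobj i.+1 -> nobj i};
  naug : {linear nobj 0%N -> A};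
  nd_nd : forall i y, nd i (nd i.+1 y) = 0;
  naug_nd : forall y, naug (nd 0%N y) = 0;
  naug_surj : forall z, exists y, naug y = z;
  naug_exact : forall y, naug y = 0 -> exists y', nd 0%N y' = y;
  nd_exact : forall i y, nd i y = 0 -> exists y', nd i.+1 y' = y }.
Arguments nd {R A} n i.
Arguments naug {R A} n.

Definition nprojective R A (P : @nresolution R A) := forall i, projective_module (P i).

Section Main.
Variables (R : comNzRingType) (m : idealr R) (hR : local_ring m).
Variables (x : nat -> R) (e : nat).
Hypothesis mx : forall a, a \in m <-> gen_ideal x e a.
(* the data and properties provided by [singular_kmodule] *)
Variables (B : kmodule x e) (a : nat -> R) (L : nat).
Hypothesis am : forall l, (l < e)%N -> a l \in m.
Hypothesis a0 : \sum_(l < e) a l * x l = 0.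
Hypothesis tB : ~ boundary 1 (relvec B a).
Hypothesis H1B : forall w, homog (@mdeg _ _ _ B) 1 w -> md B *m w = 0 -> relation_boundary a w.
Hypothesis exB : forall q, (2 <= q <= L)%N -> exact_at B q.

Let b := mrank B.
Let one := m1 B.
Notation gdiff := (@gdiff _ _ _ B a _).
Notation gvec N := (nat -> 'I_b -> N).

(** Functoriality in the coefficients of the tensor product with B<T>. *)
Definition gmap (M N : lmodType R) (f : {linear M -> N}) (v : gvec M) : gvec N :=
  fun r i => f (v r i).

Definition gim (M N : lmodType R) (f : {linear M -> N}) (v : gvec N) : Prop :=
  forall r i, exists y, f y = v r i.

Lemma gmap_linear M N f : linear (@gmap M N f).
Proof.
move=> c v w; apply/funext => r; apply/funext => i.
rewrite -[RHS]/(c *: f (v r i) + f (w r i)).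
by rewrite -[LHS]/(f (c *: v r i + w r i)) linearP.
Qed.
HB.instance Definition _ (M N : lmodType R) (f : {linear M -> N}) :=
  GRing.isLinear.Build R (gvec M) (gvec N) *:%R (@gmap M N f) (@gmap_linear M N f).

Lemma gmap_gdiff (M N : lmodType R) (f : {linear M -> N}) (v : gvec M) :
  gmap f (gdiff v) = gdiff (gmap f v).
Proof. by rewrite /gmap gdiff_morph. Qed.

Lemma gimD (M N : lmodType R) (f : {linear M -> N}) (v w : gvec N) :
  gim f v -> gim f w -> gim f (v + w).
Proof.
move=> fv fw r i; have [y yE] := fv r i; have [z zE] := fw r i.
by exists (y + z); rewrite linearD yE zE.
Qed.

Lemma gim_gmap (M N : lmodType R) (f : {linear M -> N}) (v : gvec M) : gim f (gmap f v).
Proof. by move=> r i; exists (v r i). Qed.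

Lemma gim_ker (M1 M N : lmodType R) (f : {linear M -> N}) (g : {linear M1 -> M}) (v : gvec M) :
  (forall y, f y = 0 -> exists y', g y' = y) -> gmap f v = 0 -> gim g v.
Proof.
by move=> ex fv r i; apply: ex; rewrite -[LHS]/(gmap f v r i) fv.
Qed.

Lemma gim_ghomog_lift (M N : lmodType R) (f : {linear M -> N}) p (v : gvec N) :
  ghomog p v -> gim f v -> exists2 w : gvec M, ghomog p w & gmap f w = v.
Proof. exact: ghomog_lift. Qed.

(** Multiplication of layers by the divided powers of T: the section u |-> u T of
the endomorphism D : v |-> v (r+1) of degree -2. *)
Definition shift (N : lmodType R) (v : gvec N) : gvec N :=
  fun r => if r is r'.+1 then v r' else 0.

Lemma ghomog_shift (N : lmodType R) p (v : gvec N) : ghomog p v -> ghomog p.+2 (shift v).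
Proof. by move=> hv [|r] i; rewrite ?eqxx// => /hv; rewrite doubleS !addnS => ->. Qed.

Section Divide.
Variable k : lmodType R.
Variable F : nresolution k.
Hypothesis projF : nprojective F.
Hypothesis minF : forall i y, nd F i y \in ideal_mul m (F i).
Hypothesis killF : forall y, y \in ideal_mul m (F 0%N) -> exists y', nd F 0%N y' = y.

(** D is surjective on Tor(k,k), in the form obtained by dimension shifting: u
represents a class of Tor_p(F_j / d F_(j+1), k), and v one that D maps to it. For
j = 0 the section of D works, since multiplication by t has image in m F_0,
which consists of boundaries. For j > 0 the image of u in F_(j-1) is the boundary
of some w, to which induction applies. *)
Lemma divide_cycle j p (u : gvec (F j)) : (p + j <= L)%N ->
  ghomog p u -> gim (nd F j) (gdiff u) ->
  exists v, [/\ ghomog p.+2 v, forall r, v r.+1 = u r & gim (nd F j) (gdiff v)].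
Proof.
elim: j p u => [|j IHj] p u pL hu du.
  exists (shift u); split=> //; first exact: ghomog_shift.
  move=> [|r] i; last exact: du.
  rewrite -[gdiff _ _ _]/(act (md B) 0 i + act (tmul B a) (u 0%N) i) linear0 add0r.
  apply: killF; apply: (submod_sum (ideal_mul_submod m _)) => l _.
  by apply: ideal_mulZ; apply: tmul_mem.
pose y : gvec (F j) := gmap (nd F j) u.
have [w hw wE] : exists2 w : gvec (F j), ghomog p.+1 w & gdiff w = y.
  have dy : gdiff y = 0.
    rewrite /y -gmap_gdiff; apply/funext => r; apply/funext => i.
    by have [z zE] := du r i; rewrite -[LHS]/(nd F j (gdiff u r i)) -zE nd_nd.
  have hy : ghomog p y by apply: ghomog_morph.
  (* in degree 0 the minimality of F takes the place of exactness *)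
  case: p pL hu hy => [|p] pL hu hy; last first.
    apply: (layers_exact hR mx a0 tB H1B exB) => //; last by lia.
    exact: projective_dual_basis.
  have := @unit_layers_boundary _ m _ _ mx B a (F j) (y 0%N one).
  rewrite -vunitE; last exact: ghomog_at hy.
  case=> [|w hw wE]; first exact: minF.
  exists w => //; rewrite wE; apply/funext => -[|r]//.
  by rewrite layer_ge// (ghomog_big hy).
have [||v [hv vw dv]] := IHj p.+1 w _ hw; first by lia.
  by rewrite wE; apply: gim_gmap.
have [s hs sE] := gim_ghomog_lift (ghomog_gdiff (a := a) hv) dv.
have [z hz zE] : exists2 z : gvec (F j.+2), ghomog p z &
    gmap (nd F j.+1) z = u - (fun r => s r.+1).
  apply: gim_ghomog_lift.
    apply: ghomogB => // r i /hs; rewrite doubleS; lia.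
  apply: (gim_ker (f := nd F j)); first exact: nd_exact.
  rewrite linearB/= -/y -wE; apply/funext => r.
  rewrite -[LHS]/(gdiff w r - gmap (nd F j) s r.+1) sE.
  by rewrite -[gdiff v _]/(act _ (v r.+1) + act _ (v r.+2)) !vw subrr.
exists (s + gmap (nd F j.+1) (shift z)); split.
- by apply: ghomogD => //; apply: ghomog_morph; apply: ghomog_shift.
- move=> r; rewrite -[LHS]/(s r.+1 + gmap (nd F j.+1) z r) zE.
  by rewrite -[(u - _) r]/(u r - s r.+1) addrC subrK.
- rewrite linearD/=; apply: gimD; last by rewrite -gmap_gdiff; apply: gim_gmap.
  apply: (gim_ker (f := nd F j)); first exact: nd_exact.
  by rewrite gmap_gdiff sE gdiff_gdiff.
Qed.

Lemma divide_power j n (u : gvec (F j)) : (n.*2 + j <= L)%N ->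
  ghomog 0 u -> gim (nd F j) (gdiff u) ->
  exists v, [/\ ghomog n.*2 v, forall r, v (r + n)%N = u r & gim (nd F j) (gdiff v)].
Proof.
move=> nL hu du; elim: n nL => [|n IHn] nL.
  by exists u; split=> // r; rewrite addn0.
have [|v [hv vu dv]] := IHn; first by lia.
have [|w [hw wv dw]] := divide_cycle _ hv dv; first by lia.
by exists w; split=> // r; rewrite addnS wv vu.
Qed.

Variables (M : lmodType R) (P : nresolution M) (N : nat).
Hypothesis projP : nprojective P.
Hypothesis finP : forall i, (N <= i)%N -> is_zero (P i).

(** Tor_q(k, P_i / d P_(i+1)) = 0 for q > j, since P vanishes from degree i + j on;
by dimension shifting along P. *)
Lemma bounded_acyclic j i q (v : gvec (P i)) : (N <= i + j)%N -> (j < q <= L)%N ->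
  ghomog q v -> gim (nd P i) (gdiff v) ->
  exists2 w, ghomog q.+1 w & gim (nd P i) (v - gdiff w).
Proof.
elim: j i q v => [|j IHj] i q v Nij jq hv dv.
  exists 0; first exact: ghomog0.
  move=> r l; exists 0; rewrite linear0; apply: esym; apply: finP; lia.
case: q jq hv dv => [|q] jq hv dv; first by lia.
have [w hw wE] := gim_ghomog_lift (ghomog_gdiff (a := a) hv) dv.
have [||//||z hz zE] := IHj i.+1 q w; [lia|lia| |].
  apply: (gim_ker (f := nd P i)); first exact: nd_exact.
  by rewrite gmap_gdiff wE gdiff_gdiff.
have [||||u hu uE] := @layers_exact _ _ hR _ _ mx B a L a0 tB H1B exB (P i) q.+1 (v - gmap (nd P i) z).
- exact: projective_dual_basis.
- by lia.
- by apply: ghomogB => //; apply: ghomog_morph.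
- rewrite linearB/= -gmap_gdiff -wE -linearB; apply/funext => r; apply/funext => l.
  by have [y yE] := zE r l; rewrite -[LHS]/(nd P i ((w - gdiff z) r l)) -yE nd_nd.
exists u => //; rewrite uE subKr; exact: gim_gmap.
Qed.

(** The class of c is D^J of the class of v, and f maps v to a cycle of degree 2J
with coefficients in M, hence to a boundary when 2J exceeds the projective
dimension of M. Layer J of that boundary has its unit coordinate f c in mM. *)
Theorem cocycle_into_ideal n (f : {linear F n -> M}) c : (N.*2 + n + 2 <= L)%N ->
  (forall y, f (nd F n y) = 0) -> f c \in ideal_mul m M.
Proof.
(* any J with 2J > N would do *)
move=> nL fd; pose J := N.+1.
pose u : gvec (F n) := layer 0%N (vunit c).
have du : gdiff u = 0.
  apply/funext => -[|r]; first by rewrite gdiff_layer_top act_d_unit.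
  by rewrite gdiff_layer_above.
have [|||v [hv vu dv]] := @divide_power n J u; first by rewrite /J; lia.
- by have := ghomog_layer (h := 0) (@vhomog_unit _ _ _ B (F n) c).
- by rewrite du => r i; exists 0; rewrite linear0.
have dfv : gdiff (gmap f v) = 0.
  rewrite -gmap_gdiff; apply/funext => r; apply/funext => i.
  by have [y yE] := dv r i; rewrite -[LHS]/(f (gdiff v r i)) -yE fd.
have hfv : ghomog J.*2 (gmap f v) by apply: ghomog_morph.
have [|w hw wE] := gim_ghomog_lift (f := naug P) hfv; first by move=> r i; apply: naug_surj.
have [||//||z hz zE] := @bounded_acyclic N 0 J.*2 w; [lia|by rewrite /J; lia| |].
  by apply: (gim_ker (f := naug P)); [apply: naug_exact|rewrite gmap_gdiff wE dfv].
have fvE : gmap f v = gdiff (gmap (naug P) z).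
  rewrite -gmap_gdiff -wE; apply/eqP; rewrite -subr_eq0 -linearB; apply/eqP.
  apply/funext => r; apply/funext => i; have [y yE] := zE r i.
  by rewrite -[LHS]/(naug P ((w - gdiff z) r i)) -yE naug_nd.
have -> : f c = gmap f v J one.
  by rewrite /gmap -[J]add0n vu /u /layer eqxx /vunit eqxx.
rewrite fvE; apply: gdiff_top_unit => //.
by apply: ghomog_morph.
Qed.

End Divide.
End Main.

(** * Free modules *)

Section FreeModules.
Variables (R : comNzRingType) (M : lmodType R) (B : {pred M}).
Hypothesis basisB : is_basis B.

(** Coordinates with an explicit support; [coordsP] adds vectors by enlarging the
supports, and independence makes the coordinates unique. *)
Definition coords (x : M) (a : M -> R) (s : seq M) : Prop :=
  [/\ uniq s, {subset s <= B}, forall b, b \notin s -> a b = 0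
    & x = \sum_(b <- s) a b *: b].

Lemma coordsW x a s t : uniq t -> {subset t <= B} -> {subset s <= t} ->
  coords x a s -> coords x a t.
Proof.
move=> ut tB st [us sB a0 ->]; split=> //.
  by move=> b bt; apply: a0; apply: contra bt; apply: st.
by apply/esym/big_uniq_sub => // b /a0 ->; rewrite scale0r.
Qed.

Lemma coordsP c x a s y a' t : coords x a s -> coords y a' t ->
  exists u, coords (c *: x + y) (fun b => c * a b + a' b) u.
Proof.
move=> xs yt; exists (undup (s ++ t)).
have uB : {subset undup (s ++ t) <= B}.
  by move=> b; rewrite mem_undup mem_cat => /orP[]; [case: xs|case: yt] => _ + _ _; apply.
have [|_ _ a0 ->] := @coordsW x a s (undup (s ++ t)) (undup_uniq _) uB _ xs.
  by move=> b bs; rewrite mem_undup mem_cat bs.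
have [|_ _ a'0 ->] := @coordsW y a' t (undup (s ++ t)) (undup_uniq _) uB _ yt.
  by move=> b bt; rewrite mem_undup mem_cat bt orbT.
split=> // [|b bu|]; first exact: undup_uniq.
  by rewrite a0// a'0// mulr0 addr0.
rewrite scaler_sumr -big_split; apply: eq_bigr => b _.
by rewrite scalerDl scalerA.
Qed.

Lemma coords_basis b : b \in B -> coords b (fun b' => (b' == b)%:R) [:: b].
Proof.
move=> bB; split=> //.
- by move=> b'; rewrite inE => /eqP ->.
- by move=> b'; rewrite inE => /negPf ->.
- by rewrite big_seq1 eqxx scale1r.
Qed.

Lemma coords_exists x : exists a s, coords x a s.
Proof.
have [[s [a [sB ->]]] _] := (basisB.1 x, basisB.2).
elim: s sB => [|b s IHs] sB.
  by exists (fun=> 0), [::]; split=> //; rewrite !big_nil.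
have [|a' [t st]] := IHs; first by move=> b' b's; apply: sB; rewrite inE b's orbT.
have [|t' h] := @coordsP (a b) _ _ _ _ _ _ (coords_basis (sB b _)) st.
  by rewrite mem_head.
by rewrite big_cons; eexists; exists t'; exact: h.
Qed.

Lemma coords_unique x a s a' t : coords x a s -> coords x a' t -> a = a'.
Proof.
move=> xa xa'; have [u [uu uB a0 ]] := coordsP (-1) xa xa'.
rewrite scaleN1r addNr => /esym x0; apply/funext => b.
apply/eqP; rewrite -subr_eq0 -opprB oppr_eq0 addrC -mulN1r; apply/eqP.
have [bu|/a0//] := boolP (b \in u).
by have := basisB.2 u _ uu uB x0 b bu.
Qed.

Definition coordf x : M -> R := sval (cid (coords_exists x)).

Lemma coordfP x : exists s, coords x (coordf x) s.
Proof. exact: svalP (cid (coords_exists x)). Qed.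

Lemma coordf_linear b : linear (fun x => coordf x b : R^o).
Proof.
move=> c x y; have [s xs] := coordfP x; have [t yt] := coordfP y.
have [u h] := coordsP c xs yt; have [v h'] := coordfP (c *: x + y).
by rewrite (coords_unique h' h).
Qed.

Definition coord b : {linear M -> R^o} := mk_linear (coordf_linear b).

Lemma coord_basis b : b \in B -> coord b b = 1.
Proof.
move=> bB; have [s bs] := coordfP b.
by rewrite /coord/= (coords_unique bs (coords_basis bB)) eqxx.
Qed.

Lemma coord_sum x : exists s, [/\ uniq s, {subset s <= B},
  forall b, b \notin s -> coord b x = 0 & x = \sum_(b <- s) coord b x *: b].
Proof. exact: coordfP. Qed.

Lemma basis_projective : projective_module M.
Proof.
move=> A C g f gsurj; have [y yP] := choice (fun b => gsurj (f b)).
have [s sP] := choice coord_sum.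
pose h x := \sum_(b <- s x) coord b x *: y b.
have hE x t : uniq t -> {subset s x <= t} -> h x = \sum_(b <- t) coord b x *: y b.
  move=> ut st; apply/esym/big_uniq_sub => //; first by have [] := sP x.
  by have [_ _ s0 _] := sP x => b /s0 ->; rewrite scale0r.
have hl : linear h.
  move=> c x z; pose t := undup (s (c *: x + z) ++ s x ++ s z).
  have sub (r : seq M) : {subset r <= s (c *: x + z) ++ s x ++ s z} -> {subset r <= t}.
    by move=> rs b /rs; rewrite mem_undup.
  rewrite !(hE _ t) ?undup_uniq//; try by apply: sub => b; rewrite !mem_cat => ->; rewrite ?orbT.
  rewrite scaler_sumr -big_split; apply: eq_bigr => b _.
  by rewrite linearP scalerDl scalerA.
exists (mk_linear hl) => x /=; rewrite linear_sum.
have [_ _ _ xE] := sP x; rewrite [in RHS]xE linear_sum; apply: eq_bigr => b _.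
by rewrite !linearZ/= yP.
Qed.

Lemma basis_nakayama (m : idealr R) : (forall x, x \in ideal_mul m M) -> is_zero M.
Proof.
move=> mM x; have [s [_ sB _ ->]] := coord_sum x.
case: s sB => [|b s] sB; first by rewrite big_nil.
have bB : b \in B by apply: sB; rewrite mem_head.
have : coord b b \in m.
  move: (mM b); apply: (@ideal_mul_ind _ m M (fun z => coord b z \in m)) => [|c y cm].
    split=> [|c y z ym zm]; first by rewrite linear0; apply: idealr0.
    by rewrite linearP; apply: rpredD => //; apply: (idealMr c ym).
  have -> : coord b (c *: y) = coord b y * c by rewrite linearZ; apply: mulrC.
  exact: (idealMr _ cm).
by rewrite coord_basis// idealr1.
Qed.

Lemma basis_functional : ~ is_zero M -> exists (phi : {linear M -> R^o}) b, phi b = 1.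
Proof.
move=> nz; have [[b bB]|noB] := pselect (exists b, b \in B).
  by exists (coord b), b; apply: coord_basis.
case: nz => x; have [[|b s] [_ sB _ ->]] := coord_sum x; first by rewrite big_nil.
by case: noB; exists b; apply: sB; rewrite mem_head.
Qed.

End FreeModules.

(** * The minimal resolution of the residue field over a regular ring *)

Section RegularCase.
Variables (R : comNzRingType) (m : idealr R) (hR : local_ring m).
Variables (x : nat -> R) (d : nat).
Hypothesis mx : forall a, a \in m <-> gen_ideal x d a.
Hypothesis reg : regular_seq x d.

(** The submodule (x_0, ..., x_(i-1)) N. *)
Definition gen_submod i (N : lmodType R) (y : N) : Prop :=
  exists c : nat -> N, y = \sum_(l < i) x l *: c l.

Lemma gen_submod_closed i (N : lmodType R) : submod (@gen_submod i N).
Proof.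
split; first by exists (fun=> 0); rewrite big1// => l _; rewrite scaler0.
move=> a _ _ [c ->] [c' ->]; exists (fun l => a *: c l + c' l).
rewrite scaler_sumr -big_split; apply: eq_bigr => l _.
by rewrite scalerDr !scalerA mulrC.
Qed.

Lemma gen_submod0 (N : lmodType R) (y : N) : gen_submod 0 y -> y = 0.
Proof. by case=> c ->; rewrite big_ord0. Qed.

Lemma gen_submodS i (N : lmodType R) (y : N) : gen_submod i.+1 y <-> exists c, gen_submod i (y - x i *: c).
Proof.
split=> [[c ->]|[c [c' yE]]]; first by exists (c i), c; rewrite big_ord_recr/= addrK.
exists (fun l => if l == i then c else c' l).
rewrite big_ord_recr/= eqxx -(subrK (x i *: c) y) yE; congr (_ + _).
by apply: eq_bigr => l _; rewrite ltn_eqF.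
Qed.

Lemma gen_submod_morph i (M N : lmodType R) (f : {linear M -> N}) y : gen_submod i y -> gen_submod i (f y).
Proof.
case=> c ->; exists (fun l => f (c l)); rewrite linear_sum.
by apply: eq_bigr => l _; rewrite linearZ.
Qed.

Lemma gen_submod_ideal_mul (N : lmodType R) (y : N) : gen_submod d y <-> y \in ideal_mul m N.
Proof.
split=> [[c ->]|].
  apply: rpred_sum => l _; apply: ideal_mulZ; apply/mx/mem_gen_ideal.
  exact: ltn_ord.
move: y; apply: ideal_mul_ind => [|_ y /mx[c ->]]; first exact: gen_submod_closed.
exists (fun l => c l *: y); rewrite scaler_suml; apply: eq_bigr => l _.
by rewrite scalerA mulrC.
Qed.

Lemma gen_ideal_gen_submod i (N : lmodType R) a (y : N) : gen_ideal x i a -> gen_submod i (a *: y).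
Proof.
case=> c ->; exists (fun l => c l *: y); rewrite scaler_suml; apply: eq_bigr => l _.
by rewrite scalerA mulrC.
Qed.

Lemma regular_flat i (N : lmodType R) (y : N) : dual_basis_property N -> (i < d)%N ->
  gen_submod i (x i *: y) -> gen_submod i y.
Proof.
move=> dN id_ xy; have [K [phi /(_ y (mem_head _ _)) ->]] := dN [:: y].
apply: submod_sum; first exact: gen_submod_closed.
move=> k _; apply: gen_ideal_gen_submod; apply: reg => //.
have [c cE] := gen_submod_morph (phi k) xy; exists c.
rewrite mulrC -[x i * _]/(x i *: (phi k y : R^o)) -linearZ cE.
by apply: eq_bigr => l _; rewrite [_ *: _]mulrC.
Qed.

Variables (F : nresolution (residue_field m)).
Hypothesis flatF : forall i, dual_basis_property (F i).
Hypothesis minF : forall i y, nd F i y \in ideal_mul m (F i).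

Lemma residue_field_killed (y : residue_field m) a : a \in m -> a *: y = 0.
Proof.
move=> am; have [z ->] := quot_piP y; rewrite -linearZ -[RHS](linear0 (quot_pi _)).
apply/quot_pi_eq; rewrite subr0 unfold_in -[_ *: _]/(a * z) mulrC.
exact: (idealMr z am).
Qed.

(** The homology of F/(x_0, ..., x_(i-1))F, which is Tor(R/(x_0, ..., x_(i-1)), k),
vanishes above degree i. If d z = x_i w modulo the first i elements, then w is a
cycle modulo them, since x_i is regular, hence d u by induction; now z - x_i u is
a cycle modulo the first i elements. *)
Lemma koszul_vanishing i n (z : F n.+1) : (i <= d)%N -> (i <= n)%N ->
  gen_submod i (nd F n z) -> exists u, gen_submod i (z - nd F n.+1 u).
Proof.
elim: i n z => [|i IHi] n z id_ i_n.
  move/gen_submod0 => /nd_exact[u <-]; exists u; rewrite subrr; exact: (submod0 (gen_submod_closed _ _)).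
case: n z i_n => [//|n] z i_n /gen_submodS[w zw].
have sI N := @gen_submod_closed i N.
have nw : gen_submod i (nd F n w).
  apply: regular_flat => //; have := gen_submod_morph (nd F n) zw.
  rewrite linearB nd_nd sub0r linearZ/= => h.
  by rewrite -[_ *: _]opprK -scaleN1r; apply: submodZ.
have [||u wu] := IHi n w _ _ nw; [exact: ltnW|by []|].
have [|||v zv] := IHi n.+1 (z - x i *: u); [exact: ltnW|exact: ltnW| |].
  have -> : nd F n.+1 (z - x i *: u) =
      (nd F n.+1 z - x i *: w) + x i *: (w - nd F n.+1 u).
    by rewrite linearB linearZ/= scalerBr addrA subrK.
  by apply: submodD => //; apply: submodZ.
by exists v; apply/gen_submodS; exists u; rewrite addrAC.
Qed.

(** The homology of F/(x_0, ..., x_(i-1))F in degree i contains a non-zero class z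
that m kills. The next class u comes from the connecting homomorphism: x_i z is d u modulo
the first i elements. *)
Lemma koszul_class i : (i <= d)%N -> exists z : F i,
  ~ (exists u, gen_submod i (z - nd F i u)) /\
  forall y, y \in m -> exists u, gen_submod i (y *: z - nd F i u).
Proof.
elim: i => [|i IHi] id_.
  have [z z1] := naug_surj F (quot_pi _ 1); exists z; split.
    move=> [u /gen_submod0/eqP]; rewrite subr_eq0 => /eqP zE; move: z1; rewrite zE naug_nd.
    rewrite -(linear0 (quot_pi _)) => /esym/quot_pi_eq.
    by rewrite subr0 unfold_in -[_ \in _]/(1 \in m) idealr1.
  move=> y ym; have [|u uE] := naug_exact (n := F) (y := y *: z).
    by rewrite linearZ/= residue_field_killed.
  by exists u; rewrite uE subrr; apply: (submod0 (gen_submod_closed _ _)).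
have [z [nz mz]] := IHi (ltnW id_); have sI N := @gen_submod_closed i N.
have xi : x i \in m by apply/mx/mem_gen_ideal.
have [u xu] := mz _ xi; exists u; split.
  move=> [v /gen_submodS[w h]]; apply: nz; exists w.
  apply: (regular_flat (@flatF i) id_).
  have := gen_submod_morph (nd F i) h; rewrite !linearB/= nd_nd subr0 linearZ/= => h'.
  have -> : x i *: z - x i *: nd F i w =
    (x i *: z - nd F i u) + (nd F i u - x i *: nd F i w) by rewrite addrA subrK.
  exact: submodD.
move=> y ym; have [u' yu'] := mz _ ym.
have [|||v h] := @koszul_vanishing i i (y *: u - x i *: u'); rewrite ?(ltnW id_)//.
  have -> : nd F i (y *: u - x i *: u') =
      x i *: (y *: z - nd F i u') - y *: (x i *: z - nd F i u).
    have -> : y *: (x i *: z - nd F i u) = x i *: (y *: z) - y *: nd F i u.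
      by rewrite scalerBr !scalerA mulrC.
    have -> : nd F i (y *: u - x i *: u') = y *: nd F i u - x i *: nd F i u'.
      by rewrite linearB !linearZ.
    by rewrite scalerBr opprB [RHS]addrC addrA subrK.
  by apply: submodB => //; apply: submodZ.
by exists v; apply/gen_submodS; exists u'; rewrite addrAC.
Qed.

Hypothesis freeF : forall i, free_module (F i).

(** For i = d the two previous lemmas speak of F/mF, whose differential is zero. *)
Theorem regular_resolution : is_zero (F d.+1) /\
  exists (phi : {linear F d -> R^o}) c, phi c = 1.
Proof.
split.
  have [B basisB] := freeF d.+1; apply: (basis_nakayama basisB (m := m)) => z.
  have [|||u zu] := @koszul_vanishing d d z; rewrite ?leqnn//; first by apply/gen_submod_ideal_mul; apply: minF.
  by rewrite -(subrK (nd F d.+1 u) z) rpredD ?minF//; apply/gen_submod_ideal_mul.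
have [B basisB] := freeF d; apply: (basis_functional basisB).
move=> z0; have [z [nz _]] := koszul_class (leqnn d); apply: nz; exists 0.
by rewrite [z]z0 linear0 subr0; apply: (submod0 (gen_submod_closed _ _)).
Qed.

End RegularCase.

(** * Comparison of resolutions *)

Section Comparison.
Variable R : comNzRingType.

(** Projectivity is applied to the map from E' onto the image of d, realised as the
kernel of the projection onto the cokernel. *)
Lemma projective_lift (P E' E : lmodType R) (d : {linear E' -> E}) (g : {linear P -> E}) :
  projective_module P -> (forall p, exists y, d y = g p) ->
  exists h : {linear P -> E'}, forall p, d (h p) = g p.
Proof.
move=> projP dg; pose q : {linear E -> coker d} := quot_pi (im_pred d).
have inK y : (exists y', d y' = y) -> y \in ker_pred q.
  move=> dy; apply/eqP; rewrite -[RHS](linear0 q); apply/quot_pi_eq.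
  by rewrite subr0; apply/asboolP.
pose d' y : kernel q := Kernel (inK (d y) (ex_intro _ y erefl)).
pose g' p : kernel q := Kernel (inK (g p) (dg p)).
have d'l : linear d' by move=> c y z; apply/val_inj; rewrite /= linearP.
have g'l : linear g' by move=> c y z; apply/val_inj; rewrite /= linearP.
have [|h hP] := projP _ _ (mk_linear d'l) (mk_linear g'l).
  move=> [y yq]; have /asboolP[z zE] : y \in im_pred d.
    by move: (yq) => /eqP; rewrite -(linear0 q) => /quot_pi_eq; rewrite subr0.
  by exists z; apply/val_inj.
by exists h => p; have /(congr1 val) := hP p.
Qed.

Lemma dependent_choice (T : nat -> Type) (ok : forall i, T i -> Prop)
    (Q : forall i, T i -> T i.+1 -> Prop) (t0 : T 0%N) : ok _ t0 ->
  (forall i t, ok i t -> exists t', Q i t t' /\ ok i.+1 t') ->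
  exists s : forall i, T i, s 0%N = t0 /\ forall i, Q i (s i) (s i.+1).
Proof.
move=> ok0 step; have next i (t : {t | ok i t}) :
    {t' : {t' | ok i.+1 t'} | Q i (sval t) (sval t')}.
  apply: cid; have [t' [Qt ot]] := step i _ (svalP t).
  by exists (exist _ t' ot).
pose s := nat_rect (fun i => {t | ok i t}) (exist _ t0 ok0) (fun i t => sval (next i t)).
by exists (fun i => sval (s i)); split=> // i; exact: svalP (next i (s i)).
Qed.

Variable A : lmodType R.
Variables (C E : nresolution A).
Hypothesis projC : nprojective C.

Lemma chain_map : exists u : forall i, {linear C i -> E i},
  (forall y, naug E (u 0%N y) = naug C y) /\
  forall i y, nd E i (u i.+1 y) = u i (nd C i y).
Proof.
have [u0 u0P] := projective_lift (@projC 0%N) (fun p => naug_surj E (naug C p)).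
have [||u [uE uP]] := @dependent_choice (fun i => {linear C i -> E i})
  (fun i u => forall y, exists z, nd E i z = u (nd C i y))
  (fun i u u' => forall y, nd E i (u' y) = u (nd C i y)) u0.
- by move=> y; apply: naug_exact; rewrite u0P naug_nd.
- move=> i u uok; have [u' u'P] := @projective_lift _ _ _ (nd E i) (u \o nd C i) (@projC i.+1) uok.
  exists u'; split=> // y; apply: nd_exact.
  by rewrite u'P /= nd_nd linear0.
by exists u; split=> //; rewrite uE.
Qed.

(** A chain map that induces zero on the resolved module is null-homotopic. *)
Lemma chain_homotopy (u : forall i, {linear C i -> E i}) :
  (forall y, naug E (u 0%N y) = 0) -> (forall i y, nd E i (u i.+1 y) = u i (nd C i y)) ->
  exists s : forall i, {linear C i -> E i.+1},
    (forall y, nd E 0%N (s 0%N y) = u 0%N y) /\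
    forall i y, nd E i.+1 (s i.+1 y) = u i.+1 y - s i (nd C i y).
Proof.
move=> u0 uP; have [s0 s0P] := @projective_lift _ _ _ (nd E 0%N) (u 0%N) (@projC 0%N)
  (fun p => naug_exact (u0 p)).
have lw i (s : {linear C i -> E i.+1}) : linear (fun y => u i.+1 y - s (nd C i y)).
  by move=> c y z; rewrite [u i.+1 _]linearP [nd C i _]linearP [s _]linearP/= opprD addrACA scalerBr.
have [||s [sE sP]] := @dependent_choice (fun i => {linear C i -> E i.+1})
  (fun i s => forall y, exists z, nd E i.+1 z = u i.+1 y - s (nd C i y))
  (fun i s s' => forall y, nd E i.+1 (s' y) = u i.+1 y - s (nd C i y)) s0.
- by move=> y; apply: nd_exact; rewrite linearB/= s0P uP subrr.
- move=> i s sok; have [s' s'P] := @projective_lift _ _ _ (nd E i.+1) (mk_linear (lw i s)) (@projC i.+1) sok.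
  exists s'; split=> // y; apply: nd_exact.
  by rewrite linearB/= s'P /= nd_nd linear0 subr0 uP subrr.
by exists s; split=> //; rewrite sE.
Qed.

End Comparison.

(** * Cocycles representing epsilon *)

Lemma predz (i : nat) : i%:Z = i.+1%:Z - 1. Proof. by lia. Qed.

Lemma succz (i : nat) : i.+1%:Z = i%:Z + 1. Proof. by lia. Qed.

Section Conversion.
Variables (R : comNzRingType) (C : complex R) (A : lmodType R).
Hypothesis resC : resolution C A.

Lemma resolution_aug : {e : {linear C 0 -> A} |
  (forall a, exists x, e x = a) /\ (forall x, e x = 0 <-> exists y, diff C 1 0 y = x)}.
Proof. by apply: cid; case: resC. Qed.

(** The equations replace the degrees j - 1 and j + 1 by variables, which avoids
transport between the modules in equal degrees. *)
Lemma resolution_exact (i j k : int) (y : C j) : 0 < j -> k = j - 1 -> i = j + 1 ->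
  diff C j k y = 0 -> exists z : C i, diff C i j z = y.
Proof. by move=> j0 kE iE; subst i k; case: resC => _ + _; apply. Qed.

Definition nresolution_of : nresolution A :=
  @NResolution R A (fun i => C i%:Z) (fun i => diff C i.+1%:Z i%:Z) (sval resolution_aug)
    (fun i => @diff_diff R C i.+2%:Z i.+1%:Z i%:Z)
    (fun y => ((svalP resolution_aug).2 _).2 (ex_intro _ y erefl))
    (fun a => (svalP resolution_aug).1 a)
    (fun y => ((svalP resolution_aug).2 y).1)
    (fun i y => @resolution_exact i.+2%:Z i.+1%:Z i%:Z y isT (predz i) (succz i.+1)).

Lemma nresolution_of_projective : (forall i, projective_module (C i)) ->
  nprojective nresolution_of.
Proof. by move=> projC i; apply: projC. Qed.

End Conversion.

Section EpsilonNeq0.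
Variables (R : comNzRingType) (m : idealr R) (P : complex R).

Definition is_cocycle (n : int) (M : lmodType R) (f : {linear P n -> M}) : Prop :=
  forall y, f (diff P (n + 1) n y) = 0.

Definition is_coboundary (n : int) (M : lmodType R) (f : {linear P n -> M}) : Prop :=
  exists h : {linear P (n - 1) -> M}, forall y, f y = h (diff P n (n - 1) y).

Lemma epsilon_neq0P n M : epsilon m P n M != 0 <->
  exists f : {linear P n -> M}, is_cocycle f /\ ~ is_coboundary (mod_ideal_pi m M \o f).
Proof.
split=> [|[f [fc fb]]]; last first.
  have fK : f \in ker_pred (precomp M (diff P (n + 1) n)).
    by apply/eqP/val_inj/funext => y; exact: fc.
  pose c : cocycle P n M := Kernel fK.
  apply/negP => /eqP e0; apply: fb.
  have := congr1 (fun g : {linear _ -> _} => g (Ext_class c)) e0.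
  rewrite -[LHS]/(Ext_map_fun _ _) Ext_map_class -[RHS](linear0 (quot_pi _)).
  move/quot_pi_eq; rewrite subr0 => /asboolP[h hE]; exists h => y.
  by have /(congr1 (fun g : {linear _ -> _} => g y)) := hE => /= ->.
move=> e0; apply: contrapT => no; move/negP: e0; apply; apply/eqP/val_inj/funext => u.
have [c ->] := quot_piP u; rewrite -[LHS]/(Ext_map_fun _ (Ext_class c)) Ext_map_class.
rewrite -[RHS](linear0 (quot_pi _)); apply/quot_pi_eq; rewrite subr0.
have [h hE] : is_coboundary (mod_ideal_pi m M \o ker_val c).
  apply: contrapT => cb; apply: no; exists (ker_val c); split=> // y.
  case: c {cb} => f /= /eqP fK.
  by have /(congr1 (fun g : {linear _ -> _} => g y)) := fK.
by apply/asboolP; exists h; apply/val_inj/funext => y; rewrite /= -hE.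
Qed.

End EpsilonNeq0.

Lemma zero_linear (R : comNzRingType) (U V : lmodType R) : linear (fun _ : U => 0 : V).
Proof. by move=> a x y; rewrite scaler0 addr0. Qed.

Section ModIdeal.
Variables (R : comNzRingType) (m : idealr R) (M : lmodType R).

Lemma mod_ideal_pi_eq0 y : mod_ideal_pi m M y = 0 <-> y \in ideal_mul m M.
Proof.
by rewrite -(linear0 (mod_ideal_pi m M)) -[in X in _ <-> X](subr0 y); exact: quot_pi_eq.
Qed.

Lemma mod_ideal_killed z : z \in ideal_mul m (mod_ideal m M) -> z = 0.
Proof.
move: z; apply: ideal_mul_ind => [|a z am].
  by split=> // a x y -> ->; rewrite scaler0 addr0.
have [y ->] := quot_piP z; rewrite -linearZ; apply/mod_ideal_pi_eq0.
exact: ideal_mulZ.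
Qed.

End ModIdeal.

Section Local.
Variables (R : comNzRingType) (m : idealr R) (hR : local_ring m).

(** With the least possible number of generators, a relation with a coefficient
outside m would express one generator by the others. *)
Lemma minimal_generators : exists e x, (forall a, a \in m <-> gen_ideal x e a) /\
  forall c : nat -> R, \sum_(l < e) c l * x l = 0 -> forall l, (l < e)%N -> c l \in m.
Proof.
pose gen e := `[< exists x, forall a, a \in m <-> gen_ideal x e a >].
have exg : exists e, gen e.
  case: (hR) => /(_ m)[n [g /generated_by_gen_ideal[x mx]]] _ _.
  by exists n; apply/asboolP; exists x.
case: (ex_minnP exg) => e /asboolP[x mx] emin; exists e, x; split=> // c c0 l le.
apply: contrapT => /negP/(local_unit hR)[y yc].
have e0 : (0 < e)%N by apply: leq_ltn_trans le.
suff : gen e.-1 by move/emin; rewrite -ltnS prednK// ltnn.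
(* the generators other than x l *)
pose x' j := x (bump l j); have iI := gen_ideal_closed x' e.-1.
have x'P j : (j < e)%N -> j != l -> gen_ideal x' e.-1 (x j).
  move=> je jl; have <- : x' (unbump l j) = x j by rewrite /x' unbumpK.
  by apply: mem_gen_ideal; rewrite /unbump; lia.
apply/asboolP; exists x' => a; split=> [/mx|].
  move: a; apply: gen_ideal_least => // j je.
  have [->|] := eqVneq j l; last exact: x'P.
  have -> : x l = - y * \sum_(j < e | j != Ordinal le) c j * x j.
    move: c0; rewrite (bigD1 (Ordinal le))//= => /eqP; rewrite addr_eq0 => /eqP cx.
    by rewrite mulNr -mulrN -cx mulrA yc mul1r.
  apply: idealM => //; apply: (submod_sum (M := R^o) iI) => k kl.
  by apply: idealM => //; apply: x'P.
move: a; apply: gen_ideal_least; first exact: ideal_idealr.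
by move=> j je; apply/mx/mem_gen_ideal; rewrite /bump; lia.
Qed.

Lemma noeth_finite (M : lmodType R) : finite_module M -> noeth M.
Proof.
move=> [n [g gP]] N sN; pose p (v : 'cV[R]_n) := \sum_i v i 0 *: g i.
have pl : linear p.
  move=> a v w; rewrite /p scaler_sumr -big_split; apply: eq_bigr => i _.
  by rewrite !mxE scalerDl scalerA.
have [|r [h [Nh hP]]] := @noeth_cV R n (local_noeth hR) (fun v => N (mk_linear pl v)).
  split; first by rewrite linear0; apply: submod0.
  by move=> a v w Nv Nw; rewrite linearP; apply: sN.2.
exists r, (fun i => mk_linear pl (h i)); split=> // y Ny.
have [a yE] := gP y; have vE : mk_linear pl (\col_i a i) = y.
  by rewrite /= /p yE; apply: eq_bigr => i _; rewrite mxE.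
have [|b bE] := hP (\col_i a i); first by rewrite vE.
by exists b; rewrite -vE bE linear_sum; apply: eq_bigr => i _; rewrite linearZ.
Qed.

(** M = (x_0, ..., x_(e-1)) M, and [nakayama] removes one generator at a time. *)
Lemma finite_nakayama (M : lmodType R) : finite_module M ->
  (forall y : M, y \in ideal_mul m M) -> is_zero M.
Proof.
move=> finM mM; have [e [x [mx _]]] := minimal_generators.
suff H i : (i <= e)%N -> forall y : M, gen_submod x (e - i) y.
  by move=> y; have := H e (leqnn e) y; rewrite subnn => /gen_submod0.
elim: i => [_ y|i IHi ie y].
  by rewrite subn0; apply/(gen_submod_ideal_mul mx).
have ei : (e - i = (e - i.+1).+1)%N by lia.
have sI := gen_submod_closed x (e - i.+1) M.
have [|||s /negP/(local_unit hR)[t ts]] := @nakayama R _ (local_prime hR) M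
  (@gen_submod _ x (e - i.+1) M) (fun=> True) (x (e - i.+1)%N) (noeth_finite finM) sI _ _ _ y I.
- by [].
- by apply/mx/mem_gen_ideal; lia.
- move=> z _; have := IHi (ltnW ie) z; rewrite ei => /gen_submodS[c h].
  exists 1, c; split=> //; first by rewrite idealr1.
  by rewrite scale1r.
by move/(submodZ sI t); rewrite scalerA ts scale1r.
Qed.

Lemma finite_projective_dimension_nat (M : lmodType R) : finite_projective_dimension M ->
  exists (P : nresolution M) N, nprojective P /\ forall i, (N <= i)%N -> is_zero (P i).
Proof.
move=> [P [[resP projP] [N PN]]]; exists (nresolution_of resP), (`|N|.+1)%N; split.
  exact: nresolution_of_projective.
by move=> i Ni; apply: PN; lia.
Qed.

Section Minimal.
Variable F : complex R.
Hypothesis hF : minimal_free_resolution F m (residue_field m).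

Lemma min_resolution : resolution F (residue_field m). Proof. by case: hF. Qed.

Let F' := nresolution_of min_resolution.

Lemma min_projective : nprojective F'.
Proof.
move=> i; case: hF => _ /(_ i%:Z)[B basisB] _; exact: basis_projective basisB.
Qed.

Lemma min_minimal i y : nd F' i y \in ideal_mul m (F' i).
Proof.
have h (j k : int) (z : F j) : k = j - 1 -> diff F j k z \in ideal_mul m (F k).
  by move=> ->; case: hF => _ _; apply.
by apply: h; apply: predz.
Qed.

Lemma min_kill y : y \in ideal_mul m (F' 0%N) -> exists y', nd F' 0%N y' = y.
Proof.
move=> /(ideal_mul_morph (naug F')) h; apply: naug_exact; move: h.
move: (naug F' y); apply: ideal_mul_ind => [|a z am]; last exact: residue_field_killed.
by split=> // a z w -> ->; rewrite scaler0 addr0.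
Qed.

Lemma singular_cocycle n (M : lmodType R) (f : {linear F' n -> M}) :
  ~ regular m -> finite_projective_dimension M ->
  (forall y, f (nd F' n y) = 0) -> forall c, f c \in ideal_mul m M.
Proof.
move=> nreg /finite_projective_dimension_nat[P [N [projP PN]]] fc c.
have [e [x [mx xmin]]] := minimal_generators.
have xsing : ~ regular_seq x e.
  by move=> reg; apply: nreg; apply/(regularP hR); exists e, x.
have [B [a [am a0 tB H1B exB]]] := singular_kmodule hR mx xmin xsing (N.*2 + n + 2).
apply: (cocycle_into_ideal hR mx am a0 tB H1B exB min_projective min_minimal min_kill projP PN) => //.
Qed.

Variable P : complex R.
Hypothesis hP : projective_resolution P (residue_field m).

Lemma proj_resolution : resolution P (residue_field m). Proof. by case: hP. Qed.

Let P' := nresolution_of proj_resolution.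

Lemma proj_projective : nprojective P'.
Proof. by apply: nresolution_of_projective; case: hP. Qed.

Lemma is_cocycleP (n : nat) (M : lmodType R) (f : {linear P' n -> M}) :
  is_cocycle (P := P) (n := n%:Z) f <-> forall y, f (nd P' n y) = 0.
Proof.
suff h (j : int) : j = n%:Z + 1 -> (is_cocycle (P := P) (n := n%:Z) f <-> forall y, f (diff P j n%:Z y) = 0).
  exact: (h n.+1%:Z (succz n)).
by move=> ->.
Qed.

Lemma is_coboundary0 (M : lmodType R) (f : {linear P' 0%N -> M}) :
  is_coboundary (P := P) (n := 0) f <-> forall y, f y = 0.
Proof.
have z : is_zero (P (0 - 1)) by case: proj_resolution => + _ _; apply.
split=> [[h hE] y|f0]; first by rewrite hE [diff _ _ _ _]z linear0.
by exists (mk_linear (@zero_linear _ _ _)) => y; rewrite f0.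
Qed.

Lemma is_coboundaryS (n : nat) (M : lmodType R) (f : {linear P' n.+1 -> M}) :
  is_coboundary (P := P) (n := n.+1%:Z) f <->
  exists h : {linear P' n -> M}, forall y, f y = h (nd P' n y).
Proof.
suff h (j : int) : j = n.+1%:Z - 1 -> (is_coboundary (P := P) (n := n.+1%:Z) f <->
    exists h : {linear P j -> M}, forall y, f y = h (diff P n.+1%:Z j y)).
  exact: (h n%:Z (predz n)).
by move=> ->.
Qed.

(** A cocycle f on P is homotopic to its composite with P -> F -> P, and that one
has image in mM by [singular_cocycle]; so f is a coboundary modulo m. *)
Lemma singular_epsilon n (M : lmodType R) : ~ regular m ->
  finite_projective_dimension M -> epsilon m P n M = 0.
Proof.
move=> nreg fM; apply/eqP/negPn/negP => /epsilon_neq0P[f [fc]]; apply.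
case: n f fc => [n|n] f fc; last first.
  exists (mk_linear (@zero_linear _ _ _)) => y.
  have z : is_zero (P (Negz n)) by case: proj_resolution => + _ _; apply.
  by rewrite [y]z linear0.
have {}fc := (is_cocycleP f).1 fc.
have [u [u0 uP]] := chain_map P' min_projective.
have [v [v0 vP]] := chain_map F' proj_projective.
have fu y : mod_ideal_pi m M (f (u n y)) = 0.
  apply/mod_ideal_pi_eq0; apply: (singular_cocycle (f := f \o u n) nreg fM) => z /=.
  by rewrite -uP fc.
have lw i : linear (fun y : P' i => y - u i (v i y)).
  by move=> c y z; rewrite [v i _]linearP [u i _]linearP opprD addrACA scalerBr.
have [||s [s0 sP]] := @chain_homotopy _ _ P' P' proj_projective (fun i => mk_linear (lw i)).
- by move=> y; rewrite linearB/= u0 v0 subrr.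
- by move=> i y; rewrite linearB/= uP vP.
case: n => [|n] in f fc fu *.
  apply/(is_coboundary0 (mod_ideal_pi m M \o f)) => y /=.
  rewrite -(subrK (u 0%N (v 0%N y)) y) linearD linearD fu addr0.
  by have /= <- := s0 y; rewrite fc linear0.
apply/(is_coboundaryS (mod_ideal_pi m M \o f)).
exists (mod_ideal_pi m M \o (f \o s n)) => y /=.
rewrite -{1}(subrK (u n.+1 (v n.+1 y)) y) linearD linearD fu addr0.
have /= := sP n y => /eqP; rewrite eq_sym subr_eq => /eqP ->.
by rewrite linearD fc add0r.
Qed.

(** The cocycle is z |-> phi (v z) y, where v compares P with F. A cycle c of F
modulo m with phi c = 1 detects it: its image in P is a cycle modulo m, on which
coboundaries with values in M/mM vanish, while the cocycle takes there a unit
multiple of y as value, because the composite F -> P -> F is the identity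
modulo m in degree d. *)
Lemma regular_epsilon d (M : lmodType R) (y : M) : is_zero (F' d.+1) ->
  (exists (phi : {linear F' d -> R^o}) c, phi c = 1) ->
  y \notin ideal_mul m M -> epsilon m P d%:Z M != 0.
Proof.
move=> Fd [phi [c phic]] yM.
have [u [u0 uP]] := chain_map P' min_projective.
have [v [v0 vP]] := chain_map F' proj_projective.
have fl : linear (fun z : P' d => phi (v d z) *: y).
  by move=> a z w; rewrite [v d _]linearP [phi _]linearP scalerDl scalerA.
apply/epsilon_neq0P; exists (mk_linear fl); split.
  apply/(is_cocycleP (mk_linear fl)) => z /=.
  by rewrite -vP [v d.+1 z]Fd !linear0 scale0r.
pose f : {linear P' d -> mod_ideal m M} := mod_ideal_pi m M \o mk_linear fl.
have lw i : linear (fun z : F' i => z - v i (u i z)).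
  by move=> a z w; rewrite [u i _]linearP [v i _]linearP opprD addrACA scalerBr.
have [||s [s0 sP]] := @chain_homotopy _ _ F' F' min_projective (fun i => mk_linear (lw i)).
- by move=> z; rewrite linearB/= v0 u0 subrr.
- by move=> i z; rewrite linearB/= vP uP.
(* F -> P -> F is homotopic to the identity, and F_(d+1) = 0 *)
have wc : c - v d (u d c) \in ideal_mul m (F' d).
  case: (d) c Fd {phi phic fl f} => [|k] c Fd.
    by have /= <- := s0 c; rewrite [s 0%N c]Fd linear0 rpred0.
  have /= := sP k c; rewrite [s k.+1 c]Fd linear0 => /esym/eqP; rewrite subr_eq0 => /eqP ->.
  by apply: ideal_mul_morph; apply: min_minimal.
move=> fb; have : f (u d c) = 0.
  move: fb; rewrite -/f; case: (d) c f {phic wc} => [|k] c f.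
    by move/(is_coboundary0 f).1.
  move/(is_coboundaryS f).1 => [h ->]; rewrite uP; apply: mod_ideal_killed.
  by do 2!apply: ideal_mul_morph; apply: min_minimal.
move/mod_ideal_pi_eq0 => /= phiy; move/negP: yM; apply.
have pm : phi (c - v d (u d c)) \in m.
  move: wc; move: (_ - _); apply: (@ideal_mul_ind _ m (F' d) (fun z => phi z \in m)) => [|a z am].
    split=> [|a z w zm wm]; first by rewrite linear0; apply: idealr0.
    by rewrite linearP; apply: rpredD => //; apply: (idealMr a zm).
  have -> : phi (a *: z) = phi z * a by rewrite linearZ; apply: mulrC.
  exact: (idealMr _ am).
have [t t1] := local_unit1 hR 1 pm.
have := rpredZ t phiy; rewrite scalerA.
suff -> : phi (v d (u d c)) = 1 - 1 * phi (c - v d (u d c)) by rewrite t1 scale1r.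
by rewrite mul1r linearB phic opprB addrC subrK.
Qed.

End Minimal.
End Local.

(** * The equivalence *)

Section FreeRankOne.
Variable R : comNzRingType.

(** The resolution of R by itself. *)
Definition concentrated_obj (i : int) : lmodType R :=
  if i == 0 then R^o : lmodType R else 'cV[R]_0 : lmodType R.

Definition concentrated : complex R :=
  @Complex R concentrated_obj (fun i j => mk_linear (@zero_linear R _ _))
    (fun i j x _ => erefl) (fun i j k x => erefl).

Lemma concentrated_zero i : i != 0 -> is_zero (concentrated i).
Proof.
rewrite /= /concentrated_obj => /negPf -> x.
by apply/matrixP => -[].
Qed.

Lemma regular_projective : projective_module R^o.
Proof.
move=> A B g f gs; have [y yP] := gs (f 1).
have hl : linear (fun a : R^o => a *: y) by move=> a b c; rewrite scalerDl scalerA.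
exists (mk_linear hl) => a /=; rewrite linearZ/= yP -linearZ; congr (f _).
exact: mulr1.
Qed.

Lemma zero_projective (M : lmodType R) : is_zero M -> projective_module M.
Proof.
move=> M0 A B g f _; exists (mk_linear (@zero_linear R M A)) => x /=.
by rewrite (M0 x) !linear0.
Qed.

Lemma finite_projective_dimension_regular : finite_projective_dimension R^o.
Proof.
exists concentrated; split; last first.
  by exists 0 => i i0; apply: concentrated_zero; lia.
split; last first.
  move=> i; have [->|i0] := eqVneq i 0; first exact: regular_projective.
  exact/zero_projective/concentrated_zero.
split=> [i i0|i x i0 _|].
- by apply: concentrated_zero; lia.
- exists 0; rewrite linear0; apply/esym/concentrated_zero.
  by lia.
- exists (idfun : {linear R^o -> R^o}); split=> [a|x]; first by exists a.
  by split=> [x0|[y <-]//]; exists 0; exact: esym x0.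
Qed.

Lemma finite_regular : finite_module R^o.
Proof.
by exists 1%N, (fun=> 1) => x; exists (fun=> x); rewrite big_ord1 [_ *: _]mulr1.
Qed.

End FreeRankOne.

Section FreeSummand.
Variable R : comNzRingType.

Lemma coker_zero_summand (U V : lmodType R) (d : {linear U -> V}) :
  is_zero U -> free_module V -> ~ is_zero V -> has_nonzero_free_summand (coker d).
Proof.
move=> U0 freeV V0; pose q : {linear V -> coker d} := quot_pi (im_pred d).
have qI : injective q.
  move=> x y /quot_pi_eq/asboolP[u]; rewrite [u]U0 linear0 => /esym/eqP.
  by rewrite subr_eq0 => /eqP.
have /choice[g gK] : forall u : coker d, exists x, q x = u.
  by move=> u; have [x ->] := quot_piP u; exists x.
have fl : linear (fun u => (g u, 0) : V * 'cV[R]_0).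
  move=> a u v; congr pair; last by apply/matrixP => -[].
  by apply: qI; rewrite linearP !gK.
exists V, ('cV[R]_0 : lmodType R), (mk_linear fl); split=> //.
exists (fun p => q p.1) => [u|[v w]] /=; first exact: gK.
by congr pair; [apply: qI; rewrite gK|apply/matrixP => -[]].
Qed.

Lemma free_summand_functional (U V : lmodType R) (d : {linear U -> V}) :
  has_nonzero_free_summand (coker d) ->
  exists (g : {linear V -> R^o}) c, g c = 1 /\ forall u, g (d u) = 0.
Proof.
move=> [L [K [f [[B basisB] L0 [f' fK f'K]]]]].
have [phi [b phib]] := basis_functional basisB L0.
pose q : {linear V -> coker d} := quot_pi (im_pred d).
have gl : linear (fun v => phi (f (q v)).1 : R^o).
  by move=> a v w; rewrite [q _]linearP [f _]linearP [phi _]linearP.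
have [c cE] := quot_piP (f' (b, 0)).
exists (mk_linear gl), c; split=> [|u] /=; first by rewrite /q -cE f'K.
suff -> : q (d u) = 0 by rewrite linear0 [phi _]linear0.
rewrite -(linear0 q); apply/quot_pi_eq; rewrite subr0.
by apply/asboolP; exists u.
Qed.

Lemma ideal_mul_regular (m : idealr R) a : a \in ideal_mul m R^o -> a \in m.
Proof.
move: a; apply: (@ideal_mul_ind _ m R^o (fun a => a \in m)) => [|a y am].
  exact: ideal_idealr.
by rewrite [_ *: _]mulrC; apply: (idealMr _ am).
Qed.

End FreeSummand.

Theorem theorem2p4 (R : comNzRingType) (m : idealr R) (hR : local_ring m)
    (P : complex R) (hP : projective_resolution P (residue_field m))
    (F : complex R) (hF : minimal_free_resolution F m (residue_field m)) :
  [<-> (* i *) regular m;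
       (* ii *) exists n : int, epsilon m P n R^o != 0;
       (* iii *) exists M : lmodType R, finite_projective_dimension M /\
                   exists n : int, epsilon m P n M != 0;
       (* iv *) exists2 d : nat, has_krull_dim R d &
                   forall M : lmodType R, finite_module M -> ~ is_zero M ->
                     epsilon m P d%:Z M != 0;
       (* v *) exists n : int,
                 has_nonzero_free_summand (coker (diff F n (n - 1)))].
Proof.
have R1 : ~ is_zero R^o by move=> /(_ 1)/eqP; rewrite oner_eq0.
have freeF i : free_module (F i) by have [_ + _] := hF; apply.
have data : regular m -> exists d, [/\ has_krull_dim R d,
    is_zero (nresolution_of (min_resolution hF) d.+1) &
    exists (phi : {linear nresolution_of (min_resolution hF) d -> R^o}) c, phi c = 1].
  move=> /(regularP hR)[d [x [mx reg]]]; exists d.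
  have [] := @regular_resolution R m x d mx reg (nresolution_of (min_resolution hF)).
  - by move=> i; apply: projective_dual_basis; apply: min_projective.
  - exact: min_minimal.
  - by move=> i; apply: freeF.
  by split=> //; apply: krull_dim_regular_seq mx reg.
have eps d M : is_zero (nresolution_of (min_resolution hF) d.+1) ->
    (exists (phi : {linear nresolution_of (min_resolution hF) d -> R^o}) c, phi c = 1) ->
    finite_module M -> ~ is_zero M -> epsilon m P d%:Z M != 0.
  move=> Fd phi fM M0.
  have [y /negP yM] : exists y : M, ~ y \in ideal_mul m M.
    apply: contrapT => no; apply: M0; apply: (finite_nakayama hR fM) => y.
    by apply: contrapT => yM; apply: no; exists y.
  exact: (regular_epsilon hR hP Fd phi yM).
have sing M n : finite_projective_dimension M -> epsilon m P n M != 0 -> regular m.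
  move=> fM; apply: contraPP => nreg; apply/negP; rewrite negbK; apply/eqP.
  exact: (singular_epsilon hR hF hP n nreg fM).
tfae.
- move=> /data[d [_ Fd phi]]; exists d%:Z.
  by apply: eps => //; apply: finite_regular.
- move=> [n e]; exists (R^o : lmodType R); split; last by exists n.
  exact: finite_projective_dimension_regular.
- move=> [M [fM [n e]]]; have /data[d [dimd Fd phi]] := sing M n fM e.
  by exists d => // M' fM' M'0; apply: eps.
- move=> [d _ /(_ R^o (finite_regular R) R1)].
  move=> /(sing _ _ (finite_projective_dimension_regular R))/data[d' [_ Fd phi]].
  exists d'.+1%:Z.
  suff h (j : int) : j = d'%:Z -> has_nonzero_free_summand (coker (diff F d'.+1%:Z j)).
    by apply: h; rewrite -predz.
  move=> ->; apply: coker_zero_summand => //.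
  by move=> z; case: phi => phi [c]; rewrite [c]z linear0 => /eqP; rewrite eq_sym oner_eq0.
- move=> [n /free_summand_functional[g [c [gc gd]]]].
  move: g c gc gd; move jE: (n - 1) => j; case: j jE => j jE g c gc gd; last first.
    have z : is_zero (F (Negz j)) by case: (min_resolution hF) => + _ _; apply.
    by move: gc; rewrite [c]z linear0 => /eqP; rewrite eq_sym oner_eq0.
  have {}gd (k : int) : k = j%:Z + 1 -> forall y : F k, g (diff F k j%:Z y) = 0.
    by move=> ->; have -> : j%:Z + 1 = n by lia.
  apply: contrapT => nreg.
  have := singular_cocycle hR (f := g : {linear nresolution_of (min_resolution hF) j -> R^o})
    nreg (finite_projective_dimension_regular R) (gd _ (succz j)) c.
  by rewrite gc => /ideal_mul_regular; rewrite idealr1.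
Qed.
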